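(* Assume that the Markov chain $(X_n)_{n\geq 0}$ is irreducible and aperiodic, that $\mathbb E(\xi_i)>0$ and $\mathbb E(\xi_i^2)<+\infty$ for every $i\in\mathbb X$, that $\rho$ is non-lattice, and that $k'(0)=0$. Then there exists a positive function $u:\mathbb X\times\mathbb N\to(0,+\infty)$ such that for any $(i,j)\in\mathbb X^2$ and any $z\in\mathbb N$, $z\neq 0$, $$\mathbb P_{i,z}\left(Z_n>0,\ X_n=j\right)\underset{n\to+\infty}{\sim}\frac{u(i,z)\,\boldsymbol\nu(j)}{\sqrt n}.$$
   Context: $\mathbb X$ is a finite set, $\mathbb N=\{0,1,2,\dots\}$, and $(X_n)_{n\ge0}$ is a homogeneous Markov chain on $\mathbb X$ with transition matrix $\mathbf P=(\mathbf P(i,j))_{i,j\in\mathbb X}$; $\mathbf P$ also acts on functions by $\mathbf Pg(i)=\sum_j\mathbf P(i,j)g(j)$. When the chain is irreducible and aperiodic, $\boldsymbol\nu$ denotes its unique invariant probability (positive on $\mathbb X$), and $\boldsymbol\nu(g)=\sum_i g(i)\boldsymbol\nu(i)$. For each $i\in\mathbb X$, $\xi_i$ is an $\mathbb N$-valued random variable with generating function $f_i(s)=\mathbb E(s^{\xi_i})$, $s\in[0,1]$, and $(\xi_i^{n,j})_{j,n\ge1}$ are i.i.d. copies of $\xi_i$; the families for different $i\in\mathbb X$ and the chain $(X_n)$ are independent. The branching process $(Z_n)_{n\ge0}$ in the environment $(X_n)$ is defined by $Z_0=z\in\mathbb N$ and $Z_n=\sum_{j=1}^{Z_{n-1}}\xi_{X_n}^{n,j}$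 for $n\ge1$ (empty sum $=0$). $\mathbb P_{i,z},\mathbb E_{i,z}$ denote the law and expectation of the Markov chain $(X_n,Z_n)_{n\ge0}$ started at $X_0=i$, $Z_0=z$; $\mathbb P_i,\mathbb E_i$ those of $(X_n)_{n\ge0}$ started at $X_0=i$. Set $\rho(i)=\ln f_i'(1)$ (so $f_i'(1)=\mathbb E\xi_i$), $S_0=0$, $S_n=\sum_{k=1}^n\rho(X_k)$. For $\lambda\in\mathbb R$, $k(\lambda)=\lim_{n\to\infty}\left(\mathbb E_i(e^{\lambda S_n})\right)^{1/n}$, which exists, does not depend on $i$ and is analytic in $\lambda$; one has $k'(0)=\boldsymbol\nu(\rho)$. $\rho$ is called non-lattice if for any $\theta,a\in\mathbb R$ there exist $m\ge0$ and a path $x_0,\dots,x_m$ in $\mathbb X$ with $\mathbf P(x_0,x_1)\cdots\mathbf P(x_{m-1},x_m)\mathbf P(x_m,x_0)>0$ and $\rho(x_0)+\cdots+\rho(x_m)-(m+1)\theta\notin a\mathbb Z$. *)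

(* Defs.v *)
From HB Require Import structures.
From mathcomp Require Import all_boot all_order all_algebra.
From mathcomp Require Import all_classical all_reals all_analysis.

Set Implicit Arguments.
Unset Strict Implicit.
Unset Printing Implicit Defensive.

Import Order.TTheory GRing.Theory Num.Theory.
Import numFieldNormedType.Exports.

Local Open Scope classical_set_scope.
Local Open Scope ring_scope.

Definition stochastic (R : realType) (E : finType) (P : E -> E -> R) : Prop :=
  (forall i j, 0 <= P i j) /\ (forall i, \sum_j P i j = 1).

Fixpoint nstep (R : realType) (E : finType) (P : E -> E -> R) (n : nat)
    (i j : E) : R :=
  if n is m.+1 then \sum_l P i l * nstep P m l j else (i == j)%:R.

Definition irreducible (R : realType) (E : finType) (P : E -> E -> R) : Prop :=
  forall i j, exists n, 0 < nstep P n i j.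

(* the gcd of the set of return times to i is 1 *)
Definition aperiodic (R : realType) (E : finType) (P : E -> E -> R) : Prop :=
  forall i d,
    (forall n, (0 < n)%N -> 0 < nstep P n i i -> (d %| n)%N) -> d = 1%N.

Definition invariant_probability (R : realType) (E : finType)
    (P : E -> E -> R) (nu : E -> R) : Prop :=
  [/\ forall i, 0 <= nu i, \sum_i nu i = 1
    & forall j, \sum_i nu i * P i j = nu j].

(* E(s^xi) for a random variable xi with law q; here and below xi is realized
   as the identity on the probability space (nat, q) *)
Definition genfun (R : realType) (q : probability nat R) (s : R) : R :=
  fine ('E_q[fun m : nat => (s ^+ m)%R])%E.

(* generating functions live on [0, 1], so f'(1) is a left derivative *)
Definition left_derivative (R : realType) (f : R -> R) (x : R) : R :=
  lim ((h^-1 * (f (x + h) - f x)) @[h --> (0 : R)^'-]).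

Definition rho (R : realType) (E : finType) (q : E -> probability nat R)
    (i : E) : R :=
  ln (left_derivative (genfun (q i)) 1).

Definition non_lattice (R : realType) (E : finType) (P : E -> E -> R)
    (r : E -> R) : Prop :=
  forall theta a : R, exists (m : nat) (x : nat -> E),
    0 < (\prod_(0 <= k < m) P (x k) (x k.+1)) * P (x m) (x 0%N) /\
    forall c : int,
      \sum_(0 <= k < m.+1) r (x k) - m.+1%:R * theta <> a * c%:~R.

Section Processes.
Context {R : realType} {d : measure_display} {T : measurableType d}.
Context {E : finType}.

Definition path_event (X : nat -> T -> E) (n : nat) (x : nat -> E) : set T :=
  [set w | forall k, (k <= n)%N -> X k w = x k].

(* X is, under mu, a homogeneous Markov chain with transition matrix P and
   X 0 = i; the Markov property is written without conditional probabilities *)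
Definition markov_chain (mu : probability T R) (P : E -> E -> R) (i : E)
    (X : nat -> T -> E) : Prop :=
  [/\ forall n x, measurable (X n @^-1` [set x]),
      mu (X 0%N @^-1` [set i]) = 1%E
    & forall n x, mu (path_event X n.+1 x) =
        (mu (path_event X n x) * (P (x n) (x n.+1))%:E)%E].

Definition copies (mu : probability T R) (q : E -> probability nat R)
    (xi : E -> nat -> nat -> T -> nat) : Prop :=
  forall e n j, measurable_fun setT (xi e n j) /\
    forall m, mu (xi e n j @^-1` [set m]) = q e [set m].

(* The variables xi e n j (over all e, n, j) are mutually independent and
   jointly independent of the process X *)
Definition independent (mu : probability T R) (X : nat -> T -> E)
    (xi : E -> nat -> nat -> T -> nat) : Prop :=
  forall (N : nat) (x : nat -> E) (s : seq (E * nat * nat))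
         (A : E * nat * nat -> set nat),
    uniq s ->
    mu (path_event X N x `&`
        \bigcap_(t in [set` s]) (xi t.1.1 t.1.2 t.2 @^-1` A t)) =
    (mu (path_event X N x) *
     \prod_(t <- s) mu (xi t.1.1 t.1.2 t.2 @^-1` A t))%E.

(* xi e n j stands for the variable usually indexed (n+1, j+1) with n+1, j+1
   starting from 1 *)
Fixpoint branching (X : nat -> T -> E) (xi : E -> nat -> nat -> T -> nat)
    (z n : nat) (w : T) : nat :=
  if n is m.+1 then
    (\sum_(j < branching X xi z m w) xi (X m.+1 w) m j w)%N
  else z.

Definition walk (r : E -> R) (X : nat -> T -> E) (n : nat) (w : T) : R :=
  \sum_(1 <= k < n.+1) r (X k w).

(* k(lambda); the starting point i of the chain enters through mu *)
Definition kfun (mu : probability T R) (r : E -> R) (X : nat -> T -> E)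
    (lambda : R) : R :=
  limn (fun n : nat =>
    (fine ('E_mu[fun w => expR (lambda * walk r X n w)%R])%E) `^ (n%:R^-1)).

End Processes.

(* Main.v *)
(* Conditionally on the environment the survival probability is
   [1 - (f_{X_1} o .. o f_{X_n}) (0) ^ z], so everything reduces to expectations
   over paths of the finite chain. Let [p_n] be the survival probability. The
   perturbed operator [P i j * e^(-l rho j)] has an approximate eigenfunction
   with eigenvalue [1 + kappa l^2], where [kappa > 0] by non-latticeness and the
   order one term vanishes since [k'(0) = 0] forces [nu (rho) = 0]. Killing the
   chain at rate [s = 1 / (1 + kappa l^2)] turns [1 - e^(-l y)] into an upper and,
   up to corrections, a lower barrier for the Abel means
   [(1 - s) sum_k s^k p_k], seen as functions of the logarithm [y] of the
   population: these means are [O(l)], and differ from [1 - z^(-l)] by [O(l)].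
   The branching property, applied at a time where [p_m] is small, shows that
   the Abel means divided by [l] converge as [l -> 0]. The limit is positive
   because the walk reaches high levels, where the lower barrier is effective.
   As [p_n] is nonincreasing, a Tauberian theorem gives [p_n ~ u / sqrt n], and
   the ergodic theorem, together with [p_n - p_(n+m) = o (p_n)], brings in
   [X_n = j]. *)

(* For a Brownian motion of variance 2 kappa per unit time started at [y], [1 - e^(-l y)] is the
   probability of not reaching 0 before an independent exponential time of rate kappa l^2: this is
   the origin of the barrier and of the killing rate. As 1 - s is of order l^2, a mean of order l is
   of order sqrt (1 - s), whence the exponent 1/2. The residual of the approximate eigenfunction is
   O(l^3) against a killing rate of order l^2, so each barrier is off by O(l). That is also the
   order of the main term: the barriers alone only bound the quotients by l. Comparing from time m
   on removes this ambiguity, since the bounded error is then paid only by populations alive at time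
   m. The lower barrier meets a further obstacle. By the second moments, 1 / (1 - f t) exceeds 1 /
   (f'(1) (1 - t)) by at most a constant C0, but this costs C0 e^(-y) at height [y], which is not
   negligible near 0. A multiple of l e^(-d y), with d small but independent of l, is strictly
   excessive and absorbs the loss. *)
Require Import Defs.
From HB Require Import structures.
From mathcomp Require Import all_boot all_order all_algebra.
From mathcomp Require Import all_classical all_reals all_analysis measurable_realfun.
From mathcomp Require Import ring lra zify.

Set Implicit Arguments.
Unset Strict Implicit.
Unset Printing Implicit Defensive.

Import Order.TTheory GRing.Theory Num.Theory.
Import numFieldNormedType.Exports.

Local Open Scope classical_set_scope.
Local Open Scope ring_scope.

(** * Elementary bounds and a Cauchy criterion *)

Lemma finite_bounded {R : realType} (I : finType) (f : I -> R) :
  exists2 c, 1 <= c & forall i, `|f i| <= c.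
Proof.
exists (1 + \sum_i `|f i|); first by rewrite lerDl sumr_ge0.
move=> i; rewrite (bigD1 i)//= addrCA lerDl addr_ge0//.
exact: sumr_ge0.
Qed.

Lemma finite_pos_bounded {R : realType} (I : finType) (f : I -> R) :
  (forall i, 0 < f i) -> exists2 c, 0 < c <= 1 & forall i, c <= f i.
Proof.
move=> f0; have [c c1 hc] := finite_bounded (fun i => (f i)^-1).
have c0 : 0 < c by apply: lt_le_trans c1.
exists c^-1; first by rewrite invr_gt0 c0 invf_le1.
move=> i; rewrite -[f i]invrK lef_pV2 ?posrE ?invr_gt0//.
by apply: le_trans (hc i); exact: ler_norm.
Qed.

(** Cauchy criterion in which the approximate limit [x] may depend on [e]; it serves wherever the
    limit is not known beforehand. *)
Lemma cvg_of_approx {R : realType} {T : Type} (F : set_system T)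
    {FF : ProperFilter F} (f : T -> R) :
  (forall e : R, 0 < e -> exists x : R, \forall t \near F, `|x - f t| <= e) ->
  cvg (f @ F).
Proof.
move=> h; apply: cauchy_cvg; apply: cauchy_exP => e e0.
have e20 : 0 < e / 2 by rewrite divr_gt0.
have [x hx] := h _ e20; exists x.
rewrite /fmapE -ball_normE /=; apply: filterS hx => t /= ht.
by apply: le_lt_trans ht _; rewrite ltr_pdivrMr// ltr_pMr// ltr1n.
Qed.

(** * Path expectations and the ergodic theorem *)

Section PathExpectation.
Context {R : realType} {E : finType} (P : E -> E -> R).

(** Expectation of [Psi] at the states visited at times 1 to [n], started from [i]. The start is
    left out of the list because generation 1 already reproduces in the environment at time 1. *)
Fixpoint pathE (n : nat) (Psi : seq E -> R) (i : E) : R :=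
  if n is m.+1 then \sum_j P i j * pathE m (fun s => Psi (j :: s)) j
  else Psi [::].

Lemma eq_pathE n Psi Psi' i : (forall s, Psi s = Psi' s) ->
  pathE n Psi i = pathE n Psi' i.
Proof.
elim: n Psi Psi' i => [|n IH] Psi Psi' i e /=; first exact: e.
by apply: eq_bigr => j _; rewrite (IH _ (fun s => Psi' (j :: s))).
Qed.

Lemma pathED n Psi Psi' i :
  pathE n (fun s => Psi s + Psi' s) i = pathE n Psi i + pathE n Psi' i.
Proof.
elim: n Psi Psi' i => [|n IH] Psi Psi' i //=.
by rewrite -big_split; apply: eq_bigr => j _; rewrite IH mulrDr.
Qed.

Lemma pathEZ n c Psi i : pathE n (fun s => c * Psi s) i = c * pathE n Psi i.
Proof.
elim: n Psi i => [|n IH] Psi i //=.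
by rewrite mulr_sumr; apply: eq_bigr => j _; rewrite IH mulrCA.
Qed.

Lemma pathEB n Psi Psi' i :
  pathE n (fun s => Psi s - Psi' s) i = pathE n Psi i - pathE n Psi' i.
Proof.
rewrite pathED; congr (_ + _); rewrite -mulN1r -pathEZ.
by apply: eq_pathE => s; rewrite mulN1r.
Qed.

Hypothesis hP : stochastic P.

Let P_ge0 i j : 0 <= P i j. Proof. by case: hP. Qed.
Let P_sum1 i : \sum_j P i j = 1. Proof. by case: hP. Qed.

Lemma le_pathE n Psi Psi' i : (forall s, Psi s <= Psi' s) ->
  pathE n Psi i <= pathE n Psi' i.
Proof.
elim: n Psi Psi' i => [|n IH] Psi Psi' i e /=; first exact: e.
by apply: ler_sum => j _; rewrite ler_wpM2l// IH.
Qed.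

Lemma pathE_cst n c i : pathE n (fun=> c) i = c.
Proof.
elim: n i => [|n IH] i //=.
by under eq_bigr do rewrite IH; rewrite -mulr_suml P_sum1 mul1r.
Qed.

Lemma pathE_ge0 n Psi i : (forall s, 0 <= Psi s) -> 0 <= pathE n Psi i.
Proof. by move=> h; rewrite -(pathE_cst n 0 i); exact: le_pathE. Qed.

Lemma pathE_le1 n Psi i : (forall s, Psi s <= 1) -> pathE n Psi i <= 1.
Proof. by move=> h; rewrite -(pathE_cst n 1 i); exact: le_pathE. Qed.

Lemma avg_le (c : R) (g : E -> R) i : (forall j, g j <= c) ->
  \sum_j P i j * g j <= c.
Proof.
move=> h; rewrite -[leRHS]mul1r -(P_sum1 i) mulr_suml.
by apply: ler_sum => j _; rewrite ler_wpM2l.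
Qed.

Lemma avg_ge (c : R) (g : E -> R) i : (forall j, c <= g j) ->
  c <= \sum_j P i j * g j.
Proof.
move=> h; rewrite -[leLHS]mul1r -(P_sum1 i) mulr_suml.
by apply: ler_sum => j _; rewrite ler_wpM2l.
Qed.

Lemma nstep_ge0 n i j : 0 <= nstep P n i j.
Proof.
elim: n i => [|n IH] i /=; first by rewrite ler0n.
by apply: sumr_ge0 => l _; rewrite mulr_ge0.
Qed.

Lemma nstep_pathE n (g : E -> R) i :
  pathE n (fun s => g (last i s)) i = \sum_j nstep P n i j * g j.
Proof.
elim: n i => [|n IH] i /=.
  rewrite (bigD1 i)//= eqxx mul1r big1 ?addr0// => j /negPf.
  by rewrite eq_sym => ->; rewrite mul0r.
under eq_bigr do rewrite IH mulr_sumr.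
rewrite exchange_big; apply: eq_bigr => j _.
by rewrite mulr_suml; apply: eq_bigr => l _; rewrite mulrA.
Qed.

Lemma nstep_sum1 n i : \sum_j nstep P n i j = 1.
Proof.
rewrite -[RHS](pathE_cst n 1 i) (nstep_pathE n (fun=> 1)).
by apply: eq_bigr => j _; rewrite mulr1.
Qed.

Lemma nstepD m n i j :
  nstep P (m + n) i j = \sum_l nstep P m i l * nstep P n l j.
Proof.
elim: m i => [|m IH] i /=.
  rewrite (bigD1 i)//= eqxx mul1r big1 ?addr0// => l /negPf.
  by rewrite eq_sym => ->; rewrite mul0r.
under eq_bigr do rewrite IH mulr_sumr.
rewrite exchange_big; apply: eq_bigr => l _.
by rewrite mulr_suml; apply: eq_bigr => k _; rewrite mulrA.
Qed.

Lemma nstepD_gt0 m n i l j : 0 < nstep P m i l -> 0 < nstep P n l j ->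
  0 < nstep P (m + n) i j.
Proof.
move=> h1 h2; rewrite nstepD (bigD1 l)//= ltr_pwDl ?mulr_gt0//.
by apply: sumr_ge0 => k _; rewrite mulr_ge0 ?nstep_ge0.
Qed.

Lemma harmonic_nstep n (g : E -> R) : (forall i, \sum_j P i j * g j = g i) ->
  forall i, \sum_j nstep P n i j * g j = g i.
Proof.
move=> hg i; rewrite -nstep_pathE.
elim: n i => [//|n IH] i /=.
by under eq_bigr do rewrite IH; exact: hg.
Qed.

Lemma avg_max_eq (w g : E -> R) (c : R) j : (forall l, 0 <= w l) ->
  \sum_l w l = 1 -> (forall l, g l <= c) -> \sum_l w l * g l = c ->
  0 < w j -> g j = c.
Proof.
move=> w0 w1 gc e wj.
have : \sum_l w l * (c - g l) = 0.
  under eq_bigr do rewrite mulrBr.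
  by rewrite sumrB e -mulr_suml w1 mul1r subrr.
move/eqP; rewrite psumr_eq0; last first.
  by move=> l _; rewrite mulr_ge0 // subr_ge0.
move/allP => /(_ j (mem_index_enum j)) /=.
by rewrite mulf_eq0 gt_eqF//= subr_eq0 => /eqP.
Qed.

Hypothesis hirr : irreducible P.

(** Maximum principle: at a maximum point [k], averaging over [nstep P n k] forces the maximal value
    at every state reached from [k], that is everywhere by irreducibility. *)
Lemma harmonic_cst (g : E -> R) : (forall i, \sum_j P i j * g j = g i) ->
  forall i j, g i = g j.
Proof.
move=> hg i j.
pose k := [arg max_(l > i) g l]%O.
have hk l : g l <= g k by rewrite /k; case: arg_maxP => // x _; apply.
suff H l : g l = g k by rewrite H (H j).
have [n hn] := hirr k l.
apply: (@avg_max_eq (nstep P n k) g (g k)) => //.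
- by move=> l'; exact: nstep_ge0.
- exact: nstep_sum1.
- exact: harmonic_nstep.
Qed.

Variable nu : E -> R.
Hypothesis hnu : invariant_probability P nu.

Lemma nu_avg (g : E -> R) : \sum_i nu i * (\sum_j P i j * g j) = \sum_j nu j * g j.
Proof.
under eq_bigr do rewrite mulr_sumr.
rewrite exchange_big; apply: eq_bigr => j _.
case: hnu => _ _ <-; rewrite mulr_suml.
by apply: eq_bigr => i _; rewrite mulrA.
Qed.

Lemma nu_nstep n j : \sum_i nu i * nstep P n i j = nu j.
Proof.
elim: n => [|n IH] /=.
  rewrite (bigD1 j)//= eqxx mulr1 big1 ?addr0// => l /negPf ->.
  by rewrite mulr0.
by rewrite (nu_avg (fun l => nstep P n l j)).
Qed.

Lemma nu_gt0 j : 0 < nu j.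
Proof.
case: hnu => nu0 nu1 _.
have [i hi] : exists i, 0 < nu i.
  apply: contrapT => /forallNP h.
  suff : (1 : R) = 0 by move/eqP; rewrite oner_eq0.
  rewrite -nu1 big1 // => i _; apply/eqP; rewrite eq_le nu0 andbT.
  by rewrite leNgt; apply/negP/h.
have [n hn] := hirr i j.
rewrite -(nu_nstep n) (bigD1 i)//= ltr_pwDl ?mulr_gt0//.
by apply: sumr_ge0 => k _; rewrite mulr_ge0 ?nstep_ge0.
Qed.

(* [I - P + 1 nu] is injective by the maximum principle, hence onto *)
Lemma poisson_equation (r : E -> R) : \sum_i nu i * r i = 0 ->
  exists h : E -> R, forall i, \sum_j P i j * h j - h i = r i.
Proof.
move=> r0; case: (hnu) => nu_ge0 nu1 _.
pose e := @enum_val E xpredT.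
(* Transpose of I - P + 1 nu, since functions are written as row vectors multiplying [M] from the
   left. *)
pose M : 'M[R]_#|E| := \matrix_(j, i) ((i == j)%:R - P (e i) (e j) + nu (e j)).
have ev (g : E -> R) i :
    ((\row_k g (e k)) *m M) 0 i = g (e i) - \sum_j P (e i) j * g j + \sum_j nu j * g j.
  rewrite mxE.
  under eq_bigr do rewrite !mxE mulrDr mulrBr.
  rewrite big_split/= sumrB; congr (_ - _ + _).
  - rewrite (bigD1 i)//= eqxx mulr1 big1 ?addr0// => l /negPf.
    by rewrite eq_sym => ->; rewrite mulr0.
  - rewrite [RHS](reindex _ (onW_bij _ (enum_val_bij E))) /=.
    by apply: eq_bigr => l _; rewrite mulrC.
  - rewrite [RHS](reindex _ (onW_bij _ (enum_val_bij E))) /=.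
    by apply: eq_bigr => l _; rewrite mulrC.
have rowE (v : 'rV[R]_#|E|) : v = \row_k (v 0 (enum_rank (e k))).
  by apply/rowP => k; rewrite mxE /e enum_valK.
have Mfree : row_free M.
  apply: inj_row_free => v vM.
  pose g x := v 0 (enum_rank x).
  have ev0 x : g x - \sum_j P x j * g j + \sum_j nu j * g j = 0.
    have := ev g (enum_rank x); rewrite /e enum_rankK => <-.
    by rewrite -/e /g -rowE vM mxE.
  (* Averaging the equation against [nu] cancels the I - P part and isolates the rank one term. *)
  have nug : \sum_j nu j * g j = 0.
    have : \sum_x nu x * (g x - \sum_j P x j * g j + \sum_j nu j * g j) = 0.
      by apply: big1 => x _; rewrite ev0 mulr0.
    under eq_bigr do rewrite mulrDr mulrBr.
    by rewrite big_split sumrB /= nu_avg subrr add0r -mulr_suml nu1 mul1r.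
  have gharm x : \sum_j P x j * g j = g x.
    by have := ev0 x; rewrite nug addr0 => /eqP; rewrite subr_eq0 => /eqP.
  have gc := harmonic_cst gharm.
  rewrite (rowE v); apply/rowP => k; rewrite !mxE -/(g _).
  have : \sum_j nu j * g (e k) = 0.
    by rewrite -[RHS]nug; apply: eq_bigr => j _; rewrite (gc _ j).
  by rewrite -mulr_suml nu1 mul1r.
pose v := (\row_k - r (e k)) *m invmx M.
pose g x := v 0 (enum_rank x).
exists g.
have ev1 x : g x - \sum_j P x j * g j + \sum_j nu j * g j = - r x.
  have := ev g (enum_rank x); rewrite /e enum_rankK => <-.
  rewrite -/e /g -rowE /v mulmxKV -?row_free_unit //.
  by rewrite mxE /e enum_rankK.
have nug : \sum_j nu j * g j = 0.
  have : \sum_x nu x * (g x - \sum_j P x j * g j + \sum_j nu j * g j) = 0.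
    under eq_bigr do rewrite ev1 mulrN.
    by rewrite sumrN r0 oppr0.
  under eq_bigr do rewrite mulrDr mulrBr.
  by rewrite big_split sumrB /= nu_avg subrr add0r -mulr_suml nu1 mul1r.
by move=> x; have := ev1 x; rewrite nug; lra.
Qed.

End PathExpectation.

(** The least positive gap [d] between two elements of [A] divides every element, so it is 1; two
    consecutive elements [b] and [b.+1] then generate everything from [b * b] on. *)
Lemma semigroup_cofinite (A : pred nat) :
  A 0%N -> (forall m n, A m -> A n -> A (m + n)%N) ->
  (exists n, (0 < n)%N && A n) ->
  (forall d, (forall n, (0 < n)%N -> A n -> (d %| n)%N) -> d = 1%N) ->
  exists N, forall n, (N <= n)%N -> A n.
Proof.
move=> A0 AD [n0 /andP[n00 An0]] Agcd.
have AM k n : A n -> A (k * n)%N.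
  by move=> An; elim: k => [|k IH]; rewrite ?mul0n// mulSn; exact: AD.
pose gap d := `[< (0 < d)%N /\ exists b, A b /\ A (b + d)%N >].
have exgap : exists d, gap d.
  by exists n0; apply/asboolP; split => //; exists 0%N; rewrite add0n.
case: (ex_minnP exgap) => d /asboolP[d0 [b [Ab Abd]]] dmin.
have d1 : d = 1%N.
  (* Otherwise [n %% d] would be a smaller gap, between [n %/ d * (b + d)] and [n %/ d * b + n]. *)
  apply: Agcd => n npos An; rewrite /dvdn; apply/negPn/negP => r0.
  have : gap (n %% d)%N.
    apply/asboolP; split; first by rewrite lt0n.
    exists ((n %/ d) * (b + d))%N; split; first exact: AM.
    have -> : ((n %/ d) * (b + d) + n %% d = n %/ d * b + n)%N.
      by rewrite mulnDr -addnA -divn_eq.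
    by apply: AD => //; exact: AM.
  by move/dmin; rewrite leqNgt ltn_mod d0.
move: Abd; rewrite d1 addn1 => Ab1.
exists (b * b)%N => n nb.
have [b0|bpos] := posnP b.
  by rewrite -[n]muln1; apply: AM; rewrite -[1%N]/(0.+1) -b0.
have qb : (n %% b <= n %/ b)%N.
  have := ltn_pmod n bpos; have := leq_div2r b nb; rewrite mulnK//; lia.
have -> : n = ((n %/ b - n %% b) * b + (n %% b) * b.+1)%N.
  rewrite mulnS addnCA -mulnDl subnK// addnC -divn_eq//.
by apply: AD; exact: AM.
Qed.

Section Ergodic.
Context {R : realType} {E : finType} (P : E -> E -> R).
Hypotheses (hP : stochastic P) (hirr : irreducible P) (haper : aperiodic P).

Lemma nstep_eventually_gt0 : exists N, forall i j, 0 < nstep P N i j.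
Proof.
have diag i : exists N, forall n, (N <= n)%N -> 0 < nstep P n i i.
  apply: semigroup_cofinite.
  - by rewrite /= eqxx ltr01.
  - by move=> m n; exact: nstepD_gt0.
  - have [l hl] : exists l, 0 < P i l.
      apply: contrapT => /forallNP h.
      suff : (1 : R) <= 0 by rewrite ler10.
      case: hP => _ /(_ i) <-; apply: sumr_le0 => l _.
      by rewrite leNgt; apply/negP/h.
    have [n hn] := hirr l i; exists n.+1; rewrite ltn0Sn /=.
    rewrite (bigD1 l)//= ltr_pwDl ?mulr_gt0//.
    by apply: sumr_ge0 => k _; rewrite mulr_ge0 ?nstep_ge0//; case: hP.
  - by move=> d hd; apply: (haper (i := i)).
have diag' ij : exists N, forall n, (N <= n)%N -> 0 < nstep P n ij.1 ij.2.
  case: ij => i j; have [N hN] := diag i; have [l hl] := hirr i j.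
  exists (N + l)%N => n hn; have -> : n = (n - l + l)%N by lia.
  by apply: (nstepD_gt0 hP) hl => //; apply: hN; lia.
have [N hN] := choice diag'.
exists (\max_ij N ij)%N => i j.
exact: (hN (i, j) _ (leq_bigmax (i, j))).
Qed.

Variable nu : E -> R.
Hypothesis hnu : invariant_probability P nu.

(** Doeblin's argument: the minorization [del * nu j <= nstep P N i j] contracts the distance to
    [nu] by the factor [1 - del] every [N] steps. *)
Lemma nstep_cvg_nu (eps : R) : 0 < eps ->
  exists m, forall i j, `|nstep P m i j - nu j| <= eps.
Proof.
move=> eps0; case: (hnu) => nu_ge0 nu1 _.
have [N hN] := nstep_eventually_gt0.
have nu_le1 j : nu j <= 1.
  by rewrite -nu1 (bigD1 j)//= lerDl; apply: sumr_ge0.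
have [del [del0 del1 hdel]] :
    exists del, [/\ 0 < del, del < 1 & forall i j, del * nu j <= nstep P N i j].
  have [c /andP[c0 c1] hc] := finite_pos_bounded (fun ij => hN ij.1 ij.2).
  exists (c / 2); split; [lra|lra|] => i j.
  apply: le_trans (hc (i, j)); have := nu_le1 j; have := nu_ge0 j; nra.
have contr k i j : `|nstep P (k * N) i j - nu j| <= (1 - del) ^+ k.
  elim: k i => [|k IH] i.
    rewrite mul0n /= expr0; have := nu_le1 j; have := nu_ge0 j.
    by case: (i == j) => /=; rewrite ?mulr1n ?mulr0n; move=> *; rewrite ler_norml; lra.
  (* The term [del * nu l] may be inserted because [nu] is invariant, so it integrates the second
     factor to 0. *)
  have -> : nstep P (k.+1 * N) i j - nu j =
      \sum_l (nstep P N i l - del * nu l) * (nstep P (k * N) l j - nu j).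
    rewrite mulSn nstepD.
    under [RHS]eq_bigr do rewrite mulrBr 2!mulrBl.
    rewrite !sumrB -!mulr_suml (nstep_sum1 hP) -mulr_sumr nu1.
    under [X in _ = _ - X - _]eq_bigr do rewrite -mulrA.
    by rewrite -mulr_sumr (nu_nstep hnu); ring.
  apply: le_trans (ler_norm_sum _ _ _) _.
  apply: le_trans (_ : \sum_l (nstep P N i l - del * nu l) * (1 - del) ^+ k <= _).
    apply: ler_sum => l _; rewrite normrM ger0_norm ?subr_ge0//.
    by rewrite ler_wpM2l ?subr_ge0.
  rewrite -mulr_suml sumrB (nstep_sum1 hP) -mulr_sumr nu1 mulr1 exprS.
  exact: lexx.
have /cvgrPdist_lt /(_ _ eps0) [k _ hk] : (fun k : nat => (1 - del) ^+ k) @ \oo --> (0 : R).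
  by apply: cvg_expr; rewrite ger0_norm; lra.
exists (k * N)%N => i j; apply: le_trans (contr k i j) _.
have := hk k (leqnn k); rewrite sub0r normrN ger0_norm; first exact: ltW.
by apply: exprn_ge0; lra.
Qed.

End Ergodic.

(** * The walk along paths and its variance *)

Section Coboundary.
Context {R : realType} {E : finType} (P : E -> E -> R) (r : E -> R).
Hypothesis hP : stochastic P.

(** The sum of [r] along a closed path telescopes to 0, against non-latticeness at theta = a = 0. *)
Lemma coboundary_lattice (v : E -> R) :
  (forall i j, 0 < P i j -> r j = v i - v j) -> ~ non_lattice P r.
Proof.
move=> hv /(_ 0 0) [m [x [pos /(_ 0)]]]; apply.
rewrite mul0r mulr0 subr0.
have Pge0 i j : 0 <= P i j by case: hP.
have prod0 : 0 <= \prod_(0 <= k < m) P (x k) (x k.+1) by apply: prodr_ge0.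
have Pk k : (k < m)%N -> 0 < P (x k) (x k.+1).
  move=> km; rewrite lt_neqAle Pge0 andbT eq_sym.
  apply: contraTneq pos => Pk0.
  rewrite (bigD1_seq k) ?mem_index_iota ?iota_uniq//= Pk0 !mul0r ltxx //.
have Pm : 0 < P (x m) (x 0%N).
  rewrite lt_neqAle Pge0 andbT eq_sym.
  by apply: contraTneq pos => ->; rewrite mulr0 ltxx.
rewrite big_nat_recl// (hv _ _ Pm).
rewrite (eq_big_nat _ _ (F2 := fun k => v (x k) - v (x k.+1))); last first.
  by move=> k /andP[_ km]; apply: hv; exact: Pk.
rewrite (eq_bigr (fun k => - (v (x k.+1) - v (x k)))); last first.
  by move=> k _; rewrite opprB.
by rewrite sumrN telescope_sumr//; ring.
Qed.

Hypothesis hlat : non_lattice P r.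
Hypothesis hirr : irreducible P.
Variable nu : E -> R.
Hypothesis hnu : invariant_probability P nu.

Lemma edge_sum_eq0 (F : E -> E -> R) :
  (forall i j, 0 < P i j -> 0 <= F i j) ->
  \sum_i nu i * (\sum_j P i j * F i j) = 0 ->
  forall i j, 0 < P i j -> F i j = 0.
Proof.
move=> F0 e i j Pij.
have PF i' j' : 0 <= P i' j' * F i' j'.
  have := (proj1 hP i' j'); rewrite le_eqVlt => /predU1P[<-|p]; first by rewrite mul0r.
  by rewrite mulr_ge0 ?F0// ltW.
have nuF i' : 0 <= nu i' * (\sum_j P i' j * F i' j).
  by rewrite mulr_ge0 ?sumr_ge0//; case: hnu.
move/eqP: e; rewrite psumr_eq0//.
move=> /allP /(_ i (mem_index_enum i)) /=.
rewrite mulf_eq0 gt_eqF ?(nu_gt0 hP hirr hnu)//= psumr_eq0//.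
move=> /allP /(_ j (mem_index_enum j)) /=.
by rewrite mulf_eq0 gt_eqF //= => /eqP.
Qed.

(** [reach i y] says that the walk issued from state [i] takes the value [y] at some time with
    positive probability. *)
Inductive reach : E -> R -> Prop :=
| reach0 i : reach i 0
| reachS i j y : 0 < P i j -> reach j y -> reach i (r j + y).

Lemma nstep_reach n i j : 0 < nstep P n i j ->
  exists y0, forall y, reach j y -> reach i (y0 + y).
Proof.
elim: n i => [|n IH] i /=.
  case: eqP => [-> _|_]; last by rewrite ltxx.
  by exists 0 => y; rewrite add0r.
move=> h.
have [l hl] : exists l, 0 < P i l * nstep P n l j.
  apply: contrapT => /forallNP hn; move: h; rewrite ltNge => /negP; apply.
  by apply: sumr_le0 => l _; rewrite leNgt; apply/negP/hn.
have Pil : 0 < P i l.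
  rewrite lt_neqAle (proj1 hP) andbT eq_sym.
  by apply: contraTneq hl => ->; rewrite mul0r ltxx.
have /IH [y0 hy0] : 0 < nstep P n l j by rewrite -(pmulr_rgt0 _ Pil).
exists (r l + y0) => y hy; rewrite -addrA; apply: reachS => //.
exact: hy0.
Qed.

Hypothesis hmean0 : \sum_i nu i * r i = 0.

(* were the sums along paths bounded above, their suprema would form a
   potential making [r] a coboundary *)
Lemma reach_unbounded i M : exists2 y, M <= y & reach i y.
Proof.
apply: contrapT => nex.
have bnd j : has_ubound [set y | reach j y].
  have [n hn] := hirr i j; have [y0 hy0] := nstep_reach hn.
  exists (M - y0) => y /hy0 hy.
  have : ~ M <= y0 + y by move=> h; apply: nex; exists (y0 + y).
  by move/negP; rewrite -ltNge; lra.
pose V j := sup [set y | reach j y].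
have Vge l j : 0 < P l j -> 0 <= V l - r j - V j.
  move=> Plj; suff : V j <= V l - r j by lra.
  apply: ge_sup; first by exists 0; exact: reach0.
  move=> y hy; suff : r j + y <= V l by lra.
  by apply: (ub_le_sup (bnd l)); exact: reachS.
(* The increments [V l - r j - V j] are nonnegative on edges and have mean 0 by invariance and zero
   drift, so they vanish on every edge. *)
have e : \sum_l nu l * (\sum_j P l j * (V l - r j - V j)) = 0.
  under eq_bigr => l _.
    under eq_bigr do rewrite -addrA -opprD mulrBr.
    rewrite sumrB -mulr_suml (proj2 hP) mul1r mulrBr.
    over.
  rewrite sumrB (nu_avg hnu (fun j => r j + V j)).
  under [X in _ - X]eq_bigr do rewrite mulrDr.
  by rewrite big_split /= hmean0 add0r subrr.
apply: (coboundary_lattice (v := V)) hlat => l j Plj.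
have := edge_sum_eq0 Vge e Plj; lra.
Qed.

(** The expression is half the stationary variance of the martingale increments [h j - r j - h i];
    were it 0, [r] would be the coboundary of [- h]. *)
Lemma asymptotic_variance_gt0 (h : E -> R) :
  (forall i, \sum_j P i j * (h j - r j) = h i) ->
  0 < \sum_i nu i * (r i ^+ 2 / 2 - r i * h i).
Proof.
move=> hh.
have key : \sum_i nu i * (r i ^+ 2 / 2 - r i * h i) =
    2^-1 * \sum_i nu i * (\sum_j P i j * (h j - r j - h i) ^+ 2).
  have -> : \sum_i nu i * (\sum_j P i j * (h j - r j - h i) ^+ 2) =
     \sum_i nu i * (\sum_j P i j * (h j - r j) ^+ 2) - \sum_i nu i * (h i) ^+ 2.
    rewrite -sumrB; apply: eq_bigr => i _; rewrite -mulrBr; congr (_ * _).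
    have -> : \sum_j P i j * (h j - r j - h i) ^+ 2 =
       \sum_j P i j * (h j - r j) ^+ 2 - 2 * h i * (\sum_j P i j * (h j - r j))
       + (\sum_j P i j) * h i ^+ 2.
      rewrite mulr_suml mulr_sumr -sumrB -big_split /=.
      by apply: eq_bigr => j _; ring.
    by rewrite hh (proj2 hP); ring.
  rewrite (nu_avg hnu (fun j => (h j - r j) ^+ 2)) -sumrB mulr_sumr.
  by apply: eq_bigr => i _; field.
have ge0 : 0 <= \sum_i nu i * (\sum_j P i j * (h j - r j - h i) ^+ 2).
  apply: sumr_ge0 => i _; rewrite mulr_ge0 ?sumr_ge0//; first by case: hnu.
  by move=> j _; rewrite mulr_ge0 ?sqr_ge0// (proj1 hP).
rewrite key mulr_gt0 ?invr_gt0// lt_neqAle ge0 andbT eq_sym.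
apply/negP => /eqP e.
apply: (coboundary_lattice (v := fun i => - h i)) hlat => i j Pij.
have := @edge_sum_eq0 (fun i j => (h j - r j - h i) ^+ 2)
  (fun i j _ => sqr_ge0 _) e i j Pij.
by move/eqP; rewrite expf_eq0 /= => /eqP; lra.
Qed.

End Coboundary.

(** * Expansion of the exponential and perturbation of the leading eigenvalue *)

Section ExponentialBounds.
Context {R : realType}.
Implicit Types x y B : R.

Lemma expR_sub1 x : expR x - 1 <= x * expR x.
Proof.
have := expR_ge1Dx (- x); rewrite expRN => h.
have := expR_gt0 x => e0.
have : (1 - x) * expR x <= 1 by rewrite -ler_pdivlMr// div1r.
lra.
Qed.

Lemma expR_taylor1 x : 0 <= expR x - 1 - x <= x ^+ 2 * expR `|x|.
Proof.
have h1 := expR_ge1Dx x; have h2 := expR_sub1 x; have e0 := expR_gt0 x.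
apply/andP; split; first by lra.
have [x0|x0] := leP 0 x.
  by rewrite ger0_norm// expr2; nra.
have : 1 <= expR `|x| by rewrite -expR0 ler_expR.
by rewrite expr2; nra.
Qed.

(** Mean value theorem for the remainder, whose derivative is the first order remainder bounded in
    [expR_taylor1]. *)
Lemma expR_taylor2 x B : `|x| <= B ->
  `|expR x - 1 - x - x ^+ 2 / 2| <= expR B * `|x| ^+ 3.
Proof.
move=> xB.
pose f := fun y : R => expR y - 1 - y - y ^+ 2 / 2.
have f0 : f 0 = 0 by rewrite /f expR0 expr0n /=; ring.
have df y : is_derive y 1 f (expR y - 1 - y).
  rewrite /f; apply: is_derive_eq.
  by rewrite /GRing.scale /=; field.
have bnd c : `|c| <= `|x| -> `|expR c - 1 - c| <= expR B * `|x| ^+ 2.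
  move=> cx; have /andP[h1 h2] := expR_taylor1 c.
  rewrite ger0_norm//; apply: le_trans h2 _.
  rewrite mulrC ler_pM ?expR_ge0 ?sqr_ge0//.
    by rewrite ler_expR; exact: le_trans xB.
  by rewrite -(real_normK (num_real c)) ler_sqr ?nnegrE.
have cf a b : {within `[a, b], continuous f}.
  apply: derivable_within_continuous => y _.
  by have [] := df y.
have [x0|x0] := leP 0 x.
  have [c] := MVT_segment x0 (fun y _ => df y) (cf _ _).
  rewrite in_itv/= f0 !subr0 => /andP[c0 cx] e.
  rewrite (_ : expR x - 1 - x - _ = f x)// e normrM exprSr mulrA ler_wpM2r ?normr_ge0 // bnd//.
  by rewrite !ger0_norm.
have [c] := MVT_segment (ltW x0) (fun y _ => df y) (cf _ _).
rewrite in_itv/= f0 !sub0r => /andP[cx c0] e.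
rewrite (_ : expR x - 1 - x - _ = f x)// -normrN e normrM normrN exprSr mulrA ler_wpM2r ?normr_ge0 // bnd//.
by rewrite !ler0_norm//; lra.
Qed.

End ExponentialBounds.

Section ApproximateEigenfunction.
Context {R : realType} {E : finType} (P : E -> E -> R) (r : E -> R).
Context (nu : E -> R).
Hypotheses (hP : stochastic P) (hirr : irreducible P).
Hypotheses (hnu : invariant_probability P nu) (hlat : non_lattice P r).
Hypothesis hmean0 : \sum_i nu i * r i = 0.

(* second order perturbation theory of the leading eigenvalue of
   [P i j * expR (- l * r j)]: [u l = 1 + l h + l ^+ 2 g], where [h] and [g]
   solve Poisson equations *)
Lemma approximate_eigenfunction :
  exists (kappa : R) (u : R -> E -> R) (C : R),
    [/\ 0 < kappa, 1 <= C,
     forall (l : R) i, 0 <= l <= 1 -> `|u l i - 1| <= C * l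
   & forall l i, 0 <= l <= 1 ->
      `|\sum_j P i j * (expR (- (l * r j)) * u l j) - (1 + kappa * l ^+ 2) * u l i|
        <= C * l ^+ 3].
Proof.
have nu1 : \sum_i nu i = 1 by case: hnu.
(* Cancels the terms of order l; solvable because the drift is zero, which is why the eigenvalue has
   no term of order one. *)
have [h hh] : exists h, forall i, \sum_j P i j * h j - h i = \sum_j P i j * r j.
  by apply: (poisson_equation hP hirr hnu); rewrite (nu_avg hnu r).
have hh' i : \sum_j P i j * (h j - r j) = h i.
  under eq_bigr do rewrite mulrBr.
  by rewrite sumrB -hh; ring.
have kap0 := asymptotic_variance_gt0 hP hlat hirr hnu hh'.
set kappa := \sum_i _ in kap0.
(* Cancels the terms of order l^2: [kappa] is exactly the constant for which the right-hand side has
   [nu]-mean 0. *)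
have [g hg] : exists g, forall i, \sum_j P i j * g j - g i =
    kappa - \sum_j P i j * (r j ^+ 2 / 2 - r j * h j).
  apply: (poisson_equation hP hirr hnu).
  under eq_bigr do rewrite mulrBr.
  by rewrite sumrB -mulr_suml nu1 mul1r (nu_avg hnu (fun j => r j ^+ 2 / 2 - r j * h j)) subrr.
have [B1 B11 hB1] := finite_bounded r.
have [B2 B21 hB2] := finite_bounded h.
have [B3 B31 hB3] := finite_bounded g.
have [B [B1' rB hB gB]] : exists B, [/\ 1 <= B, forall i, `|r i| <= B,
    forall i, `|h i| <= B & forall i, `|g i| <= B].
  exists (B1 + B2 + B3); split; first lra.
  - by move=> i; apply: le_trans (hB1 i) _; lra.
  - by move=> i; apply: le_trans (hB2 i) _; lra.
  - by move=> i; apply: le_trans (hB3 i) _; lra.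
pose u l i := 1 + l * h i + l ^+ 2 * g i.
pose C1 := expR B * B ^+ 3 * (3 * B) + 3 * B ^+ 3.
pose C := 2 * B + C1 + 2 * kappa * B.
have C10 : 0 <= C1.
  by rewrite /C1 addr_ge0// ?mulr_ge0 ?expR_ge0 ?exprn_ge0//; lra.
exists kappa, u, C; split => //.
- by rewrite /C; nra.
- move=> l i /andP[l0 l1]; rewrite /u.
  have -> : 1 + l * h i + l ^+ 2 * g i - 1 = l * (h i + l * g i) by ring.
  rewrite normrM ger0_norm// mulrC ler_wpM2r//.
  apply: le_trans (ler_normD _ _) _; rewrite normrM (ger0_norm l0).
  have := hB i; have := gB i; have := normr_ge0 (g i); rewrite /C; nra.
move=> l i /andP[l0 l1].
(* Remainder of order l^3 of the perturbed function. The average of the subtracted polynomial equals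
   [(1 + kappa * l ^+ 2) * u l i] up to order l^3, by the equations for [h] and [g]. *)
pose D j := expR (- (l * r j)) * u l j -
  (1 + l * (h j - r j) + l ^+ 2 * (g j + (r j ^+ 2 / 2 - r j * h j))).
have u3 j : `|u l j| <= 3 * B.
  rewrite /u; apply: le_trans (ler_normD _ _) _.
  apply: le_trans (lerD (ler_normD _ _) (lexx _)) _.
  rewrite normr1 [`|l * _|]normrM (ger0_norm l0) [`|l ^+ 2 * _|]normrM (ger0_norm (sqr_ge0 l)).
  have h1 : l * `|h j| <= 1 * B by rewrite ler_pM.
  have h2 : l ^+ 2 * `|g j| <= 1 * B by rewrite ler_pM ?sqr_ge0 ?exprn_ile1.
  lra.
have hD j : `|D j| <= C1 * l ^+ 3.
  pose x := - (l * r j).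
  have xl : `|x| <= l * B by rewrite /x normrN normrM ger0_norm// ler_wpM2l.
  have xB : `|x| <= B by apply: le_trans xl _; rewrite -[leRHS]mul1r ler_wpM2r//; lra.
  have T := expR_taylor2 xB.
  have -> : D j = (expR x - 1 - x - x ^+ 2 / 2) * u l j +
      l ^+ 3 * (- r j * g j + r j ^+ 2 * h j / 2 + l * (r j ^+ 2 * g j / 2)).
    by rewrite /D /u /x; field.
  apply: le_trans (ler_normD _ _) _.
  rewrite /C1 [leRHS]mulrDl; apply: lerD.
    have -> : expR B * B ^+ 3 * (3 * B) * l ^+ 3 = expR B * (l * B) ^+ 3 * (3 * B) by ring.
    rewrite normrM; apply: ler_pM => //; apply: le_trans T _.
    by rewrite ler_wpM2l ?expR_ge0// lerXn2r// nnegrE mulr_ge0//; lra.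
  rewrite normrM ger0_norm ?exprn_ge0// mulrC ler_wpM2r ?exprn_ge0//.
  have b2 : `|r j| ^+ 2 <= B ^+ 2 by rewrite lerXn2r// nnegrE; lra.
  have e1 : `|- r j * g j| <= B ^+ 3.
    rewrite normrM normrN; apply: le_trans (ler_pM _ _ (rB j) (gB j)) _ => //.
    by rewrite -expr2 ler_weXn2l.
  have e2 : `|r j ^+ 2 * h j / 2| <= B ^+ 3.
    rewrite [X in X <= _]normrM [`|_ * h j|]normrM normrX (@ger0_norm _ 2^-1) ?invr_ge0//.
    have := ler_pM (sqr_ge0 `|r j|) (normr_ge0 _) b2 (hB j).
    rewrite -exprSr; have := normr_ge0 (h j); have := sqr_ge0 `|r j|; nra.
  have e3 : `|l * (r j ^+ 2 * g j / 2)| <= B ^+ 3.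
    rewrite [X in X <= _]normrM [`|_ / 2|]normrM [`|_ * g j|]normrM normrX.
    rewrite (@ger0_norm _ 2^-1) ?invr_ge0// (ger0_norm l0).
    have := ler_pM (sqr_ge0 `|r j|) (normr_ge0 _) b2 (gB j).
    rewrite -exprSr; have := normr_ge0 (g j); have := sqr_ge0 `|r j|.
    set a := `|r j| ^+ 2; set b := `|g j|; move=> a0 b0 ab.
    have ab0 := mulr_ge0 a0 b0; nra.
  apply: le_trans (ler_normD _ _) _.
  apply: le_trans (lerD (ler_normD _ _) (lexx _)) _; lra.
have -> : \sum_j P i j * (expR (- (l * r j)) * u l j) - (1 + kappa * l ^+ 2) * u l i
   = \sum_j P i j * D j - l ^+ 3 * (kappa * h i + kappa * l * g i).
  have -> : \sum_j P i j * D j = \sum_j P i j * (expR (- (l * r j)) * u l j) -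
     (\sum_j P i j + l * (\sum_j P i j * (h j - r j)) +
     l ^+ 2 * ((\sum_j P i j * g j) + \sum_j P i j * (r j ^+ 2 / 2 - r j * h j))).
    rewrite -big_split/= !mulr_sumr -!big_split /= -sumrB.
    by apply: eq_bigr => j _; rewrite /D; ring.
  have -> : \sum_j P i j * g j = g i + kappa - \sum_j P i j * (r j ^+ 2 / 2 - r j * h j).
    by have := hg i; lra.
  by rewrite hh' (proj2 hP) /u; ring.
apply: le_trans (ler_normB _ _) _.
have -> : C * l ^+ 3 = 2 * B * l ^+ 3 + (C1 * l ^+ 3 + 2 * kappa * B * l ^+ 3).
  by rewrite /C; ring.
rewrite -[leLHS]add0r; apply: lerD.
  by rewrite !mulr_ge0 ?exprn_ge0//; lra.
apply: lerD.
  apply: le_trans (ler_norm_sum _ _ _) _.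
  rewrite -[leRHS]mul1r -(proj2 hP i) mulr_suml; apply: ler_sum => j _.
  by rewrite normrM ger0_norm ?(proj1 hP)// ler_wpM2l ?(proj1 hP).
rewrite normrM ger0_norm ?exprn_ge0// mulrC ler_wpM2r ?exprn_ge0//.
apply: le_trans (ler_normD _ _) _.
rewrite !normrM (ger0_norm l0) (gtr0_norm kap0).
have k1 : kappa * `|h i| <= kappa * B by rewrite ler_pM2l.
have k2 : kappa * l * `|g i| <= kappa * 1 * B.
  by rewrite ler_pM// ?mulr_ge0 ?ler_pM2l// ltW.
lra.
Qed.

End ApproximateEigenfunction.

(** * Offspring laws *)

Section PowerBounds.
Context {R : realType}.

Lemma onem_expr_ge0 (t : R) n : 0 <= t <= 1 -> 0 <= t ^+ n <= 1.
Proof. by move=> /andP[t0 t1]; rewrite exprn_ge0//= exprn_ile1. Qed.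

Lemma onem_expr_le (t : R) n : 0 <= t <= 1 -> 1 - t ^+ n <= n%:R * (1 - t).
Proof.
move=> t01; elim: n => [|n IH]; first by rewrite expr0 subrr mul0r.
have /andP[h0 h1] := onem_expr_ge0 n t01.
move: t01 => /andP[t0 t1]; rewrite exprSr -natr1 mulrDl mul1r; nra.
Qed.

(** With x = k (1 - t) this reads x / (1 + x) <= 1 - t ^ k, a lower bound for the survival of [k]
    families that depends on x alone. *)
Lemma expr_onem_le1 (t : R) k : 0 <= t <= 1 -> t ^+ k * (1 + k%:R * (1 - t)) <= 1.
Proof.
move=> t01; elim: k => [|k IH]; first by rewrite expr0; lra.
apply: le_trans IH; rewrite exprSr -mulrA.
have /andP[k0 _] := onem_expr_ge0 k t01.
rewrite ler_wpM2l// -natr1; move: t01 => /andP[t0 t1].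
have : 0 <= (k%:R : R) by rewrite ler0n.
move: (k%:R : R) => x x0.
have := mulr_ge0 x0 (sqr_ge0 (1 - t)); have := sqr_ge0 (1 - t); rewrite expr2; nra.
Qed.

(* tangent line inequality for [x / (1 + x)] at a point where [1 / (1 + x) = v] *)
Lemma onem_expr_ge (t v : R) n : 0 <= t <= 1 ->
  2 * v * (1 - t) * n%:R - v ^+ 2 * (1 - t) * n%:R
    - v ^+ 2 * (1 - t) ^+ 2 * n%:R ^+ 2 <= 1 - t ^+ n.
Proof.
move=> t01; have /andP[h0 h1] := onem_expr_ge0 n t01.
have n0 : 0 <= (n%:R : R) by rewrite ler0n.
have := expr_onem_le1 n t01; move: (n%:R : R) n0 => x x0.
have y0 : 0 <= x * (1 - t) by rewrite mulr_ge0// subr_ge0; case/andP: t01.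
have -> : 2 * v * (1 - t) * x - v ^+ 2 * (1 - t) * x
    - v ^+ 2 * (1 - t) ^+ 2 * x ^+ 2 =
   (x * (1 - t)) * (2 * v - v ^+ 2 * (1 + x * (1 - t))) by ring.
move: (x * (1 - t)) (t ^+ n) y0 h0 h1 => {x x0} y p y0 p0 p1 py.
have yp : 0 < 1 + y by lra.
have q1 : y / (1 + y) <= 1 - p.
  by rewrite ler_pdivrMr//; lra.
apply: le_trans q1; rewrite ler_pdivlMr//.
rewrite -subr_ge0.
have -> : y - y * (2 * v - v ^+ 2 * (1 + y)) * (1 + y) = y * (1 - v * (1 + y)) ^+ 2 by ring.
by rewrite mulr_ge0 ?sqr_ge0.
Qed.

End PowerBounds.

Section Offspring.
Context {R : realType} (q : probability nat R).
Hypothesis hmom2 : ('E_q[fun m : nat => (m%:R ^+ 2)%R] < +oo)%E.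

(** At most quadratic growth: the functions integrable under the second moment hypothesis, a class
    stable under [nconv]. *)
Definition growth (phi : nat -> R) :=
  exists C : R, forall m, `|phi m| <= C * (1 + m%:R ^+ 2).

Lemma growth_integrable phi : growth phi -> q.-integrable setT (EFin \o phi).
Proof.
move=> [C hC].
have i2 : q.-integrable setT (EFin \o (fun m : nat => (m%:R ^+ 2 : R))).
  apply/integrableP; split; first by [].
  move: hmom2; rewrite unlock; apply: le_lt_trans.
  by apply: ge0_le_integral => //= x _; rewrite normrX ger0_norm.
have i1 : q.-integrable setT (EFin \o cst (1 : R)) by exact: finite_measure_integrable_cst.
have i3 := integrableZl measurableT C (integrableD measurableT i1 i2).
apply: le_integrable i3 => // m _ /=.
by rewrite lee_fin; apply: le_trans (hC m) _; exact: ler_norm.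
Qed.

Lemma bounded_growth (phi : nat -> R) (C : R) : (forall m, `|phi m| <= C) -> growth phi.
Proof.
move=> h; exists C => m; apply: le_trans (h m) _.
have C0 : 0 <= C by apply: le_trans (h 0%N).
by rewrite mulrDr mulr1 lerDl mulr_ge0 ?sqr_ge0.
Qed.

Lemma growth_id : growth (fun m => m%:R : R).
Proof.
exists 1 => m; rewrite ger0_norm// mul1r.
by have := sqr_ge0 (m%:R - 1 : R); have : 0 <= (m%:R : R) by []; nra.
Qed.

Lemma growthD phi psi : growth phi -> growth psi -> growth (fun m => phi m + psi m).
Proof.
move=> [C1 h1] [C2 h2]; exists (C1 + C2) => m.
by apply: le_trans (ler_normD _ _) _; rewrite mulrDl lerD.
Qed.

Lemma growthZ c phi : growth phi -> growth (fun m => c * phi m).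
Proof.
by move=> [C h]; exists (`|c| * C) => m; rewrite normrM -mulrA ler_wpM2l.
Qed.

Lemma growth_shift (C : R) (phi : nat -> R) a : (forall m, `|phi m| <= C * (1 + m%:R ^+ 2)) ->
  forall m, `|phi (a + m)%N| <= (2 * C * (1 + a%:R ^+ 2)) * (1 + m%:R ^+ 2).
Proof.
move=> h m; apply: le_trans (h _) _; rewrite natrD.
have C0 : 0 <= C.
  by apply: le_trans (normr_ge0 _) (le_trans (h 0%N) _); rewrite expr0n addr0 mulr1.
rewrite -!mulrA mulrCA ler_wpM2l//.
have := sqr_ge0 (a%:R - m%:R : R); have : 0 <= (a%:R * m%:R : R) ^+ 2 by exact: sqr_ge0.
nra.
Qed.

(** Expectation of [phi] at a sum of [z] independent variables of law [q], as an iterated integral,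
    which spares product measures. *)
Fixpoint nconv (z : nat) (phi : nat -> R) : R :=
  if z is y.+1 then \int[q]_a (nconv y (fun b => phi (a + b)%N)) else phi 0%N.

Lemma eq_nconv z phi psi : phi =1 psi -> nconv z phi = nconv z psi.
Proof. by move=> /funext ->. Qed.

(** [K] does not depend on [phi]; hence the inner expectation again grows at most quadratically in
    the shift [a] and can be integrated. *)
Lemma nconv_bounded z : exists2 K : R, 0 <= K & forall (phi : nat -> R) (C : R),
  (forall m, `|phi m| <= C * (1 + m%:R ^+ 2)) -> `|nconv z phi| <= C * K.
Proof.
elim: z => [|z [K K0 IH]] /=.
  by exists 1 => // phi C /(_ 0%N); rewrite expr0n addr0.
pose M := \int[q]_a (1 + a%:R ^+ 2).
have gs : growth (fun a => 1 + a%:R ^+ 2).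
  by exists 1 => m; rewrite mul1r ger0_norm// addr_ge0 ?sqr_ge0.
exists (2 * K * M); first by rewrite !mulr_ge0// Rintegral_ge0// => x _; rewrite addr_ge0 ?sqr_ge0.
move=> phi C h.
have hb a : `|nconv z (fun b => phi (a + b)%N)| <= 2 * C * K * (1 + a%:R ^+ 2).
  by apply: le_trans (IH _ _ (growth_shift a h)) _; rewrite mulrAC.
have gc : growth (fun a => nconv z (fun b => phi (a + b)%N)) by exists (2 * C * K).
have ic := growth_integrable gc.
apply: le_trans (le_normr_Rintegral _ ic) _ => //.
have -> : C * (2 * K * M) = 2 * C * K * M by ring.
rewrite -RintegralZl//; last exact: growth_integrable.
apply: le_Rintegral => //; first exact: integrable_norm.
exact/growth_integrable/growthZ.
Qed.

Lemma growth_nconv z phi : growth phi -> growth (fun a => nconv z (fun b => phi (a + b)%N)).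
Proof.
move=> [C h]; have [K K0 hK] := nconv_bounded z; exists (2 * C * K) => a.
by apply: le_trans (hK _ _ (growth_shift a h)) _; rewrite mulrAC.
Qed.

Lemma growth_shift' phi a : growth phi -> growth (fun b => phi (a + b)%N).
Proof. by move=> [C h]; exists (2 * C * (1 + a%:R ^+ 2)); exact: growth_shift. Qed.

Lemma nconvD z phi psi : growth phi -> growth psi ->
  nconv z (fun a => phi a + psi a) = nconv z phi + nconv z psi.
Proof.
elim: z phi psi => [//|z IH] phi psi g1 g2 /=.
rewrite -RintegralD//; try exact/growth_integrable/growth_nconv.
by apply: eq_Rintegral => a _; rewrite IH//; exact: growth_shift'.
Qed.

Lemma nconvZ z c phi : growth phi -> nconv z (fun a => c * phi a) = c * nconv z phi.
Proof.
elim: z phi => [//|z IH] phi g1 /=.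
rewrite -RintegralZl//; last exact/growth_integrable/growth_nconv.
by apply: eq_Rintegral => a _; rewrite IH//; exact: growth_shift'.
Qed.

Lemma le_nconv z phi psi : growth phi -> growth psi -> (forall a, phi a <= psi a) ->
  nconv z phi <= nconv z psi.
Proof.
elim: z phi psi => [|z IH] phi psi g1 g2 h /=; first exact: h.
apply: le_Rintegral => //; try exact/growth_integrable/growth_nconv.
by move=> a _; apply: IH => //; exact: growth_shift'.
Qed.

Lemma nconv_cst z c : nconv z (fun=> c) = c.
Proof.
elim: z => [//|z IH] /=; under eq_Rintegral do rewrite IH.
by rewrite Rintegral_cst//= probability_setT /= mulr1.
Qed.

Let f := genfun q.
Let m1 := \int[q]_n (n%:R : R).

Lemma genfunE t : f t = \int[q]_n (t ^+ n).
Proof. by rewrite /f /genfun unlock. Qed.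

Lemma growth_expr t : 0 <= t <= 1 -> growth (fun n : nat => t ^+ n).
Proof.
move=> t01; apply: (@bounded_growth _ 1) => m.
by have /andP[h0 h1] := onem_expr_ge0 m t01; rewrite ger0_norm.
Qed.

Lemma nconv_expr z t : 0 <= t <= 1 -> nconv z (fun a => t ^+ a) = f t ^+ z.
Proof.
move=> t01; elim: z => [|z IH] /=; first by rewrite !expr0.
under eq_Rintegral => a _.
  rewrite (@eq_nconv _ _ (fun b => t ^+ a * t ^+ b)); last by move=> b; rewrite exprD.
  rewrite nconvZ ?IH; last exact: growth_expr.
  over.
by rewrite RintegralZr ?exprS ?genfunE//; exact/growth_integrable/growth_expr.
Qed.

Lemma nconv_id z : nconv z (fun a => a%:R : R) = z%:R * m1.
Proof.
elim: z => [|z IH] /=; first by rewrite mul0r.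
under eq_Rintegral => a _.
  rewrite (@eq_nconv _ _ (fun b => a%:R + b%:R)); last by move=> b; rewrite natrD.
  rewrite nconvD ?IH ?nconv_cst; last 2 first.
  - exact: (@bounded_growth _ `|a%:R|).
  - exact: growth_id.
  over.
rewrite RintegralD//; last 2 first.
- exact/growth_integrable/growth_id.
- by apply/growth_integrable/bounded_growth.
by rewrite Rintegral_cst//= probability_setT mulr1 -natr1 mulrDl mul1r addrC.
Qed.

Lemma genfun_itv t : 0 <= t <= 1 -> 0 <= f t <= 1.
Proof.
move=> t01; rewrite genfunE; apply/andP; split.
  by apply: Rintegral_ge0 => n _; have /andP[] := onem_expr_ge0 n t01.
rewrite -[leRHS](nconv_cst 1) /=.
apply: le_Rintegral => //; try exact/growth_integrable/growth_expr.
  by apply/growth_integrable/(@bounded_growth _ 1) => _; rewrite normr1.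
by move=> n _; have /andP[] := onem_expr_ge0 n t01.
Qed.

Lemma genfun_onemE t : 0 <= t <= 1 -> 1 - f t = \int[q]_n (1 - t ^+ n).
Proof.
move=> t01; rewrite genfunE RintegralB//; last 2 first.
- by apply/growth_integrable/(@bounded_growth _ 1) => _; rewrite normr1.
- exact/growth_integrable/growth_expr.
by rewrite Rintegral_cst//= probability_setT mulr1.
Qed.

Let growth_onem t : 0 <= t <= 1 -> growth (fun n : nat => 1 - t ^+ n).
Proof.
move=> t01; apply: (@bounded_growth _ 1) => m.
have /andP[h0 h1] := onem_expr_ge0 m t01.
by rewrite ler_norml; lra.
Qed.

Lemma genfun_onem_le t : 0 <= t <= 1 -> 1 - f t <= m1 * (1 - t).
Proof.
move=> t01; rewrite genfun_onemE// -RintegralZr//; last exact/growth_integrable/growth_id.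
apply: le_Rintegral => //.
- exact/growth_integrable/growth_onem.
- apply/growth_integrable.
  have := growthZ (1 - t) growth_id; congr growth.
  by apply/funext => n; rewrite mulrC.
- by move=> n _; exact: onem_expr_le.
Qed.

Lemma le_genfun t s : 0 <= t -> t <= s -> s <= 1 -> f t <= f s.
Proof.
move=> t0 ts s1; rewrite !genfunE; apply: le_Rintegral => //.
- by apply/growth_integrable/growth_expr; rewrite t0 (le_trans ts).
- by apply/growth_integrable/growth_expr; rewrite s1 (le_trans t0).
- by move=> n _; rewrite lerXn2r// nnegrE (le_trans t0).
Qed.

Hypothesis hmean : (0 < 'E_q[fun m : nat => m%:R%R])%E.

Lemma mean_gt0 : 0 < m1.
Proof.
apply: fine_gt0; move: hmean; rewrite unlock => -> /=.
have /integrableP[_] := growth_integrable growth_id.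
apply: le_lt_trans; apply: ge0_le_integral => //= n _.
by rewrite ger0_norm.
Qed.

Let m2 := \int[q]_n (n%:R ^+ 2 : R).

Let growth_sqr : growth (fun n : nat => n%:R ^+ 2).
Proof.
exists 1 => n; rewrite mul1r ger0_norm ?sqr_ge0//; lra.
Qed.

Let m2_ge0 : 0 <= m2. Proof. by apply: Rintegral_ge0 => n _; rewrite sqr_ge0. Qed.

(** Average of [onem_expr_ge] over the offspring law, at the value of [v] that maximizes the
    resulting bound. *)
Lemma genfun_onem_ge t : 0 <= t < 1 ->
  (1 - t) * (m1 ^+ 2 / (m1 + (1 - t) * m2)) <= 1 - f t.
Proof.
move=> /andP[t0 t1]; have t01 : 0 <= t <= 1 by rewrite t0 ltW.
have m0 := mean_gt0.
pose w := m1 + (1 - t) * m2.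
have w0 : 0 < w by rewrite /w ltr_pwDl// mulr_ge0//; lra.
pose v := m1 / w.
pose c1 := 2 * v * (1 - t) - v ^+ 2 * (1 - t).
pose c2 := - (v ^+ 2 * (1 - t) ^+ 2).
have -> : (1 - t) * (m1 ^+ 2 / w) = c1 * m1 + c2 * m2.
  by rewrite /c1 /c2 /v /w; field; rewrite -/w; lra.
rewrite genfun_onemE// -!RintegralZl//; last 2 first.
- exact/growth_integrable/growth_sqr.
- exact/growth_integrable/growth_id.
rewrite -RintegralD//; last 2 first.
- exact/growth_integrable/growthZ/growth_id.
- exact/growth_integrable/growthZ/growth_sqr.
apply: le_Rintegral => //.
- by apply/growth_integrable/growthD; apply/growthZ => //; exact: growth_id.
- exact/growth_integrable/growth_onem.
- move=> n _; apply: le_trans (onem_expr_ge v n t01); rewrite /c1 /c2.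
  by rewrite le_eqVlt; apply/orP; left; apply/eqP; ring.
Qed.

Lemma genfun_lt1 t : 0 <= t < 1 -> f t < 1.
Proof.
move=> t01; have := genfun_onem_ge t01; have m0 := mean_gt0.
move: t01 => /andP[t0 t1].
suff : 0 < (1 - t) * (m1 ^+ 2 / (m1 + (1 - t) * m2)) by lra.
rewrite mulr_gt0 ?subr_gt0// divr_gt0 ?exprn_gt0// ltr_pwDl// mulr_ge0//; lra.
Qed.

(** In terms of inverses the loss due to the curvature of [f] is additive and bounded, with constant
    [m2 / m1 ^+ 2]. Losses along a composition of generating functions then add up. *)
Lemma genfun_onem_inv : exists2 C, 0 <= C & forall t, 0 <= t < 1 ->
  (1 - f t)^-1 <= (m1 * (1 - t))^-1 + C.
Proof.
have m0 := mean_gt0.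
exists (m2 / m1 ^+ 2); first by rewrite divr_ge0// exprn_ge0// ltW.
move=> t t01; have h := genfun_onem_ge t01; have := genfun_lt1 t01.
move: t01 => /andP[t0 t1] ft1.
have w0 : 0 < m1 + (1 - t) * m2 by rewrite ltr_pwDl// mulr_ge0//; lra.
have -> : (m1 * (1 - t))^-1 + m2 / m1 ^+ 2 =
    ((1 - t) * (m1 ^+ 2 / (m1 + (1 - t) * m2)))^-1.
  by field; rewrite !gt_eqF//; lra.
rewrite lef_pV2 ?posrE ?subr_gt0//.
by rewrite mulr_gt0 ?subr_gt0// divr_gt0 ?exprn_gt0.
Qed.

Lemma genfun_left_derivative : left_derivative f 1 = m1.
Proof.
have m0 := mean_gt0.
apply/cvg_lim => //.
have e : \forall h \near (0 : R)^'-,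
   m1 ^+ 2 / (m1 + (- h) * m2) <= h^-1 * (f (1 + h) - f 1) <= m1.
  near=> h.
  have h0 : h < 0 by near: h; exact: nbhs_left_lt.
  have h1 : -1 < h by near: h; apply: nbhs_left_gt; lra.
  have f1 : f 1 = 1.
    rewrite genfunE; under eq_Rintegral do rewrite expr1n.
    by rewrite Rintegral_cst//= probability_setT mulr1.
  have -> : h^-1 * (f (1 + h) - f 1) = (1 - f (1 + h)) / (- h).
    by rewrite f1; field; lra.
  have t01 : 0 <= 1 + h < 1 by apply/andP; split; lra.
  have := genfun_onem_ge t01.
  have := @genfun_onem_le (1 + h); rewrite !opprD !addrA subrr !add0r.
  move=> b1 b2.
  have b1' := b1 ltac:(apply/andP; split; lra).
  by rewrite ler_pdivlMr ?oppr_gt0// ler_pdivrMr ?oppr_gt0// b1' andbT mulrC.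
apply: (squeeze_cvgr e); last exact: cvg_cst.
rewrite [X in _ --> X](_ : m1 = m1 ^+ 2 / (m1 + (- 0) * m2)); last first.
  by rewrite oppr0 mul0r addr0 expr2 mulfK// gt_eqF.
apply: cvgM; first exact: cvg_cst.
apply: cvgV; first by rewrite oppr0 mul0r addr0 gt_eqF.
apply: cvgD; first exact: cvg_cst.
apply: cvgM; last exact: cvg_cst.
apply: cvgN; apply: cvg_at_left_filter; exact: cvg_id.
Unshelve. all: by end_near.
Qed.

Lemma expR_log_mean : expR (ln (left_derivative (genfun q) 1)) = m1.
Proof. by rewrite genfun_left_derivative lnK// posrE mean_gt0. Qed.

End Offspring.

(** * Abel means of the survival probability *)

Section Abel.
Context {R : realType}.
Implicit Types (s c : R) (g : nat -> R).

(** Mean of [g] at a geometric time of parameter [s], on the event that this time is less than [n].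
    The truncation allows inductions on [n]. *)
Definition abel s n g := \sum_(k < n) (1 - s) * s ^+ k * g k.

Lemma abel0 s g : abel s 0 g = 0. Proof. by rewrite /abel big_ord0. Qed.

Lemma abelSl s n g : abel s n.+1 g = (1 - s) * g 0%N + s * abel s n (fun k => g k.+1).
Proof.
rewrite /abel big_ord_recl expr0 mulr1 mulr_sumr; congr (_ + _).
by apply: eq_bigr => k _; rewrite lift0 exprS; ring.
Qed.

Lemma eq_abel s n g g' : (forall k, g k = g' k) -> abel s n g = abel s n g'.
Proof. by move=> h; apply: eq_bigr => k _; rewrite h. Qed.

Lemma le_abel s n g g' : 0 <= s <= 1 -> (forall k, g k <= g' k) ->
  abel s n g <= abel s n g'.
Proof.
move=> /andP[s0 s1] h; apply: ler_sum => k _.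
by rewrite ler_wpM2l// mulr_ge0 ?subr_ge0 ?exprn_ge0.
Qed.

Lemma abelZ s n c g : abel s n (fun k => c * g k) = c * abel s n g.
Proof. by rewrite /abel mulr_sumr; apply: eq_bigr => k _; ring. Qed.

Lemma abelB s n g g' : abel s n (fun k => g k - g' k) = abel s n g - abel s n g'.
Proof. by rewrite /abel -sumrB; apply: eq_bigr => k _; ring. Qed.

Lemma abel_sum (I : finType) s n (w : I -> R) (g : I -> nat -> R) :
  abel s n (fun k => \sum_i w i * g i k) = \sum_i w i * abel s n (g i).
Proof.
rewrite /abel; under [RHS]eq_bigr do rewrite mulr_sumr.
rewrite exchange_big; apply: eq_bigr => k _ /=.
by rewrite mulr_sumr; apply: eq_bigr => i _; ring.
Qed.

Lemma abel_cst s n c : abel s n (fun=> c) = c * (1 - s ^+ n).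
Proof.
rewrite /abel; elim: n => [|n IH]; first by rewrite big_ord0 expr0 subrr mulr0.
by rewrite big_ord_recr /= IH exprS; ring.
Qed.

Lemma abel_ge0 s n g : 0 <= s <= 1 -> (forall k, 0 <= g k) -> 0 <= abel s n g.
Proof.
move=> /andP[s0 s1] h; apply: sumr_ge0 => k _.
by rewrite !mulr_ge0 ?subr_ge0 ?exprn_ge0.
Qed.

Lemma abel_le1 s n g : 0 <= s <= 1 -> (forall k, g k <= 1) -> abel s n g <= 1.
Proof.
move=> s01 h; apply: le_trans (le_abel _ s01 h) _.
have /andP[h0 h1] := onem_expr_ge0 n s01.
by rewrite abel_cst mul1r lerBlDr lerDl.
Qed.

End Abel.

(** X / (1 + X) is the decreasing function 1 / (1 + w) of w = 1 / X, and the left-hand side is its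
    value at 1 / Y + a. *)
Lemma odds_le {R : realType} (X Y a : R) : 0 < X -> 0 < Y -> 0 <= a ->
  X^-1 <= Y^-1 + a -> Y / (1 + Y + a * Y) <= X / (1 + X).
Proof.
move=> X0 Y0 a0 XY; have aY := mulr_ge0 a0 (ltW Y0).
have p1 : 0 < 1 + a * Y by lra.
have X1 : Y / (1 + a * Y) <= X.
  rewrite -lef_pV2 ?posrE ?divr_gt0//; apply: le_trans XY _.
  by rewrite le_eqVlt; apply/orP; left; apply/eqP; field; rewrite !gt_eqF.
rewrite ler_pdivrMr// in X1.
rewrite ler_pdivrMr; last by lra.
rewrite mulrAC ler_pdivlMr; last by lra.
by nra.
Qed.

(** * One-step inequalities and barriers for the truncated Abel means *)

Section Barrier.
Context {R : realType} {E : finType} (P : E -> E -> R) (r : E -> R).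
Context (f : E -> R -> R) (C0 : R).
Hypothesis hP : stochastic P.
Hypothesis f_itv : forall j (t : R), 0 <= t < 1 -> 0 <= f j t < 1.
Hypothesis f_le : forall j (t : R), 0 <= t < 1 -> 1 - f j t <= expR (r j) * (1 - t).
Hypothesis C0_ge0 : 0 <= C0.
Hypothesis f_inv : forall j (t : R), 0 <= t < 1 ->
  (1 - f j t)^-1 <= (expR (r j) * (1 - t))^-1 + C0.

Definition compgen (s : seq E) : R := foldr f 0 s.

Lemma compgen_itv s : 0 <= compgen s < 1.
Proof. by elim: s => [|j s IH] /=; rewrite ?lexx ?ltr01// f_itv. Qed.

(* [minE] and [harmE] with [y = ln z] bound the survival probability of [z]
   individuals: [x / (1 + x) <= 1 - t ^ z <= min 1 x] for [x = z (1 - t)] *)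
Definition minE k i y :=
  pathE P k (fun s => Num.min 1 (expR y * (1 - compgen s))) i.

Definition harmE k i y :=
  pathE P k (fun s => let x := expR y * (1 - compgen s) in x / (1 + x)) i.

Let arg_gt0 y s : 0 < expR y * (1 - compgen s).
Proof. by rewrite mulr_gt0 ?expR_gt0// subr_gt0; case/andP: (compgen_itv s). Qed.

Lemma minE_ge0 k i y : 0 <= minE k i y.
Proof. by apply: pathE_ge0 => // s; rewrite le_min ler01 ltW. Qed.

Lemma harmE_ge0 k i y : 0 <= harmE k i y.
Proof. by apply: pathE_ge0 => // s; rewrite divr_ge0// ltW// addr_gt0. Qed.

Lemma minE0_le1 i y : minE 0 i y <= 1.
Proof. by rewrite /minE /= ge_min lexx. Qed.

(** The first environment is the outermost generating function; bounding it by its tangent at 1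
    moves [y] to [y + r j]. *)
Lemma minES k i y : minE k.+1 i y <= \sum_j P i j * minE k j (y + r j).
Proof.
apply: ler_sum => j _; rewrite ler_wpM2l ?(proj1 hP)//; apply: le_pathE => // s.
rewrite le_min ge_min lexx /= ge_min; apply/orP; right.
rewrite expRD -mulrA ler_wpM2l ?expR_ge0// f_le//; exact: compgen_itv.
Qed.

Lemma le_minE k i y y' : y <= y' -> minE k i y <= minE k i y'.
Proof.
move=> yy; apply: le_pathE => // s.
rewrite le_min ge_min lexx /= ge_min; apply/orP; right.
by rewrite ler_wpM2r ?ler_expR// subr_ge0 ltW//; case/andP: (compgen_itv s).
Qed.

(** Below 0 the minimum is always its second argument, so [minE] is linear in [expR y]. This plays
    the role of a boundary condition: values after an overshoot below 0 reduce to those at 0. *)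
Lemma minE_lt0 k i y : y <= 0 -> minE k i y = expR y * minE k i 0.
Proof.
move=> y0; rewrite -pathEZ; apply: eq_pathE => s.
have /andP[c0 c1] := compgen_itv s.
have e1 : expR y <= 1 by rewrite -expR0 ler_expR.
rewrite expR0 mul1r !min_r //; first by rewrite lerBlDl lerDr.
have := expR_ge0 y; nra.
Qed.

Lemma harmE0_ge i y : 1 - expR (- y) <= harmE 0 i y.
Proof.
rewrite /harmE /= subr0 mulr1 expRN; have e0 := expR_gt0 y.
rewrite ler_pdivlMr ?addr_gt0// mulrDr mulr1 mulrBl mul1r mulVf ?gt_eqF//.
have : 0 < (expR y)^-1 by rewrite invr_gt0.
lra.
Qed.

Let arg_inv_le j y s :
  (expR y * (1 - compgen (j :: s)))^-1 <=
  (expR (y + r j) * (1 - compgen s))^-1 + C0 * expR (- y).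
Proof.
rewrite [compgen (j :: s)]/= invfM -expRN.
have -> : (expR (y + r j) * (1 - compgen s))^-1 + C0 * expR (- y) =
    expR (- y) * ((expR (r j) * (1 - compgen s))^-1 + C0).
  by rewrite expRD expRN -mulrA !invfM mulrDr [C0 * _]mulrC.
by rewrite ler_pM2l ?expR_gt0// f_inv//; exact: compgen_itv.
Qed.

(** The additive error in [f_inv] becomes [C0 * expR (- y)] at height [y]. Its effect is written as
    a multiple of [minE], so that the upper barrier makes it small. *)
Lemma harmES k i y :
  \sum_j P i j * (harmE k j (y + r j) - C0 * expR (- y) * minE k j (y + r j))
   <= harmE k.+1 i y.
Proof.
apply: ler_sum => j _; rewrite ler_wpM2l ?(proj1 hP)//.
rewrite /harmE /minE -pathEZ -pathEB; apply: le_pathE => // s /=.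
set a := C0 * expR (- y); set Y := expR (y + r j) * _; set X := expR y * _.
have Y0 : 0 < Y by exact: arg_gt0.
have X0 : 0 < X by exact: (arg_gt0 y (j :: s)).
have a0 : 0 <= a by rewrite mulr_ge0 ?expR_ge0.
have XY : X^-1 <= Y^-1 + a by exact: arg_inv_le.
have aY : 0 <= a * Y by apply: mulr_ge0 => //; exact: ltW.
have X2 := odds_le X0 Y0 a0 XY.
apply: le_trans X2.
set g := Y / (1 + Y + a * Y).
have w0 : 0 < 1 + Y + a * Y by lra.
have gE : g * (1 + Y) = Y - g * (a * Y) by rewrite /g; field; rewrite gt_eqF.
have g0 : 0 <= g by rewrite divr_ge0// ltW.
have g1 : g <= 1 by rewrite ler_pdivrMr// mul1r; lra.
have m1 : g * Y <= Num.min 1 Y * (1 + Y).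
  by have [Y1|Y1] := leP 1 Y; nra.
rewrite lerBlDr ler_pdivrMr; last by lra.
rewrite mulrDl gE.
have := ler_wpM2l a0 m1; move: (Num.min 1 Y) => mY; nra.
Qed.

(** A single transition is kept, with a multiplicative loss in place of the subtraction in [harmES],
    so that positivity is transported back along a path. *)
Lemma harmES_edge k i j y :
  P i j / (1 + C0 * expR (- y)) * harmE k j (y + r j) <= harmE k.+1 i y.
Proof.
rewrite /harmE [leRHS]/= (bigD1 j)//= -mulrA -[leLHS]addr0; apply: lerD; last first.
  apply: sumr_ge0 => l _; rewrite mulr_ge0 ?(proj1 hP)//.
  by apply: pathE_ge0 => // s /=; rewrite divr_ge0 ?addr_ge0// ltW// (arg_gt0 y (l :: s)).
rewrite ler_wpM2l ?(proj1 hP)// -pathEZ; apply: le_pathE => // s /=.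
set a := C0 * expR (- y); set Y := expR (y + r j) * _; set X := expR y * _.
have Y0 : 0 < Y by exact: arg_gt0.
have X0 : 0 < X by exact: (arg_gt0 y (j :: s)).
have a0 : 0 <= a by rewrite mulr_ge0 ?expR_ge0.
have XY : X^-1 <= Y^-1 + a by exact: arg_inv_le.
apply: le_trans (odds_le X0 Y0 a0 XY).
have aY := mulr_ge0 a0 (ltW Y0).
have w1 : 0 < 1 + Y + a * Y by lra.
have w2 : 0 < (1 + a) * (1 + Y) by rewrite mulr_gt0//; lra.
rewrite mulrCA -invfM ler_wpM2l ?(ltW Y0)// lef_pV2 ?posrE//.
lra.
Qed.

End Barrier.

Section BarrierBounds.
Context {R : realType} {E : finType} (P : E -> E -> R) (r : E -> R).
Context (f : E -> R -> R) (C0 : R).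
Hypothesis hP : stochastic P.
Hypothesis f_itv : forall j (t : R), 0 <= t < 1 -> 0 <= f j t < 1.
Hypothesis f_le : forall j (t : R), 0 <= t < 1 -> 1 - f j t <= expR (r j) * (1 - t).
Hypothesis C0_ge0 : 0 <= C0.
Hypothesis f_inv : forall j (t : R), 0 <= t < 1 ->
  (1 - f j t)^-1 <= (expR (r j) * (1 - t))^-1 + C0.
Context (kappa : R) (u : R -> E -> R) (C : R).
Hypothesis kappa0 : 0 < kappa.
Hypothesis C1 : 1 <= C.
Hypothesis u_near1 : forall (l : R) i, 0 <= l <= 1 -> `|u l i - 1| <= C * l.
Hypothesis u_eigen : forall (l : R) i, 0 <= l <= 1 ->
  `|\sum_j P i j * (expR (- (l * r j)) * u l j) - (1 + kappa * l ^+ 2) * u l i|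
     <= C * l ^+ 3.

(** The probability of surviving a step, chosen so that the killed and tilted kernel has approximate
    eigenvalue 1. *)
Definition killing (l : R) : R := (1 + kappa * l ^+ 2)^-1.

Lemma killing_den l : 1 <= 1 + kappa * l ^+ 2.
Proof. by rewrite lerDl mulr_ge0 ?sqr_ge0// ltW. Qed.

Lemma killing_gt0 l : 0 < killing l.
Proof. by rewrite invr_gt0; apply: lt_le_trans (killing_den l). Qed.

Lemma killing_le1 l : killing l <= 1.
Proof. by rewrite invf_le1 ?killing_den//; apply: lt_le_trans (killing_den l). Qed.

Lemma killing_itv l : 0 <= killing l <= 1.
Proof. by rewrite killing_le1 ltW// killing_gt0. Qed.

Lemma killing_lt1 l : 0 < l -> killing l < 1.
Proof.
move=> l0; rewrite invf_lt1 ?ltrDl ?mulr_gt0 ?exprn_gt0//.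
by apply: lt_le_trans (killing_den l).
Qed.

Lemma killingE l : killing l * (1 + kappa * l ^+ 2) = 1.
Proof. by rewrite mulVf// gt_eqF//; apply: lt_le_trans (killing_den l). Qed.

Lemma onem_killing l : 1 - killing l = killing l * kappa * l ^+ 2.
Proof. by have := killingE l; lra. Qed.

Lemma abel_minES s n i y : 0 <= s <= 1 ->
  abel s n.+1 (fun k => minE P f k i y) <=
  (1 - s) + s * \sum_j P i j * abel s n (fun k => minE P f k j (y + r j)).
Proof.
move=> s01; have /andP[s0 s1] := s01.
rewrite abelSl; apply: lerD.
  by rewrite ler_piMr ?subr_ge0// minE0_le1.
rewrite ler_wpM2l// -abel_sum; apply: le_abel => // k; exact: minES.
Qed.

Lemma abel_minE_le0 s n i y : y <= 0 ->
  abel s n (fun k => minE P f k i y) = expR y * abel s n (fun k => minE P f k i 0).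
Proof. by move=> y0; rewrite -abelZ; apply: eq_abel => k; apply: minE_lt0. Qed.

(** The function [1 - e^(-l y) u l] reproduces itself up to the residual of the eigenfunction, while
    the constant [K] shrinks to [killing l * K]. With [K] of order l, the difference is of order l^3
    and can pay for the residual. *)
Lemma eigen_step l K i y : 0 <= l <= 1 ->
  (1 - killing l) + killing l *
    (\sum_j P i j * (1 - expR (- (l * (y + r j))) * u l j + K))
  = 1 - expR (- (l * y)) * u l i + killing l * K
    - killing l * expR (- (l * y)) *
      (\sum_j P i j * (expR (- (l * r j)) * u l j) - (1 + kappa * l ^+ 2) * u l i).
Proof.
move=> l01.
have -> : \sum_j P i j * (1 - expR (- (l * (y + r j))) * u l j + K) =
    (1 + K) - expR (- (l * y)) * (\sum_j P i j * (expR (- (l * r j)) * u l j)).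
  rewrite -[X in X - _]mul1r -(proj2 hP i) mulr_suml mulr_sumr -sumrB.
  apply: eq_bigr => j _.
  have -> : - (l * (y + r j)) = - (l * y) + - (l * r j) by ring.
  by rewrite expRD; ring.
have := killingE l; set S := \sum_j _; set s := killing l.
set e := expR _; set w := 1 + _ => sw.
have -> : 1 - e * u l i = 1 - e * u l i * (s * w) by rewrite sw mulr1.
ring.
Qed.

(** Induction on the truncation against the supersolution [Phi] on the half line [0 <= y]. *)
Lemma minE_upper : exists l0 K : R, [/\ 0 < l0, l0 <= 1, 1 <= K &
  forall (l : R) n i y, 0 < l <= l0 -> 0 <= y ->
    abel (killing l) n (fun k => minE P f k i y) <= 1 - expR (- (l * y)) + K * l].
Proof.
have C1' := C1; have k0 := kappa0.
have [B B1 rB] := finite_bounded r.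
have B0 : 0 <= B by lra.
(* [C] serves the case [n = 0], [C / kappa] pays for the residual through [(1 - s) * (K * l)], and
   [2 * expR B ^+ 2] pays for overshoots below 0. The [C] added in the final constant removes [u l]
   from the bound. *)
pose K := C + C / kappa + 2 * expR B ^+ 2.
have eB0 := expR_gt0 B.
have eB1 : 1 <= expR B by rewrite -expR0 ler_expR.
have eB2 : 0 <= expR B ^+ 2 by exact: sqr_ge0.
have Ck : 0 <= C / kappa by rewrite divr_ge0 ?(ltW kappa0) ?(le_trans ler01 C1).
exists (2 * C)^-1, (K + C); split.
- by rewrite invr_gt0; lra.
- by rewrite invf_le1; lra.
- by rewrite /K; lra.
move=> l n i y /andP[l0 lC].
have l1 : l <= 1 by apply: le_trans lC _; rewrite invf_le1; lra.
have l01 : 0 <= l <= 1 by rewrite ltW.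
have Cl : C * l <= 1 / 2.
  have : l * (2 * C) <= 1 by rewrite -ler_pdivlMr ?div1r//; lra.
  lra.
have ub j : 1 - C * l <= u l j <= 1 + C * l.
  by have := u_near1 j l01; rewrite ler_norml => /andP[h1 h2]; apply/andP; split; lra.
have s01 := killing_itv l; set s := killing l in s01 *.
have s0 : 0 < s := killing_gt0 l.
pose Phi i y := 1 - expR (- (l * y)) * u l i + K * l.
suff main : forall n i y, 0 <= y -> abel s n (fun k => minE P f k i y) <= Phi i y.
  move=> y0; apply: le_trans (main n i y y0) _; rewrite /Phi.
  have e1 : expR (- (l * y)) <= 1 by rewrite -expR0 ler_expR oppr_le0 mulr_ge0// ltW.
  have e0 := expR_gt0 (- (l * y)); have /andP[h1 h2] := ub i.
  have a0 : 0 <= C * l by lra.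
  have k1 : 0 <= expR (- (l * y)) * (u l i - (1 - C * l)) by rewrite mulr_ge0 ?subr_ge0// ltW.
  have k2 : 0 <= (1 - expR (- (l * y))) * (C * l) by rewrite mulr_ge0 ?subr_ge0.
  by move: k1 k2; rewrite [(K + C) * l]mulrDl; lra.
have C_K : C <= kappa * K.
  have : C / kappa <= K by rewrite /K -addrA addrCA lerDl; lra.
  by rewrite ler_pdivrMr// mulrC.
move=> {n i y}; elim=> [|n IH] i y y0.
  rewrite abel0 /Phi.
  have e1 : expR (- (l * y)) <= 1 by rewrite -expR0 ler_expR oppr_le0 mulr_ge0// ltW.
  have e0 := expR_gt0 (- (l * y)); have /andP[h1 h2] := ub i.
  have : C <= K by rewrite /K -addrA lerDl; lra.
  move=> CK; have CKl : C * l <= K * l by rewrite ler_pM2r.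
  have k1 : 0 <= expR (- (l * y)) * (1 + C * l - u l i) by rewrite mulr_ge0 ?subr_ge0// ltW.
  have k2 : 0 <= (1 - expR (- (l * y))) * (1 + C * l) by apply: mulr_ge0; lra.
  by move: k1 k2; lra.
apply: le_trans (abel_minES n i y s01) _.
(* A jump may reach a negative height [x], with [- x <= B]. There the bound is [expR x] times the
   one at 0, and the factor [1 - expR x] gained on [K * l] covers [expR (- (l * x)) - 1]. *)
have IH' j : abel s n (fun k => minE P f k j (y + r j)) <= Phi j (y + r j).
  have [yr|yr] := leP 0 (y + r j); first exact: IH.
  set x := y + r j in yr *.
  have xB : - x <= B.
    by have := rB j; rewrite ler_norml => /andP[h _]; rewrite /x; lra.
  rewrite abel_minE_le0; last exact: ltW.
  have e0 := expR_gt0 x; have e1 : expR x < 1 by rewrite expR_lt1.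
  apply: le_trans (ler_wpM2l (ltW e0) (IH j 0 (lexx _))) _.
  rewrite /Phi mulr0 oppr0 expR0 mul1r.
  have /andP[u1 u2] := ub j.
  have h1 : expR (- (l * x)) - 1 <= l * (- x) * expR B.
    apply: le_trans (expR_sub1 _) _; rewrite -mulrN ler_wpM2l//.
      by rewrite mulr_ge0 ?oppr_ge0// ltW.
    rewrite ler_expR; apply: le_trans xB.
    by rewrite ler_piMl// oppr_ge0 ltW.
  have h2 : - x <= (1 - expR x) * expR B.
    have := expR_ge1Dx (- x) => hx.
    have hxB : expR (- x) <= expR B by rewrite ler_expR.
    have ee : expR x * expR (- x) = 1 by rewrite -expRD subrr expR0.
    have : (1 - expR x) * expR (- x) <= (1 - expR x) * expR B.
      by rewrite ler_wpM2l// subr_ge0 ltW.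
    rewrite mulrBl ee mul1r; lra.
  have h3 : expR (- (l * x)) - 1 <= l * (1 - expR x) * expR B ^+ 2.
    apply: le_trans h1 _.
    have -> : l * (1 - expR x) * expR B ^+ 2 = l * ((1 - expR x) * expR B) * expR B by ring.
    apply: ler_wpM2r; first exact: ltW.
    by apply: ler_wpM2l; [exact: ltW|].
  have u2' : u l j <= 2 by lra.
  have h4 : (expR (- (l * x)) - 1) * u l j <= l * (1 - expR x) * expR B ^+ 2 * 2.
    have p0 : 0 <= l * (1 - expR x) * expR B ^+ 2.
      by rewrite !mulr_ge0 ?exprn_ge0 ?subr_ge0// ltW.
    have [q0|q0] := leP 0 (expR (- (l * x)) - 1).
      by apply: ler_pM => //; lra.
    apply: (@le_trans _ _ 0); last lra.
    by apply: mulr_le0_ge0; lra.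
  have h5 : (1 - expR x) * (u l j - 1) <= (1 - expR x) * (C * l).
    by apply: ler_wpM2l; lra.
  have h6 : 0 <= (1 - expR x) * (C / kappa * l).
    by apply: mulr_ge0; [lra|apply: mulr_ge0 => //; exact: ltW].
  have -> : K * l = C * l + C / kappa * l + 2 * expR B ^+ 2 * l by rewrite /K; ring.
  move: h4 h5 h6; lra.
apply: le_trans (_ : (1 - s) + s * \sum_j P i j * Phi j (y + r j) <= _).
  rewrite lerD2l ler_pM2l//; apply: ler_sum => j _.
  by rewrite ler_wpM2l ?(proj1 hP).
rewrite /Phi eigen_step//.
have := u_eigen i l01; rewrite -/s; set D := \sum_j _ - _ => hD.
have e1 : expR (- (l * y)) <= 1 by rewrite -expR0 ler_expR oppr_le0 mulr_ge0// ltW.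
have e0 := expR_gt0 (- (l * y)).
have hD' : - (s * expR (- (l * y)) * D) <= s * (C * l ^+ 3).
  rewrite -mulrA -mulrN ler_pM2l//; apply: le_trans (ler_norm _) _.
  rewrite normrN normrM gtr0_norm//; apply: le_trans hD.
  by rewrite ler_piMl.
have h7 : s * (C * l ^+ 3) <= (1 - s) * (K * l).
  have -> : 1 - s = s * kappa * l ^+ 2 := onem_killing l.
  have -> : s * kappa * l ^+ 2 * (K * l) = s * (kappa * K * l ^+ 3) by ring.
  by rewrite ler_pM2l// ler_pM2r ?exprn_gt0.
move: hD' h7; lra.
Qed.

End BarrierBounds.

Section BarrierFunction.
Context {R : realType}.
Implicit Types l y u v d A B C K : R.

(** On the overshoot strip the correction is at most [2 * A * l * expR B], so the term [K * l] keeps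
    the lower barrier below the trivial bound 0. *)
Lemma barrier_fun_le0 l y u v d A B C K :
  0 <= l -> 0 <= u -> 1 - C * l <= u -> 0 <= v <= 2 -> 0 <= d <= 1 -> 0 <= A ->
  - B <= y <= 0 -> C + 2 * A * expR B <= K ->
  1 - expR (- (l * y)) * u - K * l + A * l * (expR (- (d * y)) * v) <= 0.
Proof.
move=> l0 u0 ul /andP[v0 v2] /andP[d0 d1] A0 /andP[yB y0] CK.
have h1 : 1 <= expR (- (l * y)) by rewrite -expR0 ler_expR oppr_ge0 mulr_ge0_le0.
have h2 : expR (- (d * y)) <= expR B by rewrite ler_expR; nra.
have h3 : u <= expR (- (l * y)) * u by rewrite ler_peMl.
have h4 : expR (- (d * y)) * v <= expR B * 2 by apply: ler_pM => //; exact: expR_ge0.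
have h5 := ler_wpM2l (mulr_ge0 A0 l0) h4.
have h6 := ler_wpM2r l0 CK.
move: h3 h5 h6 ul; clear; lra.
Qed.

Lemma barrier_fun_le1 l y u v d A C K :
  0 <= l -> 0 <= u -> 0 <= v <= 2 -> 0 <= d -> 0 <= A -> 0 <= y ->
  2 * A <= K -> 1 - expR (- (l * y)) * u - K * l + A * l * (expR (- (d * y)) * v) <= 1.
Proof.
move=> l0 u0 /andP[v0 v2] d0 A0 y0 AK.
have h1 : 0 <= expR (- (l * y)) * u by rewrite mulr_ge0 ?expR_ge0.
have h2 : expR (- (d * y)) * v <= 1 * 2.
  apply: ler_pM; rewrite ?expR_ge0//.
  by rewrite -expR0 ler_expR oppr_le0 mulr_ge0.
have h5 := ler_wpM2l (mulr_ge0 A0 l0) h2.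
have h6 := ler_wpM2r l0 AK.
move: h1 h5 h6; clear; lra.
Qed.

(** The losses of one step of the lower barrier: the gap in [harmE0_ge] and the [minE] term of
    [harmES], bounded by the upper barrier. Of the two factors [expR (- (y / 2))], one absorbs the
    factor [y] and the other is at most [expR (- (d * y))]. *)
Lemma barrier_loss y s l d kappa C0 C1 :
  0 <= y -> 0 <= s <= 1 -> 0 <= l <= 1 -> 0 <= d <= 1 / 2 -> 0 <= kappa -> 0 <= C0 ->
  0 <= C1 -> 1 - s = s * kappa * l ^+ 2 ->
  (1 - s) * expR (- y) + C0 * expR (- y) * ((y + C1) * l) <=
    (kappa + C0 * (2 + C1)) * l * expR (- (d * y)).
Proof.
move=> y0 /andP[s0 s1] /andP[l0 l1] /andP[d0 d1] k0 C00 C10 sE.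
set p := expR (- (y / 2)).
have p0 : 0 < p := expR_gt0 _.
have p1 : p <= 1 by rewrite -expR0 ler_expR oppr_le0 divr_ge0.
have -> : expR (- y) = p * p by rewrite -expRD; congr expR; field.
have h1 : y * p <= 2.
  have x1 : expR (y / 2) * p = 1 by rewrite -expRD subrr expR0.
  have := ler_wpM2r (ltW p0) (expR_ge1Dx (y / 2)); rewrite x1; lra.
have h2 : p <= expR (- (d * y)) by rewrite ler_expR lerN2; nra.
have h4 : p * (y + C1) <= 2 + C1.
  have : p * C1 <= C1 by rewrite ler_piMl.
  lra.
have h5 : 1 - s <= kappa * l.
  rewrite sE; apply: le_trans (_ : 1 * kappa * l ^+ 2 <= _).
    by rewrite ler_wpM2r ?sqr_ge0// ler_wpM2r.
  by rewrite mul1r ler_wpM2l// expr2 ler_piMr.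
have h7 : (1 - s) * (p * p) <= kappa * l * p.
  apply: ler_pM => //; [lra|by rewrite mulr_ge0 // ltW|].
  by rewrite ler_piMl// ltW.
have h8 : C0 * l * p * (p * (y + C1)) <= C0 * l * p * (2 + C1).
  by rewrite ler_wpM2l// !mulr_ge0// ltW.
have h9 : (kappa + C0 * (2 + C1)) * l * p <=
    (kappa + C0 * (2 + C1)) * l * expR (- (d * y)).
  rewrite ler_wpM2l// mulr_ge0// addr_ge0// mulr_ge0// addr_ge0//.
move: h7 h8 h9; clear; lra.
Qed.

End BarrierFunction.

Section HarmonicLowerBound.
Context {R : realType} {E : finType} (P : E -> E -> R) (r : E -> R).
Context (f : E -> R -> R) (C0 : R).
Hypothesis hP : stochastic P.
Hypothesis f_itv : forall j (t : R), 0 <= t < 1 -> 0 <= f j t < 1.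
Hypothesis f_le : forall j (t : R), 0 <= t < 1 -> 1 - f j t <= expR (r j) * (1 - t).
Hypothesis C0_ge0 : 0 <= C0.
Hypothesis f_inv : forall j (t : R), 0 <= t < 1 ->
  (1 - f j t)^-1 <= (expR (r j) * (1 - t))^-1 + C0.
Context (kappa : R) (u : R -> E -> R) (C : R).
Hypothesis kappa0 : 0 < kappa.
Hypothesis C1 : 1 <= C.
Hypothesis u_near1 : forall (l : R) i, 0 <= l <= 1 -> `|u l i - 1| <= C * l.
Hypothesis u_eigen : forall (l : R) i, 0 <= l <= 1 ->
  `|\sum_j P i j * (expR (- (l * r j)) * u l j) - (1 + kappa * l ^+ 2) * u l i|
     <= C * l ^+ 3.

Let killing := killing kappa.

Lemma abel_harmES s n i y : 0 <= s <= 1 ->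
  (1 - s) * (1 - expR (- y)) + s * \sum_j P i j *
     (abel s n (fun k => harmE P f k j (y + r j)) -
      C0 * expR (- y) * abel s n (fun k => minE P f k j (y + r j)))
  <= abel s n.+1 (fun k => harmE P f k i y).
Proof.
move=> s01; have /andP[s0 s1] := s01.
rewrite abelSl; apply: lerD.
  by rewrite ler_wpM2l ?subr_ge0// harmE0_ge.
rewrite ler_wpM2l//.
under eq_bigr do rewrite -abelZ -abelB.
by rewrite -abel_sum; apply: le_abel => // k; exact: (harmES hP f_itv C0_ge0 f_inv).
Qed.

(* [expR (- (d * y)) * u d i] is strictly excessive for a fixed small [d]; it
   absorbs the losses caused by [C0], which are summable away from the barrier *)
Lemma excessive_weight : exists d : R, [/\ 0 < d, d <= 1 / 2,
    forall i, 1 / 2 <= u d i <= 2 &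
    exists2 l1 : R, 0 < l1 & forall (l : R) i, 0 < l <= l1 ->
      (1 + kappa * d ^+ 2 / 4) * u d i <=
      killing l * \sum_j P i j * (expR (- (d * r j)) * u d j)].
Proof.
have C1' := C1; have k0 := kappa0.
have C0' : 0 < C by lra.
(* The first bound keeps [u d] between 1/2 and 2; the second makes the residual [C * d ^+ 3] at most
   half of the gain [kappa * d ^+ 2 * u d i]. *)
pose d := Num.min (2 * C)^-1 (kappa / (4 * C)).
have d0 : 0 < d by rewrite lt_min invr_gt0 divr_gt0 ?mulr_gt0.
have d1 : d * (2 * C) <= 1.
  by rewrite -ler_pdivlMr ?mulr_gt0// div1r ge_min lexx.
have d2 : d * (4 * C) <= kappa.
  by rewrite -ler_pdivlMr ?mulr_gt0// ge_min lexx orbT.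
have d12 : d <= 1 / 2 by nra.
have ud i : 1 / 2 <= u d i <= 2.
  have : 0 <= d <= 1 by apply/andP; split; lra.
  move/(u_near1 i); rewrite ler_norml => /andP[h1 h2].
  by apply/andP; split; lra.
exists d; split => //.
(* For such [l] the killing uses up at most half of the remaining gain, from [kappa * d ^+ 2 / 2]
   down to [kappa * d ^+ 2 / 4]. *)
exists (d / (2 * (1 + kappa))); first by rewrite divr_gt0// mulr_gt0//; lra.
move=> l i /andP[l0 ll].
have kl : kappa * l ^+ 2 * (1 + kappa * d ^+ 2 / 4) <= kappa * d ^+ 2 / 4.
  have : l * (2 * (1 + kappa)) <= d.
    by rewrite -ler_pdivlMr// mulr_gt0//; lra.
  move=> h; have h2 : l ^+ 2 * (4 * (1 + kappa) ^+ 2) <= d ^+ 2.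
    have -> : l ^+ 2 * (4 * (1 + kappa) ^+ 2) = (l * (2 * (1 + kappa))) ^+ 2 by ring.
    by rewrite lerXn2r// nnegrE ?mulr_ge0//; lra.
  have h3 : 1 + kappa * d ^+ 2 / 4 <= (1 + kappa) ^+ 2.
    have : d ^+ 2 <= 1 by rewrite exprn_ile1//; lra.
    have := sqr_ge0 kappa; have := sqr_ge0 d; nra.
  have h4 : l ^+ 2 * (1 + kappa * d ^+ 2 / 4) <= l ^+ 2 * (1 + kappa) ^+ 2.
    by rewrite ler_wpM2l// sqr_ge0.
  have h5 : l ^+ 2 * (1 + kappa * d ^+ 2 / 4) <= d ^+ 2 / 4 by lra.
  have -> : kappa * l ^+ 2 * (1 + kappa * d ^+ 2 / 4) =
     kappa * (l ^+ 2 * (1 + kappa * d ^+ 2 / 4)) by ring.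
  by rewrite -[leRHS]mulrA ler_wpM2l// ltW.
have S : (1 + kappa * d ^+ 2 / 2) * u d i <= \sum_j P i j * (expR (- (d * r j)) * u d j).
  have : 0 <= d <= 1 by apply/andP; split; lra.
  move/(u_eigen i); rewrite ler_norml => /andP[h _].
  have /andP[u1 _] := ud i.
  have h6 : C * d ^+ 3 <= kappa * d ^+ 2 / 2 * u d i.
    have -> : C * d ^+ 3 = d ^+ 2 * (C * d) by ring.
    have -> : kappa * d ^+ 2 / 2 * u d i = d ^+ 2 * (kappa * u d i / 2) by ring.
    by rewrite ler_wpM2l ?sqr_ge0//; nra.
  move: h h6; lra.
have s0 : 0 < killing l := killing_gt0 kappa0 l.
apply: le_trans (_ : killing l * ((1 + kappa * d ^+ 2 / 2) * u d i) <= _); last first.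
  by rewrite ler_pM2l.
rewrite mulrA ler_wpM2r//; first by have /andP[] := ud i; lra.
rewrite -(ler_pM2l (lt_le_trans ltr01 (killing_den kappa0 l))).
rewrite [leRHS]mulrA [(1 + kappa * l ^+ 2) * killing l]mulrC (killingE kappa0) mul1r.
move: kl; lra.
Qed.

(** Induction on [n] with the subsolution [Phi + W], where [W] is the excessive weight scaled by
    [A * l]; [killing l ^+ n] accounts for the mass lost to the truncation. *)
Lemma harmE_lower : exists l0 K : R, [/\ 0 < l0, l0 <= 1, 1 <= K &
  forall (l : R) n i y, 0 < l <= l0 -> 0 <= y ->
    1 - expR (- (l * y)) - K * l - killing l ^+ n
     <= abel (killing l) n (fun k => harmE P f k i y)].
Proof.
have C1' := C1; have k0 := kappa0; have C0' := C0_ge0.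
have [lu [Ku [lu0 lu1 Ku1 upper]]] := minE_upper hP f_itv f_le kappa0 C1 u_near1 u_eigen.
have [d [d0 d1 ud [ld ld0 exc]]] := excessive_weight.
have d12 : 0 <= d <= 1 / 2 by rewrite ltW.
have d01 : 0 <= d <= 1 by apply/andP; split; lra.
have ud02 i : 0 <= u d i <= 2 by have /andP[h ->] := ud i; rewrite (le_trans _ h).
have [B B1 rB] := finite_bounded r.
have B0 : 0 <= B by lra.
have eB0 := expR_gt0 B.
have eB1 : 1 <= expR B by rewrite -expR0 ler_expR.
pose C3 := kappa + C0 * (2 + B + Ku).
have C3E : C3 = kappa + C0 * (2 + B + Ku) by [].
have C30 : 0 <= C3 by rewrite /C3 addr_ge0// ?mulr_ge0// ?ltW//; lra.
(* The weight gains [A * kappa * d ^+ 2 / 4 * u d i] per step, in units of [l * expR (- (d * y))].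
   As [u d i >= 1 / 2], the factor 8 makes this at least the loss [C3]. *)
pose A := 8 * C3 / (kappa * d ^+ 2).
have A0 : 0 <= A.
  by rewrite /A divr_ge0 ?mulr_ge0// ?exprn_ge0// ltW.
have AE : A * (kappa * d ^+ 2) = 8 * C3.
  by rewrite /A mulfVK// gt_eqF// mulr_gt0// exprn_gt0.
clearbody A C3.
(* [C + 2 * A * expR B] makes the barrier nonpositive on the overshoot strip, and [C / kappa] pays
   for the residual of the eigenfunction. *)
pose K := C + C / kappa + 2 * A * expR B.
have Ck : 0 <= C / kappa by rewrite divr_ge0 ?(ltW kappa0) ?(le_trans ler01 C1).
have AB : A <= A * expR B by rewrite ler_peMr.
have CK : C + 2 * A * expR B <= K by rewrite /K; lra.
have AK : 2 * A <= K by rewrite /K; lra.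
have CkK : C <= kappa * K.
  have : C / kappa <= K by rewrite /K -addrA addrCA lerDl; lra.
  by rewrite ler_pdivrMr// mulrC.
have K1 : 1 <= K + C by rewrite /K; lra.
clearbody K.
pose l0 := Num.min (Num.min lu ld) (2 * C)^-1.
exists l0, (K + C); split.
- by rewrite !lt_min lu0 ld0 invr_gt0; lra.
- by rewrite ge_min; apply/orP; right; rewrite invf_le1; lra.
- exact: K1.
move=> l n i y /andP[lpos]; rewrite !le_min => /andP[/andP[llu lld] lC].
have l1 : l <= 1 by apply: le_trans lC _; rewrite invf_le1; lra.
have l01 : 0 <= l <= 1 by rewrite ltW.
have Cl : C * l <= 1 / 2.
  have : l * (2 * C) <= 1 by rewrite -ler_pdivlMr ?div1r//; lra.
  lra.
have ub j : 1 - C * l <= u l j <= 1 + C * l.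
  by have := u_near1 j l01; rewrite ler_norml => /andP[h1 h2]; apply/andP; split; lra.
have ul0 j : 0 <= u l j by have /andP[h1 _] := ub j; lra.
have s01 := killing_itv kappa0 l.
have s0 : 0 < killing l := killing_gt0 kappa0 l.
have sE : 1 - killing l = killing l * kappa * l ^+ 2 := onem_killing kappa0 l.
have lld' : 0 < l <= ld by rewrite lpos.
have llu' : 0 < l <= lu by rewrite lpos.
have {}exc i' := exc l i' lld'.
have {}upper n' i' y' := upper l n' i' y' llu'.
have s1 : killing l <= 1 by case/andP: s01.
rewrite -/killing in upper; set s := killing l in exc s01 s0 sE s1 upper *.
have e0 (x : R) := expR_gt0 x.
have e1 (x : R) : 0 <= x -> expR (- x) <= 1 by move=> x0; rewrite -expR0 ler_expR oppr_le0.
pose Phi i y := 1 - expR (- (l * y)) * u l i - K * l.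
pose W i y := A * l * (expR (- (d * y)) * u d i).
have W0 i' y' : 0 <= W i' y'.
  have /andP[h _] := ud i'.
  by rewrite /W; apply: mulr_ge0; [rewrite mulr_ge0// ltW|apply: mulr_ge0; [exact: expR_ge0|lra]].
(* The induction runs on [- B <= y], where one step from the half line lands; between [- B] and 0
   the barrier is nonpositive and there is nothing to prove. *)
suff main : forall n i y, - B <= y ->
    Phi i y + W i y - s ^+ n <= abel s n (fun k => harmE P f k i y).
  move=> y0; apply: le_trans (main n i y _); last by lra.
  have := W0 i y; rewrite /Phi.
  have := e1 (l * y) (mulr_ge0 (ltW lpos) y0); have := e0 (- (l * y)).
  move: (expR (- (l * y))) (W i y) (s ^+ n) => e w sn p0 p1 w0.
  have /andP[_ h2] := ub i.
  have : e * u l i <= e + C * l.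
    apply: le_trans (_ : e * (1 + C * l) <= _); first by rewrite ler_wpM2l// ltW.
    rewrite mulrDr mulr1 lerD2l ler_piMl// mulr_ge0//; lra.
  rewrite [(K + C) * l]mulrDl; lra.
have PhiW_neg i' y' : - B <= y' -> y' <= 0 -> Phi i' y' + W i' y' <= 0.
  move=> yB y0; have /andP[u1 u2] := ub i'; 
  by apply: (barrier_fun_le0 (B := B) (C := C)) => //; rewrite ?yB// ltW.
have PhiW_le1 i' y' : - B <= y' -> Phi i' y' + W i' y' <= 1.
  move=> yB; case: (leP 0 y') => y0; last first.
    by apply: le_trans (PhiW_neg i' y' yB (ltW y0)) ler01.
  by apply: barrier_fun_le1 => //; exact: ltW.
move=> {n i y}; elim=> [|n IH] i y yB.
  by rewrite abel0 expr0 subr_le0 PhiW_le1.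
have [y0|y0] := leP 0 y; last first.
  apply: le_trans (_ : 0 <= _).
    have := PhiW_neg i y yB (ltW y0); have := exprn_ge0 n.+1 (ltW s0); lra.
  by apply: abel_ge0 => // k; exact: harmE_ge0.
apply: le_trans (abel_harmES n i y s01).
have yr j : - B <= y + r j.
  by have := rB j; rewrite ler_norml => /andP[h _]; lra.
have up j : abel s n (fun k => minE P f k j (y + r j)) <= (y + B + Ku) * l.
  have [yr0|yr0] := leP 0 (y + r j).
    apply: le_trans (upper n j _ yr0) _.
    have h1 := expR_ge1Dx (- (l * (y + r j))).
    have h2 : l * (y + r j) <= l * (y + B).
      rewrite ler_pM2l//; have := rB j; rewrite ler_norml => /andP[_ h]; lra.
    rewrite [leRHS]mulrDl; lra.
  apply: le_trans (_ : abel s n (fun k => minE P f k j 0) <= _).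
    by apply: le_abel => // k; apply: le_minE => //; exact: ltW.
  apply: le_trans (upper n j 0 (lexx _)) _.
  rewrite mulr0 oppr0 expR0 subrr add0r ler_pM2r//; lra.
set e := expR (- y).
have loss : \sum_j P i j * (C0 * e * abel s n (fun k => minE P f k j (y + r j)))
    <= C0 * e * ((y + B + Ku) * l).
  apply: (avg_le hP (g := fun j => C0 * e * abel s n (fun k => minE P f k j (y + r j)))).
  by move=> j; rewrite ler_wpM2l// mulr_ge0// expR_ge0.
have gain : \sum_j P i j * (Phi j (y + r j) + W j (y + r j) - s ^+ n) <=
    \sum_j P i j * abel s n (fun k => harmE P f k j (y + r j)).
  by apply: ler_sum => j _; rewrite ler_wpM2l ?(proj1 hP)// IH.
have split_sum : \sum_j P i j * (Phi j (y + r j) + W j (y + r j) - s ^+ n) =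
    \sum_j P i j * (1 - expR (- (l * (y + r j))) * u l j + - (K * l)) - s ^+ n
    + A * l * expR (- (d * y)) * (\sum_j P i j * (expR (- (d * r j)) * u d j)).
  have e2 : s ^+ n = \sum_j P i j * s ^+ n by rewrite -mulr_suml (proj2 hP) mul1r.
  rewrite [X in _ = _ - X + _]e2 mulr_sumr -sumrB -big_split /=.
  apply: eq_bigr => j _; rewrite /Phi /W.
  have -> : - (d * (y + r j)) = - (d * y) + - (d * r j) by ring.
  by rewrite [expR (- (d * y) + _)]expRD; ring.
under eq_bigr do rewrite mulrBr.
rewrite sumrB [s * (_ - _)]mulrBr.
apply: le_trans (_ : (1 - s) * (1 - e) + (s * (\sum_j P i j * (Phi j (y + r j) + W j (y + r j) - s ^+ n))
   - (C0 * e * ((y + B + Ku) * l))) <= _); last first.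
  rewrite lerD2l; apply: lerB; first by rewrite ler_pM2l.
  apply: le_trans loss; rewrite ler_piMl//.
  apply: sumr_ge0 => j _; rewrite mulr_ge0 ?(proj1 hP)//.
  rewrite mulr_ge0// ?mulr_ge0 ?expR_ge0//.
  by apply: abel_ge0 => // k; exact: minE_ge0.
rewrite split_sum.
have est := eigen_step r hP u kappa0 (- (K * l)) i y l01; rewrite -/killing -/s in est.
have := u_eigen i l01; set D := \sum_j _ - (1 + _) * _ in est * => hD.
have hD' : s * expR (- (l * y)) * D <= s * (C * l ^+ 3).
  rewrite -mulrA ler_pM2l//; apply: le_trans (ler_norm _) _.
  rewrite normrM gtr0_norm//; apply: le_trans hD.
  by rewrite ler_piMl// e1// mulr_ge0// ltW.
have hK : s * (C * l ^+ 3) <= (1 - s) * (K * l).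
  rewrite sE.
  have -> : s * kappa * l ^+ 2 * (K * l) = s * (kappa * K * l ^+ 3) by ring.
  by rewrite ler_pM2l// ler_pM2r ?exprn_gt0.
have hW : W i y + C3 * l * expR (- (d * y)) <=
    s * (A * l * expR (- (d * y)) * (\sum_j P i j * (expR (- (d * r j)) * u d j))).
  have -> : s * (A * l * expR (- (d * y)) * (\sum_j P i j * (expR (- (d * r j)) * u d j)))
    = A * l * expR (- (d * y)) * (s * \sum_j P i j * (expR (- (d * r j)) * u d j)) by ring.
  have := ler_wpM2l (mulr_ge0 (mulr_ge0 A0 (ltW lpos)) (expR_ge0 (- (d * y)))) (exc i).
  apply: le_trans; rewrite /W.
  have -> : A * l * expR (- (d * y)) * ((1 + kappa * d ^+ 2 / 4) * u d i) =
    A * l * (expR (- (d * y)) * u d i) +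
    (A * (kappa * d ^+ 2)) * (u d i / 4) * l * expR (- (d * y)) by field.
  rewrite lerD2l AE ler_wpM2r ?expR_ge0// ler_wpM2r ?(ltW lpos)//.
  have /andP[w1 w2] := ud i; nra.
have hC3 : (1 - s) * e + C0 * e * ((y + (B + Ku)) * l) <= C3 * l * expR (- (d * y)).
  rewrite C3E -addrA; apply: barrier_loss => //; try exact: ltW.
  by rewrite addr_ge0// (le_trans ler01 Ku1).
rewrite addrA in hC3.
have sn : s * s ^+ n = s ^+ n.+1 by rewrite exprS.
have {}hD' := hD'; move: est hD' hK hW hC3 sn; rewrite /Phi.
set S1 := \sum_j P i j * (1 - _ + _); set S2 := \sum_j P i j * (expR _ * u d j).
set S3 := A * l * _ * S2; set w := W i y; set E1 := C3 * l * _; set L := C0 * e * _.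
set X1 := expR (- (l * y)) * u l i; set X2 := s * _ * D; set p := s ^+ n; set p' := s ^+ n.+1.
set KK := K * l.
move=> est hD' hK hW hC3 sn; lra.
Qed.

End HarmonicLowerBound.

(** * Survival probabilities and the branching recursion *)

Section Survival.
Context {R : realType} {E : finType} (P : E -> E -> R).
Context (q : E -> probability nat R).
Hypothesis hP : stochastic P.
Hypothesis hmean : forall i, (0 < 'E_(q i)[fun m : nat => m%:R%R])%E.
Hypothesis hmom2 : forall i, ('E_(q i)[fun m : nat => (m%:R ^+ 2)%R] < +oo)%E.

Let f i := genfun (q i).
Let r := rho q.

Lemma expR_rho i : expR (r i) = \int[q i]_n (n%:R : R).
Proof. exact: expR_log_mean (hmom2 i) (hmean i). Qed.

Lemma genfun_itv1 j (t : R) : 0 <= t < 1 -> 0 <= f j t < 1.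
Proof.
move=> t01; rewrite (genfun_lt1 (hmom2 j) (hmean j) t01) andbT.
have : 0 <= t <= 1 by case/andP: t01 => -> /ltW ->.
by move/(genfun_itv (hmom2 j)) => /andP[].
Qed.

Lemma genfun_le_rho j (t : R) : 0 <= t < 1 -> 1 - f j t <= expR (r j) * (1 - t).
Proof.
move=> t01; rewrite expR_rho; apply: (genfun_onem_le (hmom2 j)).
by case/andP: t01 => -> /ltW ->.
Qed.

Lemma genfun_inv_rho : exists2 C0, 0 <= C0 & forall j (t : R), 0 <= t < 1 ->
  (1 - f j t)^-1 <= (expR (r j) * (1 - t))^-1 + C0.
Proof.
have h j : exists C, 0 <= C /\ forall t : R, 0 <= t < 1 ->
    (1 - f j t)^-1 <= (expR (r j) * (1 - t))^-1 + C.
  have [C C0 hC] := genfun_onem_inv (hmom2 j) (hmean j).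
  by exists C; split => // t t01; rewrite expR_rho; exact: hC.
have [c hc] := choice h.
exists (\sum_j c j); first by apply: sumr_ge0 => j _; case: (hc j).
move=> j t t01; apply: le_trans (proj2 (hc j) t t01) _.
rewrite lerD2l (bigD1 j)//= lerDl; apply: sumr_ge0 => i _; by case: (hc i).
Qed.

Definition surv n i z := pathE P n (fun s => 1 - compgen f s ^+ z) i.

Let compgen_01 s : 0 <= compgen f s <= 1.
Proof. by have /andP[-> /ltW ->] := compgen_itv genfun_itv1 s. Qed.

Lemma surv_ge0 n i z : 0 <= surv n i z.
Proof.
apply: pathE_ge0 => // s.
by have /andP[_ h] := onem_expr_ge0 z (compgen_01 s); rewrite subr_ge0.
Qed.

Lemma surv_le1 n i z : surv n i z <= 1.
Proof.
apply: pathE_le1 => // s.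
by have /andP[h _] := onem_expr_ge0 z (compgen_01 s); rewrite lerBlDr lerDl.
Qed.

Lemma surv_z0 n i : surv n i 0 = 0.
Proof.
rewrite -[RHS](pathE_cst hP n 0 i); apply: eq_pathE => s.
by rewrite expr0 subrr.
Qed.

Lemma surv_0 i z : (0 < z)%N -> surv 0 i z = 1.
Proof. by case: z => // z _; rewrite /surv /= expr0n subr0. Qed.

Lemma surv_le_minE n i z : (0 < z)%N -> surv n i z <= minE P f n i (ln z%:R).
Proof.
move=> z0; apply: le_pathE => // s; rewrite lnK ?posrE ?ltr0n//.
rewrite le_min onem_expr_le// andbT.
by have /andP[h _] := onem_expr_ge0 z (compgen_01 s); rewrite lerBlDr lerDl.
Qed.

Lemma harmE_le_surv n i z : (0 < z)%N -> harmE P f n i (ln z%:R) <= surv n i z.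
Proof.
move=> z0; apply: le_pathE => // s /=; rewrite lnK ?posrE ?ltr0n//.
have := expr_onem_le1 z (compgen_01 s); have /andP[c0 c1] := compgen_01 s.
set x := z%:R * _; have x0 : 0 <= x by rewrite mulr_ge0// subr_ge0.
move=> h; rewrite ler_pdivrMr ?ltr_pwDl//; lra.
Qed.

Lemma surv_noninc i z n : surv n.+1 i z <= surv n i z.
Proof.
rewrite /surv; pose G (F : seq E -> R) (s : seq E) := 1 - F s ^+ z.
(* The induction removes the outermost generating function, so it needs an arbitrary nonincreasing
   [F]; the base case only uses that an extinction probability is nonnegative. *)
have H m (F : R -> R) j : (forall t t', 0 <= t -> t <= t' -> t' <= 1 -> F t' <= F t) ->
   pathE P m.+1 (fun s => F (compgen f s)) j <= pathE P m (fun s => F (compgen f s)) j.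
  elim: m F j => [|m IH] F j Fmono.
    rewrite [leRHS]/= /=; apply: (avg_le hP) => l.
    have := compgen_01 [:: l]; rewrite /= => /andP[h0 h1]; exact: Fmono.
  rewrite [leLHS]/= [leRHS]/=; apply: ler_sum => l _; rewrite ler_wpM2l ?(proj1 hP)//.
  apply: (IH (fun t => F (f l t))) => t t' t0 tt' t1.
  have h0 : 0 <= f l t <= 1 by apply: (genfun_itv (hmom2 l)); rewrite t0 (le_trans tt').
  have h1 : 0 <= f l t' <= 1 by apply: (genfun_itv (hmom2 l)); rewrite t1 (le_trans t0).
  apply: Fmono; [by case/andP: h0|exact: (le_genfun (hmom2 l))|by case/andP: h1].
apply: (H n (fun t => 1 - t ^+ z)) => t t' t0 tt' t1.
by rewrite lerD2l lerN2 lerXn2r// nnegrE (le_trans t0).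
Qed.

Lemma growth_sum (I : Type) (s : seq I) (w : I -> R) (phi : I -> nat -> R) :
  (forall i, growth (phi i)) -> growth (fun a => \sum_(i <- s) w i * phi i a).
Proof.
move=> g; elim: s => [|i s IH].
  by apply: (@bounded_growth _ _ 0) => m; rewrite big_nil normr0.
have -> : (fun a => \sum_(i0 <- i :: s) w i0 * phi i0 a) =
   (fun a => w i * phi i a + \sum_(i0 <- s) w i0 * phi i0 a).
  by apply/funext => a; rewrite big_cons.
by apply: growthD => //; exact: growthZ.
Qed.

Lemma nconv_sum j z (I : Type) (s : seq I) (w : I -> R) (phi : I -> nat -> R) :
  (forall i, growth (phi i)) ->
  nconv (q j) z (fun a => \sum_(i <- s) w i * phi i a) =
  \sum_(i <- s) w i * nconv (q j) z (phi i).
Proof.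
move=> g; elim: s => [|i s IH].
  by rewrite big_nil -[RHS](nconv_cst (q j) z 0); apply: eq_nconv => a; rewrite big_nil.
rewrite big_cons -IH -(nconvZ (hmom2 j))// -(nconvD (hmom2 j)); last 2 first.
- exact: growthZ.
- exact: growth_sum.
by apply: eq_nconv => a; rewrite big_cons.
Qed.

Lemma growth_pathE n (Psi : seq E -> nat -> R) i : (forall s, growth (Psi s)) ->
  growth (fun a => pathE P n (fun s => Psi s a) i).
Proof.
elim: n Psi i => [|n IH] Psi i g /=; first exact: g.
by apply: growth_sum => l; exact: IH.
Qed.

Lemma nconv_pathE j z n (Psi : seq E -> nat -> R) i : (forall s, growth (Psi s)) ->
  nconv (q j) z (fun a => pathE P n (fun s => Psi s a) i) =
  pathE P n (fun s => nconv (q j) z (Psi s)) i.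
Proof.
elim: n Psi i => [|n IH] Psi i g /=; first by [].
rewrite nconv_sum; last by move=> l; exact: growth_pathE.
by apply: eq_bigr => l _; rewrite IH.
Qed.

(** Transition operator of the Markov chain formed by the environment and the population. *)
Definition step (phi : E -> nat -> R) i z := \sum_j P i j * nconv (q j) z (phi j).

Lemma survS n i z : surv n.+1 i z = step (surv n) i z.
Proof.
apply: eq_bigr => j _; congr (_ * _); rewrite /surv nconv_pathE; last first.
  move=> s; apply: (@bounded_growth _ _ 1) => m.
  by have /andP[h0 h1] := onem_expr_ge0 m (compgen_01 s); rewrite ler_norml; lra.
apply: eq_pathE => s.
rewrite /= -(nconv_expr (hmom2 j))//.
have -> : (fun a : nat => 1 - compgen f s ^+ a) =
    (fun a => 1 + (-1) * compgen f s ^+ a).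
  by apply/funext => a; rewrite mulN1r.
have g1 : growth (fun a : nat => compgen f s ^+ a) by exact: growth_expr.
have g2 : growth (fun _ : nat => 1 : R) by apply: (@bounded_growth _ _ 1) => m; rewrite normr1.
rewrite (nconvD (hmom2 j) z g2 (growthZ _ g1)) nconv_cst (nconvZ (hmom2 j) z _ g1).
by rewrite mulN1r.
Qed.

Lemma le_step phi psi i z : (forall j, growth (phi j)) -> (forall j, growth (psi j)) ->
  (forall j a, phi j a <= psi j a) -> step phi i z <= step psi i z.
Proof.
move=> g1 g2 h; apply: ler_sum => j _; rewrite ler_wpM2l ?(proj1 hP)//.
by apply: (le_nconv (hmom2 j)).
Qed.

Lemma stepD phi psi i z : (forall j, growth (phi j)) -> (forall j, growth (psi j)) ->
  step (fun j a => phi j a + psi j a) i z = step phi i z + step psi i z.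
Proof.
move=> g1 g2; rewrite -big_split; apply: eq_bigr => j _.
by rewrite (nconvD (hmom2 j))// mulrDr.
Qed.

Lemma stepZ c phi i z : (forall j, growth (phi j)) ->
  step (fun j a => c * phi j a) i z = c * step phi i z.
Proof.
move=> g1; rewrite /step mulr_sumr; apply: eq_bigr => j _.
by rewrite (nconvZ (hmom2 j))// mulrCA.
Qed.

Lemma step_cst c i z : step (fun _ _ => c) i z = c.
Proof.
rewrite /step; under eq_bigr do rewrite nconv_cst.
by rewrite -mulr_suml (proj2 hP) mul1r.
Qed.

Lemma step_id : exists2 M, 1 <= M & forall i z, step (fun _ a => a%:R) i z <= M * z%:R.
Proof.
have [M M1 hM] := finite_bounded (fun j => expR (r j)).
exists M => // i z; rewrite /step; under eq_bigr do rewrite (nconv_id (hmom2 _)) -expR_rho.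
apply: (avg_le hP (g := fun j => z%:R * expR (r j))) => j.
by rewrite mulrC ler_wpM2r//; apply: le_trans (hM j); exact: ler_norm.
Qed.

Lemma growth_surv n j : growth (surv n j).
Proof.
apply: (@bounded_growth _ _ 1) => m.
by rewrite ger0_norm ?surv_ge0// surv_le1.
Qed.

Definition absurv s n i z := abel s n (fun k => surv k i z).

Lemma growth_absurv s n j : growth (absurv s n j).
Proof. by apply: growth_sum => k; exact: growth_surv. Qed.

Lemma absurvS s n i z :
  absurv s n.+1 i z = (1 - s) * surv 0 i z + s * step (absurv s n) i z.
Proof.
rewrite /absurv abelSl; congr (_ + _ * _).
rewrite /step; under [RHS]eq_bigr => j _.
  rewrite /abel nconv_sum; last by move=> k; exact: growth_surv.
  over.
rewrite -(abel_sum s n (P i) (fun j k => nconv (q j) z (surv k j))).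
by apply: eq_abel => k; rewrite survS.
Qed.

Lemma absurv_z0 s n i : absurv s n i 0 = 0.
Proof. by apply: big1 => k _; rewrite surv_z0 mulr0. Qed.

End Survival.

Lemma onem_expRN_ge {R : realType} (x : R) : 0 <= x -> x - x ^+ 2 <= 1 - expR (- x).
Proof.
move=> x0; have h := expR_ge1Dx x; have e0 := expR_gt0 x.
have : expR (- x) <= (1 + x)^-1 by rewrite expRN lef_pV2// posrE; lra.
have : (1 + x)^-1 <= 1 - x + x ^+ 2.
  rewrite -[_^-1]mul1r ler_pdivrMr; last lra.
  by have := exprn_ge0 3 x0; rewrite exprS expr2; nra.
lra.
Qed.

Lemma killing_expn_le {R : realType} (kappa l e : R) : 0 < kappa -> 0 < l -> 0 < e ->
  exists N, forall n, (N <= n)%N -> killing kappa l ^+ n <= e.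
Proof.
move=> kappa0 l_gt0 e0; have /andP[s0 s1] := killing_itv kappa0 l.
have /cvgrPdist_lt /(_ _ e0) [N _ hN] :
    (fun n : nat => killing kappa l ^+ n) @ \oo --> (0 : R).
  by apply: cvg_expr; rewrite ger0_norm ?killing_lt1.
exists N => n Nn; have := hN n Nn; rewrite sub0r normrN ger0_norm; first exact: ltW.
by rewrite exprn_ge0.
Qed.

(** * Convergence of the Abel means divided by l *)

Section SurvivalLimit.
Context {R : realType} {E : finType} (P : E -> E -> R).
Context (q : E -> probability nat R).
Hypothesis hP : stochastic P.
Hypothesis hmean : forall i, (0 < 'E_(q i)[fun m : nat => m%:R%R])%E.
Hypothesis hmom2 : forall i, ('E_(q i)[fun m : nat => (m%:R ^+ 2)%R] < +oo)%E.
Context (kappa l0 K : R).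
Hypothesis kappa0 : 0 < kappa.
Hypothesis l0_gt0 : 0 < l0.
Hypothesis l0_le1 : l0 <= 1.
Hypothesis K1 : 1 <= K.

Let w l n i z := absurv P q (killing kappa l) n i z.

Hypothesis w_upper : forall (l : R) n i z, 0 < l <= l0 -> (0 < z)%N ->
  w l n i z <= 1 - expR (- (l * ln z%:R)) + K * l.
Hypothesis w_lower : forall (l : R) n i z, 0 < l <= l0 -> (0 < z)%N ->
  1 - expR (- (l * ln z%:R)) - K * l - killing kappa l ^+ n <= w l n i z.

Let s01 l := killing_itv kappa0 l.

(** Turns the quadratic error in the height into one linear in the population, a quantity whose
    growth under [step] is controlled by [step_id]. *)
Let ln_sqr_le (z : nat) : (0 < z)%N -> ln (z%:R : R) ^+ 2 <= 4 * z%:R.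
Proof.
move=> z0; set y := ln _; have ez : expR y = z%:R by rewrite lnK// posrE ltr0n.
have y0 : 0 <= y by rewrite ln_ge0// ler1n.
have -> : (z%:R : R) = expR (y / 2) ^+ 2.
  by rewrite -ez -expRM_natl; congr expR; field.
have : y / 2 <= expR (y / 2).
  by apply: le_trans (expR_ge1Dx _); rewrite lerDr.
move=> h; have : (y / 2) ^+ 2 <= expR (y / 2) ^+ 2.
  by rewrite lerXn2r// nnegrE ?expR_ge0// divr_ge0.
have -> : (y / 2) ^+ 2 = y ^+ 2 / 4 by field.
by rewrite ler_pdivrMr// mulrC.
Qed.

Let killing_small l : 1 - killing kappa l <= kappa * l ^+ 2.
Proof.
rewrite onem_killing// -mulrA ler_piMl ?killing_le1//.
by rewrite mulr_ge0 ?sqr_ge0// ltW.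
Qed.

(** Both quotients lie within [K] of [ln z], up to second order and truncation terms. The gap
    [2 * K] carries the factor [surv P q 0 i z], equal to 1 for nonzero [z], so that [step] can act
    on it. *)
Let base (l l' : R) n n' i z : 0 < l <= l0 -> 0 < l' <= l0 ->
  w l n i z / l <= w l' n' i z / l' + 2 * K * surv P q 0 i z
    + 4 * z%:R * (l + l') + killing kappa l' ^+ n' / l'.
Proof.
move=> hl hl'; have /andP[l_gt0 _] := hl; have /andP[l'_gt0 _] := hl'.
case: z => [|z].
  rewrite /w !(absurv_z0 q hP) (surv_z0 q hP) !mul0r !mulr0 mul0r !add0r divr_ge0//.
    by rewrite exprn_ge0//; case/andP: (s01 l').
  exact: ltW.
set y := ln (z.+1%:R : R).
have y0 : 0 <= y by rewrite ln_ge0// ler1n.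
have y2 : y ^+ 2 <= 4 * z.+1%:R by exact: ln_sqr_le.
rewrite surv_0 // mulr1.
have h1 : w l n i z.+1 / l <= y + K.
  rewrite ler_pdivrMr//; apply: le_trans (w_upper n i hl (ltn0Sn z)) _.
  rewrite mulrDl; have := expR_ge1Dx (- (l * y)); rewrite -/y; lra.
have h2 : y - l' * y ^+ 2 - K - killing kappa l' ^+ n' / l' <= w l' n' i z.+1 / l'.
  rewrite ler_pdivlMr//; apply: le_trans (w_lower n' i hl' (ltn0Sn z)).
  have := onem_expRN_ge (mulr_ge0 (ltW l'_gt0) y0); rewrite -/y.
  rewrite !mulrBl divfK ?gt_eqF//.
  rewrite exprMn; lra.
have h3 : l' * y ^+ 2 <= 4 * z.+1%:R * l' by rewrite mulrC ler_pM2r.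
have h4 : 0 <= 4 * z.+1%:R * l by rewrite mulr_ge0// ltW.
rewrite mulrDr; lra.
Qed.

(** Each application of [step] turns [surv m] into [surv m.+1], whereas the other errors remain a
    multiple of [z * (l + l')]. *)
Let comparison m : exists2 c : R, 0 <= c &
  forall (l l' : R) n n' i z, 0 < l <= l0 -> 0 < l' <= l0 ->
  w l (m + n) i z / l <= w l' (m + n') i z / l' + 2 * K * surv P q m i z
    + c * z%:R * (l + l') + killing kappa l' ^+ n' / l'.
Proof.
elim: m => [|m [c c0 IH]].
  by exists 4 => // l l' n n' i z hl hl'; rewrite !add0n; exact: base.
have [M M1 hM] := step_id hP hmean hmom2.
have kap0 := kappa0.
(* [M] bounds the mean offspring numbers, and [kappa] comes from the terms [(1 - s) / l] and
   [(1 - s') / l']. *)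
exists (c * M + kappa); first by rewrite addr_ge0 ?mulr_ge0//; lra.
move=> l l' n n' i z hl hl'; have /andP[l_gt0 _] := hl; have /andP[l'_gt0 _] := hl'.
rewrite addSn.
set s := killing kappa l; set s' := killing kappa l'.
have gw l1 n1 j : growth (w l1 n1 j) by exact: growth_absurv.
have gs n1 j : growth (surv P q n1 j) by exact: growth_surv.
have gi (j : E) : growth (fun a : nat => a%:R : R) by exact: growth_id.
have step01 l1 n1 : 0 <= step P q (w l1 n1) i z <= 1.
  apply/andP; split.
    rewrite -[leLHS](step_cst q hP 0 i z); apply: (le_step hP hmom2) => //.
      by move=> j; apply: (@bounded_growth _ _ 0) => a; rewrite normr0.
    by move=> j a; apply: abel_ge0 => // k; exact: surv_ge0.
  rewrite -[leRHS](step_cst q hP 1 i z); apply: (le_step hP hmom2) => //.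
    by move=> j; apply: (@bounded_growth _ _ 1) => a; rewrite normr1.
  by move=> j a; apply: abel_le1 => // k; exact: surv_le1.
have [z0|z0] := posnP z.
  rewrite z0 /w !(absurv_z0 q hP) (surv_z0 q hP) !mul0r !mulr0 mul0r !add0r divr_ge0//.
    by rewrite exprn_ge0//; case/andP: (s01 l').
  exact: ltW.
have z1 : 1 <= (z%:R : R) by rewrite ler1n.
have /andP[s0 s1] : 0 <= s <= 1 := s01 l.
have /andP[s'0 s'1] : 0 <= s' <= 1 := s01 l'.
have up : w l (m + n).+1 i z <= (1 - s) + step P q (w l (m + n)) i z.
  rewrite /w absurvS// -/s surv_0 // mulr1 lerD2l ler_piMl//.
  by case/andP: (step01 l (m + n)).
have lo : step P q (w l' (m + n')) i z - (1 - s') <= w l' (m + n').+1 i z.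
  rewrite /w absurvS// -/s' surv_0 // mulr1 -/(w l' _).
  have /andP[h0 h1] := step01 l' (m + n').
  rewrite -/(w l' (m + n')).
  have : (1 - s') * step P q (w l' (m + n')) i z <= (1 - s') * 1 by rewrite ler_wpM2l ?subr_ge0.
  have := s'1; rewrite /w; lra.
have mid : step P q (w l (m + n)) i z / l <=
    step P q (w l' (m + n')) i z / l' + 2 * K * surv P q m.+1 i z
    + c * (l + l') * (M * z%:R) + killing kappa l' ^+ n' / l'.
  have hc : 0 <= c * (l + l') by rewrite mulr_ge0// addr_ge0// ltW.
  pose psi j a := (l'^-1 * w l' (m + n') j a + 2 * K * surv P q m j a) +
     (c * (l + l') * a%:R + killing kappa l' ^+ n' / l').
  have gA j : growth (fun a => l'^-1 * w l' (m + n') j a) by exact: growthZ.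
  have gB j : growth (fun a => 2 * K * surv P q m j a) by exact: growthZ.
  have gC (j : E) : growth (fun a : nat => c * (l + l') * a%:R) by exact/growthZ/growth_id.
  have gD (j : E) : growth (fun a : nat => killing kappa l' ^+ n' / l').
    by apply: (@bounded_growth _ _ `|killing kappa l' ^+ n' / l'|).
  have gAB j := growthD (gA j) (gB j).
  have gCD j := growthD (gC j) (gD j).
  apply: le_trans (_ : step P q psi i z <= _).
    rewrite mulrC -(stepZ P hmom2 _ _ _ (gw l (m + n)%N)); apply: (le_step hP hmom2).
    - by move=> j; exact: (growthZ _ (gw l (m + n)%N j)).
    - by move=> j; exact: (growthD (gAB j) (gCD j)).
    move=> j a; rewrite mulrC; apply: le_trans (IH l l' n n' j a hl hl') _.
    by rewrite /psi [_ / l']mulrC [c * a%:R * _]mulrAC addrA.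
  rewrite (stepD P hmom2 i z gAB gCD) (stepD P hmom2 i z gA gB) (stepD P hmom2 i z gC gD).
  rewrite step_cst// !(stepZ P hmom2)// -survS//.
  rewrite [l'^-1 * _]mulrC addrA lerD2r lerD2l.
  by rewrite ler_wpM2l.
have e1 : (1 - s) / l <= kappa * l.
  rewrite ler_pdivrMr// -mulrA -expr2; exact: killing_small.
have e2 : (1 - s') / l' <= kappa * l'.
  rewrite ler_pdivrMr// -mulrA -expr2; exact: killing_small.
have up' : w l (m + n).+1 i z / l <= kappa * l + step P q (w l (m + n)) i z / l.
  apply: le_trans (_ : ((1 - s) + step P q (w l (m + n)) i z) / l <= _).
    by rewrite ler_pM2r ?invr_gt0.
  by rewrite mulrDl lerD2r.
have lo' : step P q (w l' (m + n')) i z / l' <= w l' (m + n').+1 i z / l' + kappa * l'.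
  rewrite -lerBlDr; apply: le_trans (_ : (step P q (w l' (m + n')) i z - (1 - s')) / l' <= _).
    by rewrite mulrBl lerD2l lerN2.
  by rewrite ler_pM2r ?invr_gt0.
have kz : kappa * (l + l') <= kappa * (l + l') * z%:R.
  by rewrite ler_peMr// mulr_ge0 ?addr_ge0// ltW.
rewrite addSn mulrDl.
move: up' lo' mid kz; lra.
Qed.

Lemma absurv_nondec l i z : nondecreasing_seq (fun n => w l n i z).
Proof.
apply/nondecreasing_seqP => n; rewrite /w /absurv /abel big_ord_recr /= lerDl.
have /andP[s0 s1] := s01 l.
by rewrite !mulr_ge0 ?subr_ge0 ?exprn_ge0 ?surv_ge0.
Qed.

Lemma absurv_le1 l n i z : w l n i z <= 1.
Proof. by apply: abel_le1 => // k; exact: surv_le1. Qed.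

Lemma absurv_cvg l i z : cvgn (fun n => w l n i z).
Proof.
apply: nondecreasing_is_cvgn; first exact: absurv_nondec.
by exists 1 => _ [n _ <-]; exact: absurv_le1.
Qed.

Definition Wlim l i z := limn (fun n => w l n i z).

Lemma absurv_le_Wlim l n i z : w l n i z <= Wlim l i z.
Proof.
apply: (nondecreasing_cvgn_le (u_ := fun n => w l n i z)).
  exact: absurv_nondec.
exact: absurv_cvg.
Qed.

Lemma Wlim_le l i z x : (forall n, w l n i z <= x) -> Wlim l i z <= x.
Proof. by move=> h; apply: limr_le; [exact: absurv_cvg|near=> n; exact: h].
Unshelve. all: by end_near. Qed.

Lemma surv_noninc_le i z m n : (m <= n)%N -> surv P q n i z <= surv P q m i z.
Proof.
move=> mn; have /nonincreasing_seqP : forall n, surv P q n.+1 i z <= surv P q n i z.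
  by move=> k; exact: surv_noninc.
by move/(_ _ _ mn).
Qed.

(** By monotonicity, [surv n] times [1 - killing kappa l ^+ n] is at most the Abel mean, hence at
    most [l * (y + K)], which is small for small [l]. *)
Lemma surv_vanishes i z e : 0 < e -> exists m, surv P q m i z <= e.
Proof.
move=> e0; case: z => [|z]; first by exists 0%N; rewrite (surv_z0 q hP) ltW.
have K1' := K1; have l0' := l0_gt0.
set y := ln (z.+1%:R : R).
have y0 : 0 <= y by rewrite ln_ge0// ler1n.
pose l := Num.min l0 (e / 2 / (y + K)).
have l_gt0 : 0 < l by rewrite lt_min l0' !divr_gt0//; lra.
have ll : 0 < l <= l0 by rewrite l_gt0 ge_min lexx.
have le : l * (y + K) <= e / 2.
  by rewrite -ler_pdivlMr ?ge_min ?lexx ?orbT//; lra.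
have h2 : (0 : R) < 1 / 2 by rewrite divr_gt0.
have [n /(_ n (leqnn n)) hn] := killing_expn_le kappa0 l_gt0 h2.
exists n.
have h : surv P q n i z.+1 * (1 - killing kappa l ^+ n) <= w l n i z.+1.
  rewrite -abel_cst; have /andP[s0 s1] := s01 l.
  apply: ler_sum => k _; rewrite ler_wpM2l ?mulr_ge0 ?subr_ge0 ?exprn_ge0//.
  exact/surv_noninc_le/ltnW.
have := w_upper n i ll (ltn0Sn z); rewrite -/y.
have := expR_ge1Dx (- (l * y)).
have sv := surv_ge0 hP hmean hmom2 n i z.+1.
have h3 : surv P q n i z.+1 * (1 / 2) <= surv P q n i z.+1 * (1 - killing kappa l ^+ n).
  by rewrite ler_wpM2l//; lra.
move: le h h3; lra.
Qed.

(* running [m] generations first turns the [O(1)] gap between the quotients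
   [w / l] for two values of [l] into [O(surv m)] plus a multiple of [l + l'] *)
Lemma Wlim_ratio_cauchy i z e : 0 < e -> exists2 del, 0 < del &
  forall l l', 0 < l <= del -> 0 < l' <= del -> Wlim l i z / l <= Wlim l' i z / l' + e.
Proof.
move=> e0; have K1' := K1; have l0' := l0_gt0.
have eK : 0 < e / 4 / K by rewrite !divr_gt0//; lra.
have [m hm] := surv_vanishes i z eK.
have [c c0 comp] := comparison m.
pose del := Num.min l0 (e / 4 / (c * z%:R + 1)).
have cz : 0 <= c * z%:R by rewrite mulr_ge0.
have del0 : 0 < del by rewrite lt_min l0' !divr_gt0//; lra.
exists del => // l l' /andP[l_gt0 ld] /andP[l'_gt0 l'd].
have ll0 : 0 < l <= l0 by rewrite l_gt0 (le_trans ld)// ge_min lexx.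
have ll0' : 0 < l' <= l0 by rewrite l'_gt0 (le_trans l'd)// ge_min lexx.
have cdel x : x <= del -> 0 < x -> c * z%:R * x <= e / 4.
  move=> xd x0; apply: le_trans (_ : (c * z%:R + 1) * del <= _).
    apply: ler_pM => //; first exact: ltW.
    by rewrite lerDl.
  by rewrite mulrC -ler_pdivlMr ?ge_min ?lexx ?orbT//; lra.
rewrite ler_pdivrMr//; apply: Wlim_le => n; rewrite -ler_pdivrMr//.
apply/ler_addgt0Pr => e' e'0.
have [n' /(_ n' (leqnn n')) hn'] := killing_expn_le kappa0 l'_gt0 (mulr_gt0 e'0 l'_gt0).
have h1 : w l n i z / l <= w l (m + n) i z / l.
  by rewrite ler_pM2r ?invr_gt0//; apply: absurv_nondec; exact: leq_addl.
apply: le_trans h1 _; apply: le_trans (comp l l' n n' i z ll0 ll0') _.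
have h2 : w l' (m + n') i z / l' <= Wlim l' i z / l'.
  by rewrite ler_pM2r ?invr_gt0//; exact: absurv_le_Wlim.
have h3 : killing kappa l' ^+ n' / l' <= e' by rewrite ler_pdivrMr.
have h4 : 2 * K * surv P q m i z <= e / 2.
  move: hm; rewrite ler_pdivlMr; last lra.
  lra.
have := cdel l ld l_gt0; have := cdel l' l'd l'_gt0.
rewrite mulrDr; move: h2 h3 h4; lra.
Qed.

Lemma Wlim_ratio_cvg i z : cvg (Wlim l i z / l @[l --> 0^'+]).
Proof.
apply: cvg_of_approx => e e0.
have [del del0 hdel] := Wlim_ratio_cauchy i z e0.
exists (Wlim del i z / del); near=> l.
have hl : 0 < l <= del.
  apply/andP; split; first by near: l; exact: nbhs_right_gt.
  by near: l; apply: nbhs_right_le.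
have hd : 0 < del <= del by rewrite del0 lexx.
rewrite ler_distlC; apply/andP; split.
  by rewrite lerBlDr; exact: hdel.
exact: hdel.
Unshelve. all: by end_near. Qed.

End SurvivalLimit.

Section OneSidedLimits.
Context {R : realType} {T : Type} (F : set_system T) {FF : Filter F}.

Lemma cvg_to_at_right (f : T -> R) (a : R) :
  f @ F --> a -> (\forall t \near F, a < f t) -> f @ F --> a^'+.
Proof.
move=> fa fr A hA; have := fa _ hA; rewrite /nbhs /= => h.
by apply: filterS2 h fr => t; apply.
Qed.

Lemma cvg_to_at_left (f : T -> R) (a : R) :
  f @ F --> a -> (\forall t \near F, f t < a) -> f @ F --> a^'-.
Proof.
move=> fa fr A hA; have := fa _ hA; rewrite /nbhs /= => h.
by apply: filterS2 h fr => t; apply.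
Qed.

End OneSidedLimits.

(* junk value outside of [0 <= s < 1] or if [g] grows too fast *)
Definition powsum {R : realType} (s : R) (g : nat -> R) : R :=
  limn (fun n => \sum_(k < n) s ^+ k * g k).

(** * Positivity of the limit *)

Section HarmonicPositivity.
Context {R : realType} {E : finType} (P : E -> E -> R) (r : E -> R).
Context (f : E -> R -> R) (C0 : R).
Hypothesis hP : stochastic P.
Hypothesis f_itv : forall j (t : R), 0 <= t < 1 -> 0 <= f j t < 1.
Hypothesis C0_ge0 : 0 <= C0.
Hypothesis f_inv : forall j (t : R), 0 <= t < 1 ->
  (1 - f j t)^-1 <= (expR (r j) * (1 - t))^-1 + C0.
Context (kappa l0 K : R).
Hypothesis kappa0 : 0 < kappa.
Hypothesis l0_gt0 : 0 < l0.
Hypothesis K1 : 1 <= K.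
Hypothesis harm_lower : forall (l : R) n i y, 0 < l <= l0 -> 0 <= y ->
    1 - expR (- (l * y)) - K * l - killing kappa l ^+ n
     <= abel (killing kappa l) n (fun k => harmE P f k i y).

Let linear_below i y := exists c del : R, [/\ 0 < c, 0 < del &
  forall l, 0 < l <= del -> exists N, forall n, (N <= n)%N ->
    c * l <= abel (killing kappa l) n (fun k => harmE P f k i y)].

Lemma linear_below_high i y : K + 2 <= y -> linear_below i y.
Proof.
move=> hy; have K1' := K1; have y3 : 3 <= y by lra.
have y2 : 0 < y ^+ 2 by rewrite exprn_gt0//; lra.
(* With [y >= K + 2], the barrier is at least [2 * l] minus the quadratic term [(l * y) ^+ 2] and
   the truncation term, each kept below [l / 2]. *)
exists (2^-1), (Num.min l0 (2 * y ^+ 2)^-1); split => //.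
  by rewrite lt_min l0_gt0 invr_gt0 mulr_gt0.
move=> l /andP[l_gt0]; rewrite le_min => /andP[ll0 ly].
have l2 : 0 < l / 2 by rewrite divr_gt0.
have [N hN] := killing_expn_le kappa0 l_gt0 l2.
exists N => n /hN hn.
have hl : 0 < l <= l0 by rewrite l_gt0.
apply: le_trans (harm_lower n i hl _); last by lra.
have h := onem_expRN_ge (mulr_ge0 (ltW l_gt0) (le_trans (ler0n _ 3) y3)).
have h2 : (l * y) ^+ 2 <= l / 2.
  have : l * (2 * y ^+ 2) <= 1.
    have p0 : 0 < 2 * y ^+ 2 by apply: mulr_gt0.
    by rewrite -(ler_pdivlMr _ _ p0) div1r.
  have -> : (l * y) ^+ 2 = l * (l * (2 * y ^+ 2)) / 2 by field.
  by move=> h3; rewrite ler_pM2r ?invr_gt0// ler_piMr// ltW.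
have h3 : l * (K + 2) <= l * y by rewrite ler_pM2l.
move: h h2 h3 hn; lra.
Qed.

(** The loss in [harmES_edge] does not depend on [l], so a lower bound of order [l] survives the
    finitely many steps of a path back from a high level. *)
Lemma linear_below_step i j y : 0 < P i j -> linear_below j (y + r j) -> linear_below i y.
Proof.
move=> Pij [c [del [c0 del0 hc]]]; have k0 := kappa0.
set a := P i j / (1 + C0 * expR (- y)).
have a0 : 0 < a by rewrite divr_gt0// ltr_pwDl// mulr_ge0// expR_ge0.
(* The halving covers the killing factor, which is at least 1/2 when [l] is at most 1 and at most
   [kappa^-1]. *)
exists (a * c / 2), (Num.min del (Num.min 1 kappa^-1)); split.
- by rewrite divr_gt0// mulr_gt0.
- by rewrite !lt_min del0 invr_gt0 k0 ltr01.
move=> l /andP[l_gt0]; rewrite !le_min => /and3P[ld l1 lk].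
have hl : 0 < l <= del by rewrite l_gt0.
have [N hN] := hc l hl.
exists N.+1 => -[//|n]; rewrite ltnS => /hN hn.
have s01 := killing_itv kappa0 l; have /andP[s0 s1] := s01.
have s2 : 1 / 2 <= killing kappa l.
  rewrite /killing div1r lef_pV2 ?posrE//; last first.
    by apply: lt_le_trans (killing_den kappa0 l).
  have : kappa * l <= 1 by rewrite mulrC -ler_pdivlMr// div1r.
  rewrite expr2 mulrA => h.
  have : kappa * l * l <= 1 * 1 by apply: ler_pM => //; rewrite ?mulr_ge0// ltW.
  lra.
rewrite abelSl.
apply: le_trans (_ : killing kappa l * (a * abel (killing kappa l) n
   (fun k => harmE P f k j (y + r j))) <= _).
  apply: le_trans (_ : 1 / 2 * (a * (c * l)) <= _).
    by rewrite le_eqVlt; apply/orP; left; apply/eqP; field.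
  apply: ler_pM => //.
    by apply: mulr_ge0; [exact: ltW|apply: mulr_ge0; exact: ltW].
  by rewrite ler_pM2l.
rewrite -[leLHS]add0r; apply: lerD.
  by rewrite mulr_ge0 ?subr_ge0// harmE_ge0.
rewrite ler_wpM2l// -abelZ; apply: le_abel => // k.
exact: harmES_edge.
Qed.

Lemma linear_below_reach i y x : reach P r i x -> K + 2 <= y + x -> linear_below i y.
Proof.
move=> h; elim: h y => [{}i|{}i j {}x Pij _ IH] y hy.
  by apply: linear_below_high; rewrite addr0 in hy.
by apply: (linear_below_step Pij); apply: IH; rewrite -addrA.
Qed.

Lemma harmE_linear_below i y : (forall M, exists2 x, M <= x & reach P r i x) ->
  exists c del : R, [/\ 0 < c, 0 < del &
  forall l, 0 < l <= del -> exists N, forall n, (N <= n)%N ->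
    c * l <= abel (killing kappa l) n (fun k => harmE P f k i y)].
Proof.
move=> h; have [x hx rx] := h (K + 2 - y).
by apply: (linear_below_reach rx); lra.
Qed.

End HarmonicPositivity.

Section SurvivalAbelLimit.
Context {R : realType} {E : finType} (P : E -> E -> R).
Context (q : E -> probability nat R) (nu : E -> R).
Hypothesis hP : stochastic P.
Hypothesis hmean : forall i, (0 < 'E_(q i)[fun m : nat => m%:R%R])%E.
Hypothesis hmom2 : forall i, ('E_(q i)[fun m : nat => (m%:R ^+ 2)%R] < +oo)%E.
Hypothesis hnu : invariant_probability P nu.
Hypothesis hirr : irreducible P.
Hypothesis hlat : non_lattice P (rho q).
Hypothesis hmean0 : \sum_i nu i * rho q i = 0.

(** The function of [s] is the inverse of [killing kappa], so limits as [l] decreases to 0 become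
    limits as [s] increases to 1. *)
Let killing_param (kappa : R) : 0 < kappa ->
  (Num.sqrt ((s^-1 - 1) / kappa)) @[s --> (1:R)^'-] --> (0:R)^'+.
Proof.
move=> k0; apply: cvg_to_at_right; last first.
  near=> s; rewrite sqrtr_gt0 divr_gt0// subr_gt0 invf_gt1.
    by near: s; exact: nbhs_left_lt.
  by near: s; apply: nbhs_left_gt; exact: ltr01.
rewrite -[X in _ --> X]sqrtr0.
apply: (cvg_comp (fun s => (s^-1 - 1) / kappa) Num.sqrt); last exact: sqrt_continuous.
rewrite (_ : 0 = (1^-1 - 1) / kappa); last by rewrite invr1 subrr mul0r.
apply: cvgM; last exact: cvg_cst.
apply: cvgB; last exact: cvg_cst.
apply: cvgV; first exact: oner_neq0.
by apply: cvg_at_left_filter; exact: cvg_id.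
Unshelve. all: by end_near. Qed.

Theorem survival_abel_cvg i z : (0 < z)%N -> exists2 c : R, 0 < c &
  Num.sqrt (1 - s) * powsum s (fun k => surv P q k i z) @[s --> (1:R)^'-] --> c.
Proof.
move=> z0.
have f_itv := genfun_itv1 hmean hmom2; have f_le := genfun_le_rho hmean hmom2.
have [C0 C00 f_inv] := genfun_inv_rho hmean hmom2.
have [kappa [u [C [k0 C1 hu1 hu2]]]] := approximate_eigenfunction hP hirr hnu hlat hmean0.
have [l1 [K1 [l10 l11 K11 up]]] := minE_upper hP f_itv f_le k0 C1 hu1 hu2.
have [l2 [K2 [l20 l21 K21 lo]]] := harmE_lower hP f_itv f_le C00 f_inv k0 C1 hu1 hu2.
pose l0 := Num.min l1 l2; pose K := Num.max K1 K2.
have l0_gt0 : 0 < l0 by rewrite lt_min l10.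
have l0_le1 : l0 <= 1 by rewrite ge_min l11.
have K_ge1 : 1 <= K by rewrite le_max K11.
have lz (z' : nat) : (0 < z')%N -> 0 <= ln (z'%:R : R) by move=> ?; rewrite ln_ge0// ler1n.
have w_upper (l : R) n i' z' : 0 < l <= l0 -> (0 < z')%N ->
    absurv P q (killing kappa l) n i' z' <= 1 - expR (- (l * ln z'%:R)) + K * l.
  rewrite le_min => /andP[lg /andP[ll1 ll2]] z'0.
  have hl : 0 < l <= l1 by rewrite lg.
  apply: le_trans (_ : 1 - expR (- (l * ln z'%:R)) + K1 * l <= _).
    apply: le_trans (up l n i' _ hl (lz _ z'0)).
    by apply: le_abel => [|k]; [exact: killing_itv|exact: surv_le_minE].
  by rewrite lerD2l ler_pM2r// le_max lexx.
have harm_low (l : R) n i' y : 0 < l <= l0 -> 0 <= y ->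
    1 - expR (- (l * y)) - K * l - killing kappa l ^+ n
     <= abel (killing kappa l) n (fun k => harmE P (fun j => genfun (q j)) k i' y).
  rewrite le_min => /andP[lg /andP[ll1 ll2]] y0.
  have hl : 0 < l <= l2 by rewrite lg.
  apply: le_trans (lo l n i' y hl y0).
  by rewrite lerD2r lerD2l lerN2 ler_pM2r// le_max lexx orbT.
have w_lower (l : R) n i' z' : 0 < l <= l0 -> (0 < z')%N ->
    1 - expR (- (l * ln z'%:R)) - K * l - killing kappa l ^+ n <=
    absurv P q (killing kappa l) n i' z'.
  move=> hl z'0; apply: le_trans (harm_low l n i' _ hl (lz _ z'0)) _.
  by apply: le_abel => [|k]; [exact: killing_itv|exact: harmE_le_surv].
have := Wlim_ratio_cvg hP hmean hmom2 k0 l0_gt0 K_ge1 w_upper w_lower (i := i) (z := z).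
set W := Wlim P q kappa; set U := lim _ => hU.
have [c [del [c0 del0 hc]]] := harmE_linear_below hP f_itv C00 f_inv k0 l0_gt0 K_ge1
  harm_low (ln z%:R) (reach_unbounded hP hlat hirr hnu hmean0 i).
have U0 : c <= U.
  apply: limr_ge => //; near=> l.
  have hl : 0 < l <= del.
    apply/andP; split; first by near: l; exact: nbhs_right_gt.
    by near: l; apply: nbhs_right_le.
  have [N hN] := hc l hl; have /andP[l_gt0 _] := hl.
  rewrite ler_pdivlMr//; apply: le_trans (hN N (leqnn N)) _.
  apply: le_trans (absurv_le_Wlim hP hmean hmom2 k0 l N i z).
  by apply: le_abel => [|k]; [exact: killing_itv|exact: harmE_le_surv].
exists (U / Num.sqrt kappa).
  by rewrite divr_gt0 ?sqrtr_gt0//; apply: lt_le_trans U0.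
(* For [l] the parameter of [s], one has [l * sqrt (s * kappa) = sqrt (1 - s)], which converts
   division by [l] into the normalization by [sqrt (1 - s)]. *)
have key : {near (1:R)^'-, (fun s => W (Num.sqrt ((s^-1 - 1) / kappa)) i z /
    Num.sqrt ((s^-1 - 1) / kappa) / Num.sqrt (s * kappa)) =1
    (fun s => Num.sqrt (1 - s) * powsum s (fun k => surv P q k i z))}.
  near=> s.
  have s1 : s < 1 by near: s; exact: nbhs_left_lt.
  have s0 : 0 < s by near: s; apply: nbhs_left_gt; exact: ltr01.
  set l := Num.sqrt ((s^-1 - 1) / kappa).
  have ll : l ^+ 2 = (s^-1 - 1) / kappa.
    by rewrite sqr_sqrtr// divr_ge0 ?ltW// subr_gt0 invf_gt1.
  have ks : killing kappa l = s.
    by rewrite /killing ll [kappa * _]mulrC divfK ?gt_eqF// addrC subrK invrK.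
  have -> : W l i z = (1 - s) * powsum s (fun k => surv P q k i z).
    have cv := @absurv_cvg _ _ _ _ hP hmean hmom2 _ k0 l i z.
    have e n : absurv P q (killing kappa l) n i z =
        (1 - s) * \sum_(k < n) s ^+ k * surv P q k i z.
      by rewrite ks /absurv /abel mulr_sumr; apply: eq_bigr => k _; ring.
    have s1' : 1 - s != 0 by rewrite gt_eqF// subr_gt0.
    have cv' : cvgn (fun n => \sum_(k < n) s ^+ k * surv P q k i z).
      have -> : (fun n => \sum_(k < n) s ^+ k * surv P q k i z) =
          (fun n => (1 - s)^-1 * absurv P q (killing kappa l) n i z).
        by apply/funext => n; rewrite e mulrA mulVf ?mul1r.
      exact: is_cvgMl_tmp.
    have := cvgM (cvg_cst (1 - s)) cv'.
    rewrite (_ : cst (1 - s) \* _ = fun n => absurv P q (killing kappa l) n i z); last first.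
      by apply/funext => n; rewrite e.
    by move=> h; apply: cvg_lim => //; exact: h.
  rewrite -mulrA -invfM -sqrtrM; last first.
    by rewrite divr_ge0 ?ltW// subr_gt0 invf_gt1.
  have -> : (s^-1 - 1) / kappa * (s * kappa) = 1 - s by field; rewrite !gt_eqF.
  have q0 : 0 < Num.sqrt (1 - s) by rewrite sqrtr_gt0 subr_gt0.
  rewrite mulrAC; congr (_ * _).
  rewrite -{1}[1 - s]sqr_sqrtr ?subr_ge0 ?ltW// expr2 mulfK// gt_eqF//.
apply: cvg_trans; first exact: (near_eq_cvg key).
apply: cvgM.
  apply: (cvg_comp (fun s => Num.sqrt ((s^-1 - 1) / kappa)) (fun l => W l i z / l)).
    exact: killing_param.
  exact: hU.
apply: cvgV; first by rewrite gt_eqF ?sqrtr_gt0.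
rewrite -[X in _ --> Num.sqrt X]mul1r.
apply: (cvg_comp (fun s => s * kappa) Num.sqrt); last exact: sqrt_continuous.
apply: cvgM; last exact: cvg_cst.
by apply: cvg_at_left_filter; exact: cvg_id.
Unshelve. all: by end_near. Qed.

End SurvivalAbelLimit.

(** * A Tauberian theorem for monotone sequences *)

Section PowerSums.
Context {R : realType}.
Implicit Types (s c : R) (g h : nat -> R).

Definition bounded_seq g := exists M : R, forall k, `|g k| <= M.

Lemma bounded_seq_cst c : bounded_seq (fun=> c).
Proof. by exists `|c|. Qed.

Lemma bounded_seqD g h : bounded_seq g -> bounded_seq h -> bounded_seq (fun k => g k + h k).
Proof.
move=> [M hM] [N hN]; exists (M + N) => k.
by apply: le_trans (ler_normD _ _) _; exact: lerD.
Qed.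

Lemma bounded_seqM g h : bounded_seq g -> bounded_seq h -> bounded_seq (fun k => g k * h k).
Proof.
move=> [M hM] [N hN]; exists (M * N) => k.
by rewrite normrM; exact: ler_pM.
Qed.

Lemma sum_geom_le s n : 0 <= s < 1 -> \sum_(k < n) s ^+ k <= (1 - s)^-1.
Proof.
move=> /andP[s0 s1].
have := abel_cst s n 1; rewrite /abel mul1r.
under eq_bigr do rewrite mulr1.
rewrite -mulr_sumr => e.
rewrite -(ler_pM2l (_ : 0 < 1 - s)) ?subr_gt0// e mulfV; last first.
  by rewrite gt_eqF// subr_gt0.
by rewrite lerBlDr lerDl exprn_ge0.
Qed.

Lemma powsum_cvg s g : 0 <= s < 1 -> bounded_seq g ->
  cvgn (fun n => \sum_(k < n) s ^+ k * g k).
Proof.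
move=> s01 [M hM]; have /andP[s0 s1] := s01.
have M0 : 0 <= M by apply: le_trans (hM 0%N).
have pos h : (forall k, 0 <= h k <= 2 * M) -> cvgn (fun n => \sum_(k < n) s ^+ k * h k).
  move=> hh; apply: nondecreasing_is_cvgn.
    apply/nondecreasing_seqP => n; rewrite big_ord_recr /= lerDl mulr_ge0 ?exprn_ge0//.
    by have /andP[] := hh n.
  exists (2 * M * (1 - s)^-1) => _ [n _ <-].
  apply: le_trans (_ : \sum_(k < n) s ^+ k * (2 * M) <= _).
    apply: ler_sum => k _; rewrite ler_wpM2l ?exprn_ge0//.
    by have /andP[] := hh k.
  by rewrite -mulr_suml mulrC ler_wpM2l ?mulr_ge0// sum_geom_le.
have -> : (fun n => \sum_(k < n) s ^+ k * g k) =
    (fun n => \sum_(k < n) s ^+ k * (g k + M)) \- (fun n => \sum_(k < n) s ^+ k * M).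
  apply/funext => n /=; rewrite -sumrB; apply: eq_bigr => k _; ring.
apply: is_cvgB; [apply: (pos (fun k => g k + M)) => k|apply: (pos (fun=> M)) => k].
  by have := hM k; rewrite ler_norml => /andP[h1 h2]; apply/andP; split; lra.
by apply/andP; split; lra.
Qed.

Lemma powsumD s g h : 0 <= s < 1 -> bounded_seq g -> bounded_seq h ->
  powsum s (fun k => g k + h k) = powsum s g + powsum s h.
Proof.
move=> s01 bg bh; rewrite /powsum; apply: cvg_lim => //.
rewrite (_ : (fun n => _) =
    fun n => \sum_(k < n) s ^+ k * g k + \sum_(k < n) s ^+ k * h k).
  by apply: cvgD; exact: powsum_cvg.
apply/funext => n; rewrite -big_split.
by apply: eq_bigr => k _; rewrite mulrDr.
Qed.

Lemma powsumZ s c g : 0 <= s < 1 -> bounded_seq g ->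
  powsum s (fun k => c * g k) = c * powsum s g.
Proof.
move=> s01 bg; rewrite /powsum; apply: cvg_lim => //.
rewrite (_ : (fun n => _) = fun n => c * \sum_(k < n) s ^+ k * g k).
  by apply: cvgM; [exact: cvg_cst|exact: powsum_cvg].
by apply/funext => n; rewrite mulr_sumr; apply: eq_bigr => k _; rewrite mulrCA.
Qed.

Lemma powsumB s g h : 0 <= s < 1 -> bounded_seq g -> bounded_seq h ->
  powsum s (fun k => g k - h k) = powsum s g - powsum s h.
Proof.
move=> s01 bg bh.
have bh' : bounded_seq (fun k => -1 * h k).
  by apply: bounded_seqM => //; exact: bounded_seq_cst.
rewrite -[X in _ - X]mul1r -mulNr -powsumZ// -powsumD//.
by congr powsum; apply/funext => k; rewrite mulN1r.
Qed.

Lemma le_powsum s g h : 0 <= s < 1 -> bounded_seq g -> bounded_seq h ->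
  (forall k, g k <= h k) -> powsum s g <= powsum s h.
Proof.
move=> s01 bg bh gh; apply: ler_lim; [exact: powsum_cvg|exact: powsum_cvg|].
near=> n; apply: ler_sum => k _; rewrite ler_wpM2l// exprn_ge0//.
by case/andP: s01.
Unshelve. all: by end_near. Qed.

Lemma powsum_ge_partial s g n : 0 <= s < 1 -> bounded_seq g -> (forall k, 0 <= g k) ->
  \sum_(k < n) s ^+ k * g k <= powsum s g.
Proof.
move=> s01 bg g0; have /andP[s0 s1] := s01.
apply: (nondecreasing_cvgn_le (u_ := fun n => \sum_(k < n) s ^+ k * g k)).
  apply/nondecreasing_seqP => m; rewrite big_ord_recr /= lerDl.
  by rewrite mulr_ge0 ?exprn_ge0.
exact: powsum_cvg.
Qed.

Lemma powsum1 s : 0 <= s < 1 -> powsum s (fun=> 1) = (1 - s)^-1.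
Proof.
move=> s01; have /andP[s0 s1] := s01.
have s1' : 1 - s != 0 by rewrite gt_eqF// subr_gt0.
rewrite /powsum; apply: cvg_lim => //.
rewrite (_ : (fun n => _) = fun n => (1 - s)^-1 * (1 - s ^+ n)).
  rewrite -[X in _ --> X]mulr1 -[X in _ * X]subr0.
  apply: cvgM; first exact: cvg_cst.
  by apply: cvgB; [exact: cvg_cst|apply: cvg_expr; rewrite ger0_norm].
apply/funext => n; have := abel_cst s n 1; rewrite mul1r => <-.
rewrite /abel mulr_sumr; by apply: eq_bigr => k _; rewrite !mulr1 mulrA mulVf ?mul1r.
Qed.

(** Karamata's observation: a power of [s ^+ k] used as a weight only changes the point at which the
    series is evaluated. *)
Lemma powsum_shift s g j : powsum s (fun k => (s ^+ k) ^+ j * g k) = powsum (s ^+ j.+1) g.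
Proof.
rewrite /powsum; congr (limn _); apply/funext => n; apply: eq_bigr => k _.
by rewrite mulrA -exprS -!exprM mulnC.
Qed.

End PowerSums.

(** * Polynomial approximation of tent functions *)

Section PolynomialApproximation.
Context {R : realType}.
Implicit Types (phi psi : R -> R) (x c : R).

Definition poly_approx phi := forall e : R, 0 < e ->
  exists Q : {poly R}, forall x, 0 <= x <= 1 -> `|phi x - Q.[x]| <= e.

Lemma poly_approxD phi psi : poly_approx phi -> poly_approx psi ->
  poly_approx (fun x => phi x + psi x).
Proof.
move=> h1 h2 e e0; have e20 : 0 < e / 2 by rewrite divr_gt0.
have [Q1 q1] := h1 _ e20; have [Q2 q2] := h2 _ e20.
exists (Q1 + Q2) => x x01; rewrite hornerD opprD addrACA.
by apply: le_trans (ler_normD _ _) _; rewrite [e]splitr lerD ?q1 ?q2.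
Qed.

Lemma poly_approxZ phi c : poly_approx phi -> poly_approx (fun x => c * phi x).
Proof.
move=> h e e0; have c0 : 0 < `|c| + 1 by rewrite ltr_wpDl.
have [Q q] := h _ (divr_gt0 e0 c0).
exists (c *: Q) => x x01; rewrite hornerZ -mulrBr normrM.
apply: le_trans (_ : (`|c| + 1) * (e / (`|c| + 1)) <= _).
  by apply: ler_pM => //; [rewrite lerDl|exact: q].
by rewrite mulrC divfK// gt_eqF.
Qed.

(** The classical iteration for the square root of [('X - c) ^+ 2]. *)
Fixpoint abs_poly c n : {poly R} :=
  if n is m.+1 then
    abs_poly c m + 2^-1 *: (('X - c%:P) ^+ 2 - abs_poly c m ^+ 2)
  else 0.

(** One iteration multiplies the error [a - p] by [1 - (a + p) / 2], which lies between 0 and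
    [1 - a / 2]. *)
Lemma abs_polyP c n x : 0 <= c <= 1 -> 0 <= x <= 1 ->
  0 <= (abs_poly c n).[x] /\
  0 <= `|x - c| - (abs_poly c n).[x] <= `|x - c| * (1 - `|x - c| / 2) ^+ n.
Proof.
move=> /andP[c0 c1] /andP[x0 x1].
have a1 : `|x - c| <= 1 by rewrite ler_norml; apply/andP; split; lra.
have a0 := normr_ge0 (x - c).
elim: n => [|n [p0 /andP[e0 e1]]] /=.
  by rewrite horner0 subr0 expr0 mulr1 lexx a0.
rewrite !hornerE -(real_normK (num_real (x - c))).
move: a0 a1 e0 e1 p0; set a := `|_|; set p := (abs_poly c n).[x] => a0 a1 e0 e1 p0.
have -> : a - (p + 2^-1 * (a ^+ 2 - p ^+ 2)) = (a - p) * (1 - (a + p) / 2) by field.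
have h0 : 0 <= 1 - (a + p) / 2 by lra.
split.
  have : 0 <= (a - p) * (a + p) by rewrite mulr_ge0//; lra.
  rewrite -subr_sqr; lra.
rewrite mulr_ge0//= exprSr mulrA; apply: ler_pM => //; lra.
Qed.

Lemma poly_approx_dist c : 0 <= c <= 1 -> poly_approx (fun x => `|x - c|).
Proof.
move=> c01 e e0.
(* By [expr_onem_le1], the error [a * (1 - a / 2) ^+ n] is at most [2 / n], uniformly in [a]. *)
pose n := `|Num.ceil (2 / e)|%N.
have hn : 2 / e <= n%:R.
  apply: le_trans (ceil_ge _) _.
  by rewrite natr_absz ler_int ler_norm.
exists (abs_poly c n) => x x01.
have [p0 /andP[e1 e2]] := abs_polyP n c01 x01.
rewrite ger0_norm//; apply: le_trans e2 _.
set a := `|x - c|; have a0 : 0 <= a by exact: normr_ge0.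
have a1 : a <= 1.
  by move: c01 x01 => /andP[? ?] /andP[? ?]; rewrite ler_norml; apply/andP; split; lra.
have t01 : 0 <= 1 - a / 2 <= 1 by apply/andP; split; lra.
have := expr_onem_le1 n t01; set w := _ ^+ n => h.
have w0 : 0 <= w by have /andP[] := onem_expr_ge0 n t01.
have h2 : w * (n%:R * a) <= 2.
  have -> : w * (n%:R * a) = 2 * (w * (n%:R * (1 - (1 - a / 2)))) by field.
  rewrite ler_piMr//; apply: le_trans h; rewrite ler_wpM2l// lerDr//.
have h3 : w * a * (2 / e) <= 2.
  apply: le_trans h2; rewrite -mulrA ler_wpM2l// mulrC ler_wpM2r//.
move: h3; rewrite mulrA ler_pdivrMr// [2 * e]mulrC ler_pM2r// mulrC //.
Qed.

(** The tent supported on the interval from [a] to [b], with height [b - a] at the midpoint; it is a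
    combination of distances so that [poly_approx_dist] applies. *)
Definition tent (a b x : R) : R := `|x - a| + `|x - b| - 2 * `|x - (a + b) / 2|.

Lemma poly_approx_tent a b : 0 <= a <= 1 -> 0 <= b <= 1 -> poly_approx (tent a b).
Proof.
move=> a01 b01.
have m01 : 0 <= (a + b) / 2 <= 1.
  by move: a01 b01 => /andP[? ?] /andP[? ?]; apply/andP; split; lra.
have -> : tent a b = (fun x => (`|x - a| + `|x - b|) + (- 2) * `|x - (a + b) / 2|).
  by apply/funext => x; rewrite /tent mulNr.
apply: poly_approxD; last exact/poly_approxZ/poly_approx_dist.
by apply: poly_approxD; exact: poly_approx_dist.
Qed.

Lemma tent_ge0 a b x : 0 <= tent a b x.
Proof.
rewrite /tent subr_ge0; have := ler_normD (x - a) (x - b).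
have -> : (x - a) + (x - b) = 2 * (x - (a + b) / 2) by field.
by rewrite normrM ger0_norm.
Qed.

Lemma tent_eq0 a b x : a <= b -> x <= a \/ b <= x -> tent a b x = 0.
Proof.
move=> ab h; rewrite /tent.
by case: (ger0P (x - a)) => h1; case: (ger0P (x - b)) => h2;
  case: (ger0P (x - (a + b) / 2)) => h3; case: h => h; lra.
Qed.

Lemma tent_ge a b x : a + (b - a) / 4 <= x <= b - (b - a) / 4 -> (b - a) / 2 <= tent a b x.
Proof.
move=> /andP[xa xb]; rewrite /tent.
by case: (ger0P (x - a)) => h1; case: (ger0P (x - b)) => h2;
  case: (ger0P (x - (a + b) / 2)) => h3; lra.
Qed.

End PolynomialApproximation.

Section Tauberian.
Context {R : realType}.
Implicit Types (s c x : R) (g p : nat -> R) (phi : R -> R).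

Let near1_itv : \forall s \near (1 : R)^'-, 0 < s < 1.
Proof.
near=> s; apply/andP; split; last by near: s; exact: nbhs_left_lt.
by near: s; apply: nbhs_left_gt; exact: ltr01.
Unshelve. all: by end_near. Qed.

Lemma bounded_poly_seq (Q : {poly R}) s : 0 <= s < 1 -> bounded_seq (fun k => Q.[s ^+ k]).
Proof.
move=> /andP[s0 s1]; exists (\sum_(i < size Q) `|Q`_i|) => k.
rewrite horner_coef; apply: le_trans (ler_norm_sum _ _ _) _.
apply: ler_sum => i _; rewrite normrM ler_piMr// ger0_norm ?exprn_ge0//.
by rewrite exprn_ile1 ?exprn_ge0// exprn_ile1// ltW.
Qed.

Lemma bounded_approx_seq phi s : poly_approx phi -> 0 <= s < 1 ->
  bounded_seq (fun k => phi (s ^+ k)).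
Proof.
move=> h s01; have [Q hQ] := h 1 ltr01.
have [M hM] := bounded_poly_seq Q s01; exists (1 + M) => k.
have -> : phi (s ^+ k) = (phi (s ^+ k) - Q.[s ^+ k]) + Q.[s ^+ k] by rewrite subrK.
apply: le_trans (ler_normD _ _) _; apply: lerD => //; apply: hQ.
by apply: onem_expr_ge0; case/andP: s01 => -> /ltW ->.
Qed.

Lemma powsum_poly_cvg (w : R -> R) g (Q : {poly R}) : bounded_seq g ->
  (forall j : nat, cvg (w s * powsum (s ^+ j.+1) g @[s --> (1 : R)^'-])) ->
  cvg (w s * powsum s (fun k => Q.[s ^+ k] * g k) @[s --> (1 : R)^'-]).
Proof.
move=> bg hj.
pose F n s := w s * powsum s (fun k => (\sum_(i < n) Q`_i * (s ^+ k) ^+ i) * g k).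
suff H n : cvg (F n s @[s --> (1 : R)^'-]).
  rewrite (_ : (fun s => _) = F (size Q)) //; apply/funext => s.
  by congr (_ * powsum _ _); apply/funext => k; rewrite horner_coef.
elim: n => [|n IH].
  apply: (cvgP (0 : R)).
  suff key : {near (1 : R)^'-, (fun=> 0) =1 F 0%N}.
    by apply: cvg_trans; [exact: (near_eq_cvg key)|exact: cvg_cst].
  near=> s.
  have /andP[s0 s1] : 0 < s < 1 by near: s; exact: near1_itv.
  have s01 : 0 <= s < 1 by rewrite ltW.
  have -> : F 0%N s = w s * powsum s (fun k => 0 * g k).
    by congr (_ * powsum _ _); apply/funext => k; rewrite big_ord0.
  by rewrite powsumZ// mul0r mulr0.
move/cvg_ex: IH => [a ha]; have /cvg_ex[b hb] := hj n.
apply/cvg_ex; exists (a + Q`_n * b).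
have hab : F n s + Q`_n * (w s * powsum (s ^+ n.+1) g) @[s --> (1 : R)^'-] --> a + Q`_n * b.
  by apply: cvgD => //; apply: cvgM => //; exact: cvg_cst.
suff key : {near (1 : R)^'-, (fun s => F n s + Q`_n * (w s * powsum (s ^+ n.+1) g)) =1 F n.+1}.
  by apply: cvg_trans hab; exact: near_eq_cvg key.
near=> s.
have /andP[s0 s1] : 0 < s < 1 by near: s; exact: near1_itv.
have s01 : 0 <= s < 1 by rewrite ltW.
have bX i : bounded_seq (fun k => (s ^+ k) ^+ i).
  exists 1 => k; rewrite ger0_norm ?exprn_ge0 ?(ltW s0)//.
  by rewrite exprn_ile1 ?exprn_ge0 ?(ltW s0)// exprn_ile1 ?(ltW s0) ?ltW.
have bXg i : bounded_seq (fun k => (s ^+ k) ^+ i * g k) by exact: bounded_seqM.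
have bS : bounded_seq (fun k => (\sum_(i < n) Q`_i * (s ^+ k) ^+ i) * g k).
  apply: bounded_seqM => //.
  elim: (n) => [|m IHm].
    by exists 0 => k; rewrite big_ord0 normr0.
  have -> : (fun k => \sum_(i < m.+1) Q`_i * (s ^+ k) ^+ i) =
     (fun k => \sum_(i < m) Q`_i * (s ^+ k) ^+ i + Q`_m * (s ^+ k) ^+ m).
    by apply/funext => k; rewrite big_ord_recr.
  apply: bounded_seqD => //; apply: bounded_seqM => //; exact: bounded_seq_cst.
rewrite /F -powsum_shift.
have -> : (fun k => (\sum_(i < n.+1) Q`_i * (s ^+ k) ^+ i) * g k) =
   (fun k => (\sum_(i < n) Q`_i * (s ^+ k) ^+ i) * g k + Q`_n * ((s ^+ k) ^+ n * g k)).
  by apply/funext => k; rewrite big_ord_recr /= mulrDl mulrA.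
rewrite powsumD//; last by apply: bounded_seqM => //; exact: bounded_seq_cst.
by rewrite powsumZ// mulrDr mulrCA.
Unshelve. all: by end_near. Qed.

(** Karamata's argument. The normalization [w] is left free: it is [sqrt (1 - s)] for the survival
    probabilities and [1 - s] for the constant sequence. *)
Lemma powsum_approx_cvg (w : R -> R) g phi : bounded_seq g -> (forall k, 0 <= g k) ->
  (forall s, 0 < s < 1 -> 0 <= w s) ->
  (forall j : nat, cvg (w s * powsum (s ^+ j.+1) g @[s --> (1 : R)^'-])) ->
  poly_approx phi ->
  cvg (w s * powsum s (fun k => phi (s ^+ k) * g k) @[s --> (1 : R)^'-]).
Proof.
move=> bg g0 w0 hj hphi.
have /cvg_ex[c hc] := hj 0%N.
have C0 : 0 < `|c| + 1 by rewrite ltr_wpDl.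
apply: cvg_of_approx => e e0.
(* The uniform error of the polynomial gets multiplied by [w s * powsum s g], which is eventually at
   most [|c| + 1]. *)
have e' : 0 < e / 2 / (`|c| + 1) by rewrite !divr_gt0.
have [Q hQ] := hphi _ e'.
have /cvg_ex[b hb] := powsum_poly_cvg (Q := Q) bg hj.
exists b.
have e2 : 0 < e / 2 by rewrite divr_gt0.
move/cvgrPdist_le : hb => /(_ _ e2) hb.
move/cvgrPdist_le : hc => /(_ _ ltr01) hc.
near=> s.
have s01' : 0 < s < 1 by near: s; exact: near1_itv.
have s01 : 0 <= s < 1 by case/andP: s01' => /ltW -> ->.
have hbs : `|b - w s * powsum s (fun k => Q.[s ^+ k] * g k)| <= e / 2 by near: s.
have hcs : `|c - w s * powsum (s ^+ 1) g| <= 1 by near: s.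
rewrite expr1 in hcs.
rewrite (_ : b - _ = (b - w s * powsum s (fun k => Q.[s ^+ k] * g k)) +
   (w s * powsum s (fun k => Q.[s ^+ k] * g k) - w s * powsum s (fun k => phi (s ^+ k) * g k))); last by ring.
apply: le_trans (ler_normD _ _) _; rewrite [e in leRHS]splitr lerD//.
have bQ := bounded_seqM (bounded_poly_seq Q s01) bg.
have bphi := bounded_seqM (bounded_approx_seq hphi s01) bg.
have ws := w0 _ s01'.
rewrite -mulrBr -powsumB// normrM (ger0_norm ws).
have bd k : `|Q.[s ^+ k] * g k - phi (s ^+ k) * g k| <= e / 2 / (`|c| + 1) * g k.
  rewrite -mulrBl normrM (ger0_norm (g0 k)) ler_wpM2r// distrC; apply: hQ.
  by apply: onem_expr_ge0; case/andP: s01 => -> /ltW ->.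
have bB : bounded_seq (fun k => Q.[s ^+ k] * g k - phi (s ^+ k) * g k).
  have [M hM] := bg; exists (e / 2 / (`|c| + 1) * M) => k.
  apply: le_trans (bd k) _; rewrite ler_wpM2l ?(ltW e')//.
  by apply: le_trans (hM k); exact: ler_norm.
have bG : bounded_seq (fun k => e / 2 / (`|c| + 1) * g k).
  by apply: bounded_seqM => //; exact: bounded_seq_cst.
have nrm : `|powsum s (fun k => Q.[s ^+ k] * g k - phi (s ^+ k) * g k)| <=
    e / 2 / (`|c| + 1) * powsum s g.
  rewrite -powsumZ// ler_norml; apply/andP; split.
    rewrite -mulN1r -powsumZ//; apply: le_powsum => //.
      by apply: bounded_seqM => //; exact: bounded_seq_cst.
    by move=> k; have := bd k; rewrite ler_norml mulN1r => /andP[].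
  apply: le_powsum => // k; by have := bd k; rewrite ler_norml => /andP[].
apply: le_trans (ler_wpM2l ws nrm) _.
have hC : w s * powsum s g <= `|c| + 1.
  by move: hcs; rewrite ler_norml => /andP[h _]; have := ler_norm c; lra.
apply: le_trans (_ : e / 2 / (`|c| + 1) * (`|c| + 1) <= _).
  by rewrite mulrCA ler_wpM2l// ltW.
by rewrite divfK// gt_eqF.
Unshelve. all: by end_near. Qed.

Let geom_sum s j : (1 - s ^+ j) = (1 - s) * \sum_(i < j) s ^+ i.
Proof. by rewrite -opprB subrX1 -mulNr opprB. Qed.

Let expr_at_left j : s ^+ j.+1 @[s --> (1 : R)^'-] --> (1 : R)^'-.
Proof.
apply: cvg_to_at_left.
  rewrite -[X in _ --> X](expr1n R j.+1).
  have := @exprn_continuous R j.+1 1; rewrite /continuous_at => h.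
  by apply: cvg_at_left_filter.
near=> s; have /andP[s0 s1] : 0 < s < 1 by near: s; exact: near1_itv.
by rewrite exprn_ilt1// ltW.
Unshelve. all: by end_near. Qed.

Let sum_expr_cvg j : (\sum_(i < j.+1) s ^+ i) @[s --> (1 : R)^'-] --> (j.+1%:R : R).
Proof.
elim: j => [|j IH].
  rewrite (_ : (fun s : R => _) = cst 1); first exact: cvg_cst.
  by apply/funext => s; rewrite big_ord1 expr0.
rewrite (_ : (fun s : R => _) = (fun s => (\sum_(i < j.+1) s ^+ i) + s ^+ j.+1)); last first.
  by apply/funext => s; rewrite big_ord_recr.
rewrite -[X in _ --> X]natr1; apply: cvgD => //.
rewrite -[X in _ --> X](expr1n R j.+1).
have := @exprn_continuous R j.+1 1; rewrite /continuous_at => h.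
by apply: cvg_at_left_filter.
Qed.

(** Substitute [s ^+ j.+1] for [s] in the limit; the ratio [(1 - s ^+ j.+1) / (1 - s)] is a
    geometric sum, which tends to [j.+1]. *)
Lemma powsum_sqrt_cvg p c : Num.sqrt (1 - s) * powsum s p @[s --> (1 : R)^'-] --> c ->
  forall j : nat, cvg (Num.sqrt (1 - s) * powsum (s ^+ j.+1) p @[s --> (1 : R)^'-]).
Proof.
move=> hc j; apply: cvgP.
have h1 := cvg_comp (fun s : R => s ^+ j.+1) _ (expr_at_left j) hc.
have h2 : (Num.sqrt (\sum_(i < j.+1) s ^+ i))^-1 @[s --> (1 : R)^'-] --> (Num.sqrt (j.+1%:R : R))^-1.
  apply: cvgV; first by rewrite gt_eqF// sqrtr_gt0.
  apply: (cvg_comp (fun s : R => \sum_(i < j.+1) s ^+ i) Num.sqrt); first exact: sum_expr_cvg.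
  exact: sqrt_continuous.
have h12 := cvgM h1 h2.
apply: cvg_trans; last exact: h12.
apply: near_eq_cvg; near=> s.
have /andP[s0 s1] : 0 < s < 1 by near: s; exact: near1_itv.
have S0 : 0 < \sum_(i < j.+1) s ^+ i.
  by rewrite big_ord_recl expr0 ltr_pwDl// sumr_ge0// => i _; rewrite exprn_ge0// ltW.
rewrite /= geom_sum sqrtrM ?subr_ge0 ?(ltW s1)//.
have b0 : Num.sqrt (\sum_(i < j.+1) s ^+ i) != 0 by rewrite gt_eqF// sqrtr_gt0.
by rewrite [X in X / _]mulrAC mulfK.
Unshelve. all: by end_near. Qed.

Lemma powsum_one_cvg j : cvg ((1 - s) * powsum (s ^+ j.+1) (fun=> 1) @[s --> (1 : R)^'-]).
Proof.
have h : (\sum_(i < j.+1) s ^+ i)^-1 @[s --> (1 : R)^'-] --> (j.+1%:R : R)^-1.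
  by apply: cvgV; [rewrite pnatr_eq0|exact: sum_expr_cvg].
apply: cvgP; apply: cvg_trans; last exact: h.
apply: near_eq_cvg; near=> s.
have /andP[s0 s1] : 0 < s < 1 by near: s; exact: near1_itv.
have sj : 0 <= s ^+ j.+1 < 1 by rewrite exprn_ge0 ?exprn_ilt1// ltW.
rewrite powsum1// geom_sum invfM mulrA mulfV ?mul1r//.
by rewrite gt_eqF// subr_gt0.
Unshelve. all: by end_near. Qed.

End Tauberian.

Section TauberianTheorem.
Context {R : realType}.
Implicit Types (s c x : R).

(** The expression is a Riemann sum for the integral of the tent over the points [s ^+ k]; on the
    middle half of its support the tent is at least [(b - a) / 2]. *)
Lemma tent_mean_gt0 (a b : R) : 0 < a -> a < b -> b < 1 ->
  exists2 I : R, 0 < I &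
   (1 - s) * powsum s (fun k => tent a b (s ^+ k) * 1) @[s --> (1 : R)^'-] --> I.
Proof.
move=> a0 ab b1.
have a01 : 0 <= a <= 1 by apply/andP; split; lra.
have b01 : 0 <= b <= 1 by apply/andP; split; lra.
have happ := poly_approx_tent a01 b01.
have := powsum_approx_cvg (w := fun s => 1 - s) (g := fun=> 1) (bounded_seq_cst 1)
  (fun k => ler01) _ powsum_one_cvg happ.
have w0 s : 0 < s < 1 -> 0 <= 1 - s by move=> /andP[_ s1]; rewrite subr_ge0 ltW.
move=> /(_ w0) cv.
set I := lim _ in cv; exists I; last exact: cv.
pose a' := a + (b - a) / 4; pose b' := b - (b - a) / 4.
have ab' : a' < b' by rewrite /a' /b'; lra.
apply: (@lt_le_trans _ _ ((b - a) / 2 * ((b' - a') / 2))).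
  by rewrite mulr_gt0 ?divr_gt0// subr_gt0.
apply: limr_ge => //; near=> s.
have s1 : s < 1 by near: s; exact: nbhs_left_lt.
have s0 : 0 < s by near: s; apply: nbhs_left_gt; exact: ltr01.
have s01 : 0 <= s < 1 by rewrite ltW.
(* The first power of [s] not exceeding [b'] is then above the midpoint of [a'] and [b']. *)
have sb : (a' + b') / 2 / b' < s.
  near: s; apply: nbhs_left_gt; rewrite ltr_pdivrMr; rewrite /b' /a'; lra.
have ex_small e : 0 < e -> exists k, s ^+ k < e.
  move=> e0; have /cvgrPdist_lt /(_ _ e0) [n _ hn] : (fun n : nat => s ^+ n) @ \oo --> (0 : R).
    by apply: cvg_expr; rewrite ger0_norm// ltW.
  by exists n; have := hn n (leqnn n); rewrite sub0r normrN ger0_norm// exprn_ge0// ltW.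
have mono m n : (m <= n)%N -> s ^+ n <= s ^+ m.
  by move=> mn; rewrite ler_wiXn2l// ltW.
have exK1 : exists k, s ^+ k <= b'.
  have [|k hk] := ex_small b'; first by rewrite /b'; lra.
  by exists k; exact: ltW.
have exK2 : exists k, s ^+ k < a' by apply: ex_small; rewrite /a'; lra.
case: (ex_minnP exK1) => K1 hK1 minK1; case: (ex_minnP exK2) => K2 hK2 minK2.
have K12 : (K1 <= K2)%N by apply: minK1; apply: ltW; apply: lt_trans hK2 _.
have sK1 : s * b' <= s ^+ K1.
  case: K1 hK1 minK1 K12 => [|m] hK1 minK1 K12.
    by rewrite expr0 mulr_ile1 ?ltW// /b'; lra.
  rewrite exprS ler_pM2l// leNgt; apply/negP => h.
  by have := minK1 m (ltW h); rewrite ltnn.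
(* The weights [(1 - s) * s ^+ k] are differences of successive powers, so their sum over the
   indices from [K1] to [K2] telescopes. *)
have step m : s ^+ K1 - s ^+ (K1 + m) <= \sum_(k < K1 + m) (1 - s) * s ^+ k * (K1 <= k)%:R.
  elim: m => [|m IH].
    by rewrite addn0 subrr sumr_ge0// => k _; rewrite mulr_ge0// mulr_ge0 ?subr_ge0 ?exprn_ge0 ?(ltW s0) ?(ltW s1).
  rewrite addnS big_ord_recr /= leq_addr mulr1 exprS.
  by move: IH; lra.
have := step (K2 - K1)%N; rewrite subnKC// => hstep.
have bt : bounded_seq (fun k => tent a b (s ^+ k) * 1).
  by apply: bounded_seqM; [exact: bounded_approx_seq|exact: bounded_seq_cst].
apply: le_trans (_ : (1 - s) * \sum_(k < K2) s ^+ k * (tent a b (s ^+ k) * 1) <= _); last first.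
  rewrite ler_wpM2l ?subr_ge0 ?(ltW s1)//; apply: powsum_ge_partial => // k.
  by rewrite mulr1 tent_ge0.
apply: le_trans (_ : (b - a) / 2 * \sum_(k < K2) (1 - s) * s ^+ k * (K1 <= k)%:R <= _); last first.
  rewrite !mulr_sumr; apply: ler_sum => k _; rewrite mulr1.
  have p0 : 0 <= (1 - s) * s ^+ k by rewrite mulr_ge0 ?subr_ge0 ?exprn_ge0// ltW.
  rewrite mulrCA [leRHS]mulrA ler_wpM2l//.
  case: leqP => hk; last by rewrite mulr0 tent_ge0.
  rewrite mulr1; apply: tent_ge; apply/andP; split; last first.
    by apply: le_trans (mono _ _ hk) hK1.
  rewrite leNgt; apply/negP => h; have := minK2 k h.
  by rewrite leqNgt ltn_ord.
rewrite ler_pM2l; last by rewrite divr_gt0// subr_gt0.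
apply: le_trans hstep.
have b'0 : 0 < b' by rewrite /b'; lra.
move: sb; rewrite ltr_pdivrMr// => sb; lra.
Unshelve. all: by end_near. Qed.

Let expn (c : R) (n : nat) := expR (- (c / n%:R)).

Let inv_nat_cvg (c : R) : c / n%:R @[n --> \oo] --> (0 : R).
Proof.
apply/cvgrPdist_le => e e0; near=> n.
have n0 : (0 < n)%N by near: n; exact: nbhs_infty_gt.
have n0' : 0 < (n%:R : R) by rewrite ltr0n.
rewrite sub0r normrN normrM normfV (ger0_norm (ltW n0')) ler_pdivrMr//.
rewrite mulrC -ler_pdivrMr//.
by apply: ltW; near: n; exact: nbhs_infty_gtr.
Unshelve. all: by end_near. Qed.

Let expn_at_left (c : R) : 0 < c -> expn c n @[n --> \oo] --> (1 : R)^'-.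
Proof.
move=> c0; apply: cvg_to_at_left.
  rewrite /expn -[X in _ --> X]expR0 -[X in expR X]oppr0.
  apply: (cvg_comp (fun n : nat => - (c / n%:R)) expR); last exact: continuous_expR.
  by apply: cvgN; exact: inv_nat_cvg.
near=> n; rewrite /expn expR_lt1 oppr_lt0 divr_gt0// ltr0n.
by near: n; exact: nbhs_infty_gt.
Unshelve. all: by end_near. Qed.

Let sqrt_onem_expn (c : R) : 0 < c ->
  Num.sqrt n%:R * Num.sqrt (1 - expn c n) @[n --> \oo] --> Num.sqrt c.
Proof.
move=> c0.
have h : n%:R * (1 - expn c n) @[n --> \oo] --> c.
  have e : \forall n \near \oo, c - c * (c / n%:R) <= n%:R * (1 - expn c n) <= c.
    near=> n.
    have n0 : 0 < (n%:R : R) by rewrite ltr0n; near: n; exact: nbhs_infty_gt.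
    have cn : 0 <= c / n%:R by rewrite divr_ge0// ltW.
    have h1 := onem_expRN_ge cn; have h2 := expR_ge1Dx (- (c / n%:R)).
    have nc : n%:R * (c / n%:R) = c by rewrite mulrC divfK// gt_eqF.
    apply/andP; split.
      have := ler_wpM2l (ltW n0) h1; by rewrite [leLHS]mulrBr expr2 [X in _ - X]mulrA nc.
    apply: le_trans (_ : n%:R * (c / n%:R) <= _); last by rewrite nc.
    by rewrite ler_pM2l// /expn; lra.
  apply: (squeeze_cvgr e); last exact: cvg_cst.
  rewrite -[X in _ --> X]subr0 -[X in _ - X](mulr0 c).
  apply: cvgB; first exact: cvg_cst.
  by apply: cvgM; [exact: cvg_cst|exact: inv_nat_cvg].
apply: cvg_trans; last first.
  apply: (cvg_comp (fun n : nat => n%:R * (1 - expn c n)) Num.sqrt); first exact: h.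
  exact: sqrt_continuous.
apply: near_eq_cvg; near=> n; rewrite /= sqrtrM//.
Unshelve. all: by end_near. Qed.

Variable p : nat -> R.
Hypothesis p01 : forall k, 0 <= p k <= 1.
Hypothesis p_noninc : forall k, p k.+1 <= p k.
Variable c : R.
Hypothesis c0 : 0 < c.
Hypothesis hc : Num.sqrt (1 - s) * powsum s p @[s --> (1 : R)^'-] --> c.

Let p_bnd : bounded_seq p.
Proof. by exists 1 => k; have /andP[h0 h1] := p01 k; rewrite ger0_norm. Qed.

Let p_mono m n : (m <= n)%N -> p n <= p m.
Proof. by move=> mn; have /nonincreasing_seqP := p_noninc; move/(_ _ _ mn). Qed.

(* the tent is supported in [e^-beta, e^-1]: weighing [p k] by its value at
   [s ^ k] with [s = e^(- e / n)] for [e = 1], respectively [e = beta], involves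
   only indices [k] after, respectively before, [n] *)
Lemma tauberian_window (beta : R) : 1 < beta -> exists (l : R) (lo up : nat -> R),
  [/\ lo n @[n --> \oo] --> l, up n @[n --> \oo] --> Num.sqrt beta * l &
      \forall n \near \oo, lo n <= Num.sqrt n%:R * p n <= up n].
Proof.
move=> beta1.
pose a : R := expR (- beta); pose b : R := expR (- 1).
have a0 : 0 < a by exact: expR_gt0.
have ab : a < b by rewrite ltr_expR ltrN2.
have b1 : b < 1 by rewrite expR_lt1 oppr_lt0.
have a01 : 0 <= a <= 1 by apply/andP; split; lra.
have b01 : 0 <= b <= 1 by apply/andP; split; lra.
have happ := poly_approx_tent a01 b01.
have [I I0 hI] := tent_mean_gt0 a0 ab b1.
(* [sqrt (1 - s) * (M s / N s)] is a weighted mean of the [p k], with weights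
   [s ^+ k * tent a b (s ^+ k)]. *)
pose M s := Num.sqrt (1 - s) * powsum s (fun k => tent a b (s ^+ k) * p k).
pose N s := (1 - s) * powsum s (fun k => tent a b (s ^+ k) * 1).
have /cvg_ex[L hL] : cvg (M s @[s --> (1 : R)^'-]).
  apply: powsum_approx_cvg => //; first by move=> k; case/andP: (p01 k).
  by apply: powsum_sqrt_cvg; exact: hc.
pose l := L / I.
have hMN : M s / N s @[s --> (1 : R)^'-] --> l.
  by apply: cvgM => //; apply: cvgV => //; rewrite gt_eqF.
have N0 : \forall s \near (1 : R)^'-, 0 < N s by exact: (cvgr_gt _ hI).
have beta0 : 0 < beta by lra.
have Nn e : 0 < e -> \forall n \near \oo, 0 < N (expn e n).
  by move=> e0; have := @expn_at_left e e0 [set s | 0 < N s] N0.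
exists l, (fun n => Num.sqrt n%:R * Num.sqrt (1 - expn 1 n) * (M (expn 1 n) / N (expn 1 n))),
  (fun n => Num.sqrt n%:R * Num.sqrt (1 - expn beta n) * (M (expn beta n) / N (expn beta n))).
have lim_of e : 0 < e ->
  Num.sqrt n%:R * Num.sqrt (1 - expn e n) * (M (expn e n) / N (expn e n)) @[n --> \oo]
    --> Num.sqrt e * l.
  move=> e0; apply: cvgM; first exact: sqrt_onem_expn.
  exact: (cvg_comp (expn e) (fun s => M s / N s) (expn_at_left e0) hMN).
split; [|exact: lim_of|].
  by have := lim_of 1 ltr01; rewrite sqrtr1 mul1r.
near=> n.
have n0 : (0 < n)%N by near: n; exact: nbhs_infty_gt.
have n0' : 0 < (n%:R : R) by rewrite ltr0n.
(* Only indices strictly between [n / e] and [beta * n / e] carry weight: all after [n] for [e = 1],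
   all before [n] for [e = beta]. *)
have tent0 e k : tent a b (expn e n ^+ k) != 0 -> n%:R < e * k%:R < beta * n%:R.
  have -> : expn e n ^+ k = expR (- (e * k%:R / n%:R)).
    by rewrite /expn -expRM_natr; congr expR; rewrite mulNr mulrAC.
  move=> h; apply/andP; split.
    rewrite ltNge; apply/negP => hk; move/negP: h; apply; apply/eqP.
    apply: tent_eq0; first exact: ltW.
    by right; rewrite /b ler_expR lerN2 ler_pdivrMr// mul1r.
  rewrite ltNge; apply/negP => hk; move/negP: h; apply; apply/eqP.
  apply: tent_eq0; first exact: ltW.
  by left; rewrite /a ler_expR lerN2 ler_pdivlMr.
have ratio e : 0 < e -> 0 < N (expn e n) ->
    [/\ (forall k, tent a b (expn e n ^+ k) != 0 -> p k <= p n) ->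
        Num.sqrt n%:R * Num.sqrt (1 - expn e n) * (M (expn e n) / N (expn e n)) <=
        Num.sqrt n%:R * p n
      & (forall k, tent a b (expn e n ^+ k) != 0 -> p n <= p k) ->
        Num.sqrt n%:R * p n <=
        Num.sqrt n%:R * Num.sqrt (1 - expn e n) * (M (expn e n) / N (expn e n))].
  move=> e0 Npos; set s := expn e n in Npos *.
  have s0 : 0 < s by exact: expR_gt0.
  have s1 : s < 1 by rewrite expR_lt1 oppr_lt0 divr_gt0.
  have s01 : 0 <= s < 1 by rewrite ltW.
  have q0 : 0 < Num.sqrt (1 - s) by rewrite sqrtr_gt0 subr_gt0.
  have bt := bounded_approx_seq happ s01.
  have btp := bounded_seqM bt p_bnd.
  have btn : bounded_seq (fun k => p n * (tent a b (s ^+ k) * 1)).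
    by apply: bounded_seqM; [exact: bounded_seq_cst|apply: bounded_seqM => //; exact: bounded_seq_cst].
  have bt1 : bounded_seq (fun k => tent a b (s ^+ k) * 1).
    by apply: bounded_seqM => //; exact: bounded_seq_cst.
  have e1 : Num.sqrt (1 - s) * (p n / Num.sqrt (1 - s)) = p n.
    by rewrite mulrC divfK// gt_eqF.
  have NE : p n / Num.sqrt (1 - s) * N s =
      Num.sqrt (1 - s) * powsum s (fun k => p n * (tent a b (s ^+ k) * 1)).
    rewrite powsumZ// /N -{2}[1 - s]sqr_sqrtr ?subr_ge0 ?(ltW s1)//.
    by field; rewrite gt_eqF.
  split => hk.
    rewrite -mulrA ler_wpM2l ?sqrtr_ge0// -[leRHS]e1 ler_pM2l// ler_pdivrMr// NE.
    rewrite ler_pM2l//; apply: le_powsum => // k; rewrite mulr1 mulrC.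
    have [->|t0] := eqVneq (tent a b (s ^+ k)) 0; first by rewrite !mulr0.
    by rewrite ler_wpM2r ?tent_ge0// hk.
  rewrite -mulrA ler_wpM2l ?sqrtr_ge0// -[leLHS]e1 ler_pM2l// ler_pdivlMr// NE.
  rewrite ler_pM2l//; apply: le_powsum => // k; rewrite mulr1 [leRHS]mulrC.
  have [->|t0] := eqVneq (tent a b (s ^+ k)) 0; first by rewrite !mulr0.
  by rewrite ler_wpM2r ?tent_ge0// hk.
apply/andP; split.
  have [|h _] := ratio 1 ltr01; first by near: n; exact: (Nn 1 ltr01).
  apply: h => k /tent0 /andP[h _]; apply: p_mono.
  by rewrite mul1r ltr_nat in h; exact: ltnW.
have [|_ h] := ratio beta beta0; first by near: n; exact: (Nn beta beta0).
apply: h => k /tent0 /andP[_ h]; apply: p_mono.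
by rewrite ltr_pM2l// ltr_nat in h; exact: ltnW.
Unshelve. all: by end_near. Qed.

End TauberianTheorem.

(** * Existence and positivity of the limit *)

Section MonotoneTauberian.
Context {R : realType} (p : nat -> R) (c : R).
Hypothesis p01 : forall k, 0 <= p k <= 1.
Hypothesis p_noninc : forall k, p k.+1 <= p k.
Hypothesis c0 : 0 < c.
Hypothesis hc : Num.sqrt (1 - s) * powsum s p @[s --> (1 : R)^'-] --> c.

Lemma tauberian_cvg : cvg (Num.sqrt n%:R * p n @[n --> \oo]).
Proof.
have win := tauberian_window p01 p_noninc hc.
(* The number [l] given by a window depends on [beta]; a first window, with [beta = 2], supplies a
   bound [M] fixed before the second one is chosen. *)
have [l2 [lo2 [up2 [hlo2 hup2 h2]]]] := win 2 ltac:(by rewrite ltr1n).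
pose M := Num.sqrt 2 * l2 + 1.
have hM : \forall n \near \oo, Num.sqrt n%:R * p n <= M.
  have lM : Num.sqrt 2 * l2 < M by rewrite ltrDl.
  have h := cvgr_lt (Num.sqrt 2 * l2) hup2 M lM.
  near=> n; have /andP[_ h4] : lo2 n <= Num.sqrt n%:R * p n <= up2 n by near: n.
  by apply: le_trans h4 _; apply: ltW; near: n; exact: h.
have M0 : 0 <= M.
  have [n hn] := filter_ex hM; apply: le_trans hn.
  by rewrite mulr_ge0 ?sqrtr_ge0//; case/andP: (p01 n).
apply: cvg_of_approx => e e0.
(* As [sqrt (1 + d) - 1 <= d] and [l <= M + e], the width [(sqrt (1 + d) - 1) * l] of the window is
   at most [e / 4]. *)
pose d := Num.min 1 (e / (4 * (M + e + 1))).
have d0 : 0 < d by rewrite lt_min ltr01 divr_gt0// mulr_gt0//; lra.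
have hd : d * (M + e + 1) <= e / 4.
  have : d * (4 * (M + e + 1)) <= e.
    by rewrite -ler_pdivlMr ?ge_min ?lexx ?orbT// mulr_gt0//; lra.
  lra.
have d1 : 1 < 1 + d by rewrite ltrDl.
have [l [lo [up [hlo hup h]]]] := win (1 + d) d1.
have sd : 1 <= Num.sqrt (1 + d) <= 1 + d.
  have s1 : 1 <= Num.sqrt (1 + d) by rewrite -[leLHS]sqrtr1 ler_wsqrtr// ltW.
  rewrite s1 /=; have := sqr_sqrtr (ltW (lt_trans ltr01 d1)).
  by rewrite expr2 => {2}<-; rewrite ler_peMl// (le_trans ler01).
have e4 : 0 < e / 4 by rewrite divr_gt0.
have klo : \forall n \near \oo, l - e / 4 < lo n by apply: (cvgr_gt l hlo); lra.
have kup : \forall n \near \oo, up n < Num.sqrt (1 + d) * l + e / 4.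
  by apply: (cvgr_lt _ hup); lra.
have lM : l <= M + e.
  have : \forall n \near \oo, l <= M + e.
    near=> n.
    have /andP[h3 _] : lo n <= Num.sqrt n%:R * p n <= up n by near: n.
    have h4 : Num.sqrt n%:R * p n <= M by near: n.
    have h5 : l - e / 4 < lo n by near: n.
    lra.
  by move=> /filter_ex [].
have le : (Num.sqrt (1 + d) - 1) * l <= e / 4.
  have /andP[s1 s2] := sd.
  apply: le_trans (_ : (Num.sqrt (1 + d) - 1) * (M + e + 1) <= _).
    by rewrite ler_wpM2l ?subr_ge0//; lra.
  by apply: le_trans hd; rewrite ler_wpM2r//; lra.
exists l; near=> n.
have /andP[h3 h4] : lo n <= Num.sqrt n%:R * p n <= up n by near: n.
have h5 : l - e / 4 < lo n by near: n.
have h6 : up n < Num.sqrt (1 + d) * l + e / 4 by near: n.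
rewrite ler_norml; apply/andP; split; lra.
Unshelve. all: by end_near. Qed.

(** Two values of [s] are compared: the nearer one to 1 makes the power series exceed a bound for
    the sum of the first [n] terms, so the tail, controlled by [p n], has to supply the
    difference. *)
Lemma tauberian_lower : exists2 b : R, 0 < b & \forall n \near \oo, b <= Num.sqrt n%:R * p n.
Proof.
have c0' := c0.
have p_bnd : bounded_seq p.
  by exists 1 => k; have /andP[h0 h1] := p01 k; rewrite ger0_norm.
have p_mono m n : (m <= n)%N -> p n <= p m.
  by move=> mn; have /nonincreasing_seqP := p_noninc; move/(_ _ _ mn).
have [del del0 hdel] : exists2 del : R, 0 < del & forall s : R, 0 <= s < 1 -> 1 - s < del ->
    c / 2 <= Num.sqrt (1 - s) * powsum s p <= 2 * c.
  have : \forall s \near (1 : R)^'-, c / 2 <= Num.sqrt (1 - s) * powsum s p <= 2 * c.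
    near=> s; apply/andP; split; apply: ltW; near: s.
      by apply: (cvgr_gt c hc); lra.
    by apply: (cvgr_lt c hc); lra.
  rewrite nbhs_left0P => -[del /= del0 h]; exists del => // s /andP[s0 s1] sd.
  have -> : s = 1 - (1 - s) by ring.
  apply: (h (1 - s)) => /=; rewrite ?subr_gt0//.
  by rewrite sub0r normrN gtr0_norm ?subr_gt0.
exists (c / 200); first by rewrite divr_gt0.
near=> n.
have n1 : (0 < n)%N by near: n; exact: nbhs_infty_gt.
have n0 : 0 < (n%:R : R) by rewrite ltr0n.
have n1' : 1 <= (n%:R : R) by rewrite ler1n.
have nd : 1 / n%:R < del.
  rewrite ltr_pdivrMr// mulrC -ltr_pdivrMr//; near: n; exact: nbhs_infty_gtr.
pose t := Num.sqrt (n%:R : R).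
have t0 : 0 < t by rewrite sqrtr_gt0.
have tt : t ^+ 2 = n%:R by rewrite sqr_sqrtr// ltW.
have in0 : 0 < (n%:R^-1 : R) by rewrite invr_gt0.
have in1 : (n%:R^-1 : R) <= 1 by rewrite invf_le1.
rewrite div1r in nd.
have sum_le : \sum_(k < n) p k <= 8 * c * t.
  (* Here [s ^+ n >= 3 / 4] and the series is at most [4 * c * t], whence the bound [8 * c * t] on
     the partial sum. *)
  pose s := 1 - 4^-1 * n%:R^-1 : R.
  have s01 : 0 <= s < 1 by rewrite /s; apply/andP; split; lra.
  have s01' : 0 <= s <= 1 by case/andP: s01 => -> /ltW ->.
  have oms : 1 - s = (2^-1 / t) ^+ 2.
    by rewrite /s -tt; field; rewrite gt_eqF.
  have sn : 3 / 4 <= s ^+ n.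
    have := onem_expr_le n s01'.
    have -> : n%:R * (1 - s) = 1 / 4 by rewrite /s; field; rewrite gt_eqF.
    lra.
  have sd : 1 - s < del by rewrite /s; lra.
  have /andP[_] := hdel s s01 sd.
  rewrite oms sqrtr_sqr ger0_norm; last by rewrite divr_ge0// ltW.
  have : \sum_(k < n) p k * (3 / 4) <= powsum s p.
    apply: le_trans (powsum_ge_partial n s01 p_bnd (fun k => proj1 (andP (p01 k)))).
    apply: ler_sum => k _; rewrite mulrC ler_wpM2r//; first by case/andP: (p01 k).
    by apply: le_trans sn _; rewrite ler_wiXn2l//; [case/andP: s01'|case/andP: s01'|exact: ltnW].
  rewrite -mulr_suml => h1 h2.
  have h3 : powsum s p <= 4 * c * t.
    have := ler_wpM2r (ltW t0) h2.
    have -> : 2^-1 / t * powsum s p * t = powsum s p / 2 by field; rewrite gt_eqF.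
    lra.
  have : 0 <= c * t by rewrite mulr_ge0// ltW.
  lra.
(* Now the series is at least [10 * c * t], which exceeds [8 * c * t], and the tail is at most
   [400 * t ^+ 2 * p n]: this yields [c / 200]. *)
pose s := 1 - 400^-1 * n%:R^-1 : R.
have s01 : 0 <= s < 1 by rewrite /s; apply/andP; split; lra.
have oms : 1 - s = (20^-1 / t) ^+ 2.
  by rewrite /s -tt; field; rewrite gt_eqF.
have sd : 1 - s < del by rewrite /s; lra.
have /andP[+ _] := hdel s s01 sd.
rewrite oms sqrtr_sqr ger0_norm; last by rewrite divr_ge0// ltW.
move=> hlow.
have hup : powsum s p <= 8 * c * t + p n * (1 - s)^-1.
  apply: limr_le; first exact: powsum_cvg.
  near=> m.
  apply: le_trans (_ : \sum_(k < m) (p k * (k < n)%:R + s ^+ k * p n) <= _).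
    apply: ler_sum => k _; have /andP[s0 s1] := s01.
    have /andP[pk0 _] := p01 k; have /andP[pn0 _] := p01 n.
    have sk : 0 <= s ^+ k <= 1 by apply: onem_expr_ge0; rewrite s0 ltW.
    have /andP[sk0 sk1] := sk.
    have [kn|nk] := ltnP k n.
      rewrite mulr1 -[leLHS]addr0 lerD ?mulr_ge0// ler_piMl//.
    by rewrite mulr0 add0r ler_wpM2l// p_mono.
  rewrite big_split /= -[X in _ + X <= _]mulr_suml; apply: lerD.
    apply: le_trans sum_le.
    have nm : (n <= m)%N by near: m; exact: nbhs_infty_ge.
    rewrite (big_ord_widen _ (fun k => p k) nm) [leRHS]big_mkcond /=.
    by apply: ler_sum => k _; case: ifP => _; rewrite ?mulr1// mulr0.
  rewrite [leLHS]mulrC; apply: ler_wpM2l; first by case/andP: (p01 n).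
  exact: sum_geom_le.
have h1 := ler_wpM2l (_ : 0 <= 20^-1 / t) hup.
have {}h1 := h1 ltac:(by rewrite divr_ge0// ltW).
rewrite oms in h1.
have e1 : 20^-1 / t * (8 * c * t + p n * ((20^-1 / t) ^+ 2)^-1) = 2 / 5 * c + 20 * (t * p n).
  by field; rewrite gt_eqF.
rewrite e1 in h1; rewrite -/t; lra.
Unshelve. all: by end_near. Qed.

Theorem monotone_tauberian : exists2 l : R, 0 < l & Num.sqrt n%:R * p n @[n --> \oo] --> l.
Proof.
have [b b0 hb] := tauberian_lower; have cv := tauberian_cvg.
exists (lim (Num.sqrt n%:R * p n @[n --> \oo])); last exact: cv.
by apply: lt_le_trans b0 _; apply: limr_ge.
Qed.

End MonotoneTauberian.

(** * From the process to path expectations *)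

Lemma iota1S n : iota 1 n.+1 = rcons (iota 1 n) n.+1.
Proof. by rewrite -[n.+1 in LHS]addn1 iotaD add1n cats1. Qed.

Section MarkovPaths.
Context {R : realType} {d : measure_display} {T : measurableType d} {E : finType}.
Context (mu : probability T R) (P : E -> E -> R) (i : E) (X : nat -> T -> E).
Hypothesis hX : markov_chain mu P i X.

Let mX n x : measurable (X n @^-1` [set x]). Proof. by case: hX. Qed.

Lemma path_eventS n x : path_event X n.+1 x = path_event X n x `&` (X n.+1 @^-1` [set x n.+1]).
Proof.
apply/seteqP; split => w /=.
  by move=> h; split => [k kn|]; apply: h => //; exact: leqW.
by move=> [h1 h2] k; rewrite leq_eqVlt => /predU1P[->//|]; rewrite ltnS; exact: h1.
Qed.

Lemma path_event0 x : path_event X 0 x = X 0%N @^-1` [set x 0%N].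
Proof.
apply/seteqP; split => w /=; first exact.
by move=> h k; rewrite leqn0 => /eqP ->.
Qed.

Lemma measurable_path_event n x : measurable (path_event X n x).
Proof.
elim: n => [|n IH]; first by rewrite path_event0.
by rewrite path_eventS; exact: measurableI.
Qed.

Lemma eq_path_event n x y : (forall k, (k <= n)%N -> x k = y k) ->
  path_event X n x = path_event X n y.
Proof.
by move=> h; apply/seteqP; split => w hw k kn; rewrite hw// h.
Qed.

Local Open Scope ereal_scope.

Lemma ge0_integral_finite (D : set T) (Y : T -> E) (g : T -> \bar R) :
  measurable D -> (forall e, measurable (Y @^-1` [set e])) ->
  measurable_fun D g -> (forall w, D w -> 0 <= g w) ->
  \int[mu]_(w in D) g w = \sum_(e : E) \int[mu]_(w in D `&` (Y @^-1` [set e])) g w.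
Proof.
move=> mD mY mg g0.
have mF e : measurable (D `&` (Y @^-1` [set e])) by exact: measurableI.
have DE : D = \big[setU/set0]_(e : E) (D `&` (Y @^-1` [set e])).
  rewrite -bigcup_seq; apply/seteqP; split => w.
    by move=> Dw; exists (Y w) => //=; rewrite mem_index_enum.
  by move=> [e _ []].
rewrite {1}DE ge0_integral_bigsetU//.
- exact: index_enum_uniq.
- by move=> e e' _ _ [w [[_ <-] [_ <-]]].
- by rewrite -DE.
- by rewrite -DE.
Qed.

(** [g] may depend on more than the chain: only its integral over each cylinder is prescribed. The
    cylinders are merged by summing over the last state, the Markov property supplying the
    weights. *)
Lemma integral_paths (n : nat) (g : T -> \bar R) (Psi : seq E -> R) :
  stochastic P -> measurable_fun setT g -> (forall w, 0 <= g w) ->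
  (forall x, \int[mu]_(w in path_event X n x) g w =
     mu (path_event X n x) * (Psi [seq x k | k <- iota 1 n])%:E) ->
  \int[mu]_w g w = (pathE P n Psi i)%:E.
Proof.
move=> hP mg g0 hg.
have main m k x : (k + m = n)%N -> \int[mu]_(w in path_event X k x) g w =
    mu (path_event X k x) *
    (pathE P m (fun s => Psi ([seq x l | l <- iota 1 k] ++ s)) (x k))%:E.
  elim: m k x => [|m IH] k x km /=.
    by rewrite cats0; rewrite addn0 in km; rewrite km.
  (* The path [x] with its state at time [k.+1] replaced by [j]. *)
  pose y j l := if l == k.+1 then j else x l.
  have yk j l : (l <= k)%N -> y j l = x l.
    by move=> lk; rewrite /y; case: eqP => // e; rewrite e ltnn in lk.
  have ykS j : y j k.+1 = j by rewrite /y eqxx.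
  have mpe := measurable_path_event k x.
  have fin : mu (path_event X k x) \is a fin_num by rewrite fin_num_measure.
  rewrite (@ge0_integral_finite _ (X k.+1))//; last exact: measurable_funTS.
  rewrite -[mu (path_event X k x)]fineK// -EFinM mulr_sumr -sumEFin.
  apply: eq_bigr => j _.
  have -> : path_event X k x `&` (X k.+1 @^-1` [set j]) = path_event X k.+1 (y j).
    rewrite path_eventS ykS; congr (_ `&` _).
    by apply: eq_path_event => l lk; rewrite yk.
  rewrite (IH k.+1 (y j)); last by rewrite addSnnS.
  have -> : mu (path_event X k.+1 (y j)) = mu (path_event X k x) * (P (x k) j)%:E.
    case: hX => _ _ ->; rewrite ykS yk//; congr (mu _ * _).
    by apply: eq_path_event => l lk; rewrite yk.
  rewrite -[mu (path_event X k x)]fineK// -!EFinM ykS mulrA; congr (_ * _)%:E.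
  apply: eq_pathE => s; congr Psi.
  rewrite iota1S map_rcons ykS cat_rcons; congr (_ ++ _).
  by apply/eq_in_map => l; rewrite mem_iota add1n ltnS => /andP[_ lk]; rewrite yk.
have := main n 0%N (fun=> i) (add0n n); rewrite path_event0 /=.
case: hX => _ -> _; rewrite mul1e => <-.
have mA := mX 0 i.
(* The chain starts from [i] with probability 1, so the complement does not contribute. *)
rewrite -(setvU (X 0%N @^-1` [set i])) ge0_integral_setU//.
- rewrite null_set_integral ?add0e//; first exact: measurableC.
    exact: measurable_funTS.
  have := probability_setC mu mA; case: hX => _ h _.
  by rewrite h subee.
- exact: measurableC.
- exact: measurable_funTS.
- by rewrite disj_set2E setICl.
Qed.

End MarkovPaths.

(** * The drift of the walk vanishes *)

Section FiniteValued.
Context {R : realType} {d : measure_display} {T : measurableType d} {E : finType}.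

Lemma measurable_fun_finite {d'} {U : measurableType d'} (Y : T -> E) (phi : E -> U) :
  (forall e, measurable (Y @^-1` [set e])) -> measurable_fun setT (fun w => phi (Y w)).
Proof.
move=> mY _ B mB; rewrite setTI.
have -> : (fun w => phi (Y w)) @^-1` B = \bigcup_(e in [set e | B (phi e)]) (Y @^-1` [set e]).
  apply/seteqP; split => w /=; first by move=> Bw; exists (Y w).
  by move=> [e Be] ->.
by apply: fin_bigcup_measurable => //; exact: finite_finset.
Qed.

End FiniteValued.

Section MomentGrowth.
Context {R : realType} {E : finType} (P : E -> E -> R) (r : E -> R).
Hypotheses (hP : stochastic P) (hirr : irreducible P).

Definition expmoment (l : R) n i := pathE P n (fun s => expR (l * \sum_(x <- s) r x)) i.

Lemma expmomentS l n i :
  expmoment l n.+1 i = \sum_j P i j * (expR (l * r j) * expmoment l n j).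
Proof.
apply: eq_bigr => j _; congr (_ * _); rewrite -pathEZ; apply: eq_pathE => s.
by rewrite big_cons mulrDr expRD.
Qed.

Lemma expmoment0 l i : expmoment l 0 i = 1.
Proof. by rewrite /expmoment /= big_nil mulr0 expR0. Qed.

Lemma expmoment_gt0 l n i : 0 < expmoment l n i.
Proof.
elim: n i => [|n IH] i; first by rewrite expmoment0.
have [c /andP[c0 c1] hc] := finite_pos_bounded (fun j => mulr_gt0 (expR_gt0 (l * r j)) (IH j)).
by rewrite expmomentS; apply: lt_le_trans c0 _; exact: avg_ge.
Qed.

Lemma expmomentD_le l n m i M : (forall j, expmoment l m j <= M) ->
  expmoment l (n + m) i <= expmoment l n i * M.
Proof.
move=> hM; elim: n i => [|n IH] i; first by rewrite add0n expmoment0 mul1r.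
rewrite addSn !expmomentS mulr_suml; apply: ler_sum => j _.
by rewrite -!mulrA ler_wpM2l ?(proj1 hP)// ler_wpM2l// expR_ge0.
Qed.

Lemma expmomentD_ge l n m i M : (forall j, M <= expmoment l m j) ->
  expmoment l n i * M <= expmoment l (n + m) i.
Proof.
move=> hM; elim: n i => [|n IH] i; first by rewrite add0n expmoment0 mul1r.
rewrite addSn !expmomentS mulr_suml; apply: ler_sum => j _.
by rewrite -!mulrA ler_wpM2l ?(proj1 hP)// ler_wpM2l// expR_ge0.
Qed.

Lemma expmoment_nstep l (kap : R) n m i j : 0 <= kap -> (forall k, kap <= expR (l * r k)) ->
  kap ^+ m * nstep P m i j * expmoment l n j <= expmoment l (m + n) i.
Proof.
move=> k0 hk; elim: m i => [|m IH] i.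
  rewrite expr0 mul1r add0n /=; case: eqP => [->|_]; first by rewrite mul1r.
  by rewrite mul0r ltW// expmoment_gt0.
rewrite addSn expmomentS /= mulr_sumr mulr_suml; apply: ler_sum => k _.
apply: le_trans (_ : P i k * (kap * (kap ^+ m * nstep P m k j * expmoment l n j)) <= _).
  by rewrite exprS le_eqVlt; apply/orP; left; apply/eqP; ring.
rewrite ler_wpM2l ?(proj1 hP)//; apply: ler_pM => //.
by rewrite !mulr_ge0 ?exprn_ge0 ?(nstep_ge0 hP)// ltW// expmoment_gt0.
Qed.

(** Going from [i] to [j] in [m] steps costs a factor independent of [n], and [m] further steps
    multiply the moment by at most a constant. *)
Lemma expmoment_comparable l : exists2 c : R, 1 <= c &
  forall n i j, expmoment l n j <= c * expmoment l n i.
Proof.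
have [kap /andP[k0 k1] hk] := finite_pos_bounded (fun j => expR_gt0 (l * r j)).
have h (ij : E * E) : exists c : R, forall n, expmoment l n ij.2 <= c * expmoment l n ij.1.
  case: ij => i j /=; have [m hm] := hirr i j.
  have [M M1 hM] := finite_bounded (expmoment l m).
  have p0 : 0 < kap ^+ m * nstep P m i j by rewrite mulr_gt0 ?exprn_gt0.
  exists (M / (kap ^+ m * nstep P m i j)) => n.
  rewrite mulrAC ler_pdivlMr// mulrC.
  apply: (le_trans (expmoment_nstep n m i j (ltW k0) hk)).
  rewrite addnC [leRHS]mulrC; apply: expmomentD_le => k.
  exact: le_trans (ler_norm _) (hM k).
have [c hc] := choice h; have [C C1 hC] := finite_bounded c.
exists C => // n i j; apply: le_trans (hc (i, j) n) _.
by rewrite ler_wpM2r//; [exact/ltW/expmoment_gt0|exact: le_trans (ler_norm _) (hC (i, j))].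
Qed.

(** Replacing the intermediate state by [i] changes the moment by a bounded factor, which becomes a
    bounded error for the logarithm. *)
Lemma ln_expmoment_quasiadditive l : exists2 D : R, 0 <= D & forall n m i,
  `|ln (expmoment l (n + m) i) - ln (expmoment l n i) - ln (expmoment l m i)| <= D.
Proof.
have [c c1 hc] := expmoment_comparable l.
have c0 : 0 < c by apply: lt_le_trans c1.
have ci0 : 0 < c^-1 by rewrite invr_gt0.
exists (ln c); first exact: ln_ge0.
move=> n m i.
have a0 := expmoment_gt0 l n i; have b0 := expmoment_gt0 l m i.
have up := expmomentD_le n i (fun j => hc m i j).
have lo : expmoment l n i * (expmoment l m i / c) <= expmoment l (n + m) i.
  by apply: expmomentD_ge => j; rewrite ler_pdivrMr// mulrC.
rewrite -ler_ln ?posrE ?expmoment_gt0 ?mulr_gt0// in up.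
rewrite -ler_ln ?posrE ?expmoment_gt0 ?mulr_gt0 ?divr_gt0 ?expmoment_gt0// in lo.
rewrite !lnM ?posrE ?mulr_gt0// in up.
rewrite lnM ?ln_div ?posrE ?divr_gt0// in lo.
by rewrite ler_norml; apply/andP; split; lra.
Qed.

(** Evaluating the sequence at the product [m * n], as [n] blocks of length [m] and as [m] blocks of
    length [n], shows that the quotients form a Cauchy sequence. *)
Lemma ln_expmoment_cvg l i : cvg (ln (expmoment l n i) / n%:R @[n --> \oo]).
Proof.
have [D D0 hD] := ln_expmoment_quasiadditive l.
pose L n := ln (expmoment l n i).
have hk k m : `|L (k * m)%N - k%:R * L m| <= k%:R * D.
  elim: k => [|k IH].
    by rewrite mul0n /L expmoment0 ln1 !mul0r subr0 normr0.
  rewrite mulSn -natr1 !mulrDl !mul1r.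
  have -> : L (m + k * m)%N - (k%:R * L m + L m) =
     (L (m + k * m)%N - L m - L (k * m)%N) + (L (k * m)%N - k%:R * L m) by ring.
  by apply: le_trans (ler_normD _ _) _; rewrite addrC lerD// hD.
have hmn m n : (0 < m)%N -> (0 < n)%N -> `|L m / m%:R - L n / n%:R| <= D / m%:R + D / n%:R.
  move=> m0 n0; have m0' : 0 < (m%:R : R) by rewrite ltr0n.
  have n0' : 0 < (n%:R : R) by rewrite ltr0n.
  have mn0 : 0 < (m%:R * n%:R : R) by rewrite mulr_gt0.
  have -> : L m / m%:R - L n / n%:R = (n%:R * L m - m%:R * L n) / (m%:R * n%:R).
    by field; rewrite !gt_eqF.
  have -> : D / m%:R + D / n%:R = (n%:R * D + m%:R * D) / (m%:R * n%:R).
    by field; rewrite !gt_eqF.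
  rewrite normrM normfV (gtr0_norm mn0) ler_pM2r ?invr_gt0//.
  have -> : n%:R * L m - m%:R * L n =
    - (L (n * m)%N - n%:R * L m) + (L (m * n)%N - m%:R * L n) by rewrite mulnC; ring.
  by apply: le_trans (ler_normD _ _) _; rewrite normrN lerD.
apply: cvg_of_approx => e e0.
have [N [N0 hN]] : exists N, (0 < N)%N /\ D / N%:R <= e / 2.
  exists (Num.trunc (D / (e / 2))).+1; split => //.
  rewrite ler_pdivrMr// mulrC -ler_pdivrMr ?divr_gt0//; apply: ltW.
  exact: truncnS_gt.
exists (L N / N%:R); near=> n.
have Nn : (N <= n)%N by near: n; exact: nbhs_infty_ge.
have n0 : (0 < n)%N by apply: leq_trans N0 Nn.
apply: le_trans (hmn N n N0 n0) _.
rewrite [leRHS]splitr lerD//; apply: le_trans hN.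
by rewrite ler_wpM2l// lef_pV2 ?posrE ?ltr0n// ler_nat.
Unshelve. all: by end_near. Qed.

Variable nu : E -> R.
Hypothesis hnu : invariant_probability P nu.

(** With [h] solving the Poisson equation for the centred drift, the difference is the mean of [h]
    at time [n] minus its initial value. *)
Lemma path_mean : exists2 H : R, 0 <= H & forall n i,
  `|pathE P n (fun s => \sum_(x <- s) r x) i - n%:R * \sum_i nu i * r i| <= H.
Proof.
set c := \sum_i nu i * r i.
have [h hh] : exists h, forall i, \sum_j P i j * h j - h i = \sum_j P i j * r j - c.
  apply: (poisson_equation hP hirr hnu).
  under eq_bigr do rewrite mulrBr.
  rewrite sumrB (nu_avg hnu r) -mulr_suml.
  by case: hnu => _ -> _; rewrite mul1r subrr.
have [H H1 hH] := finite_bounded h.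
exists (2 * H); first by lra.
move=> n i.
have -> : pathE P n (fun s => \sum_(x <- s) r x) i =
    n%:R * c + \sum_j nstep P n i j * h j - h i.
  elim: n i => [|n IH] i.
    rewrite /= big_nil mul0r add0r -(nstep_pathE P 0 h i) /=.
    by rewrite subrr.
  have -> : pathE P n.+1 (fun s => \sum_(x <- s) r x) i =
      \sum_j P i j * (r j + pathE P n (fun s => \sum_(x <- s) r x) j).
    apply: eq_bigr => j _; congr (_ * _).
    rewrite -[r j](pathE_cst hP n _ j) -pathED; apply: eq_pathE => s.
    by rewrite big_cons.
  under eq_bigr do rewrite IH.
  have -> : \sum_j P i j * (r j + (n%:R * c + \sum_k nstep P n j k * h k - h j)) =
      \sum_j P i j * r j + (\sum_j P i j) * (n%:R * c)
      + \sum_j P i j * (\sum_k nstep P n j k * h k) - \sum_j P i j * h j.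
    by rewrite mulr_suml -!big_split /= -sumrB; apply: eq_bigr => j _; ring.
  have -> : \sum_j P i j * (\sum_k nstep P n j k * h k) =
      \sum_j nstep P n.+1 i j * h j.
    rewrite -nstep_pathE /=; apply: eq_bigr => j _.
    by rewrite -nstep_pathE.
  rewrite (proj2 hP) mul1r -natr1; have := hh i; lra.
have -> : n%:R * c + \sum_j nstep P n i j * h j - h i - n%:R * c =
   \sum_j nstep P n i j * h j - h i by ring.
apply: le_trans (ler_normB _ _) _.
have -> : 2 * H = H + H by ring.
apply: lerD => //; apply: le_trans (ler_norm_sum _ _ _) _.
rewrite -[leRHS]mul1r -(nstep_sum1 hP n i) mulr_suml; apply: ler_sum => j _.
by rewrite normrM ger0_norm ?(nstep_ge0 hP)// ler_wpM2l ?(nstep_ge0 hP).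
Qed.

(** Jensen's inequality bounds the logarithm of the moment below by [l] times the mean of the walk,
    which is [n * nu (r)] up to a bounded error. *)
Lemma expmoment_rate_ge l i : exists2 k : R, expR (l * \sum_i nu i * r i) <= k &
  expmoment l n i `^ (n%:R^-1) @[n --> \oo] --> k.
Proof.
have /cvg_ex[a ha] := @ln_expmoment_cvg l i.
set c := \sum_i nu i * r i.
exists (expR a); last first.
  apply: cvg_trans; last first.
    apply: (cvg_comp (fun n : nat => ln (expmoment l n i) / n%:R) expR); first exact: ha.
    exact: continuous_expR.
  apply: near_eq_cvg; near=> n.
  by rewrite /= /powR gt_eqF ?expmoment_gt0// mulrC.
rewrite ler_expR.
have [H H0 hH] := path_mean.
have lb n : l * pathE P n (fun s => \sum_(x <- s) r x) i <= ln (expmoment l n i).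
  set m := l * _; rewrite -ler_expR lnK ?posrE ?expmoment_gt0//.
  (* The tangent of the exponential at the mean [m], integrated along paths. *)
  have -> : expR m = pathE P n (fun s => expR m * (1 - m) + expR m * l * \sum_(x <- s) r x) i.
    rewrite pathED (pathE_cst hP).
    have -> : pathE P n (fun s => expR m * l * \sum_(x <- s) r x) i =
        expR m * l * pathE P n (fun s => \sum_(x <- s) r x) i by exact: pathEZ.
    by rewrite -mulrA -/m; ring.
  apply: le_pathE => // s.
  have -> : expR (l * \sum_(x <- s) r x) = expR m * expR (l * (\sum_(x <- s) r x) - m).
    by rewrite -expRD; congr expR; ring.
  have -> : expR m * (1 - m) + expR m * l * \sum_(x <- s) r x =
     expR m * (1 + (l * (\sum_(x <- s) r x) - m)) by ring.
  by rewrite ler_pM2l ?expR_gt0// expR_ge1Dx.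
apply/ler_addgt0Pr => e e0; rewrite -lerBlDr.
apply: (@cvgr_to_ge _ _ _ _ _ _ _ ha) => //.
near=> n.
have n0 : 0 < (n%:R : R) by rewrite ltr0n; near: n; exact: nbhs_infty_gt.
rewrite ler_pdivlMr//; apply: le_trans (lb n).
have := hH n i; set S := pathE _ _ _ _ => hS.
have h1 : l * (n%:R * c) - `|l| * H <= l * S.
  have : `|l * (S - n%:R * c)| <= `|l| * H by rewrite normrM ler_wpM2l.
  rewrite ler_norml => /andP[h2 _]; lra.
have h2 : `|l| * H <= e * n%:R.
  rewrite mulrC -ler_pdivrMl// mulrC; apply: ltW; near: n; exact: nbhs_infty_gtr.
lra.
Unshelve. all: by end_near. Qed.

End MomentGrowth.

Section CriticalDrift.
Context {R : realType} {d : measure_display} {T : measurableType d} {E : finType}.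
Context (mu : probability T R) (P : E -> E -> R) (i : E) (X : nat -> T -> E) (r : E -> R).
Hypotheses (hP : stochastic P) (hX : markov_chain mu P i X).

Lemma walk_on_path n x w : path_event X n x w ->
  walk r X n w = \sum_(y <- [seq x k | k <- iota 1 n]) r y.
Proof.
move=> hw; rewrite big_map /walk /index_iota subn1 /=.
rewrite [LHS]big_seq [RHS]big_seq; apply: eq_bigr => k.
by rewrite mem_iota add1n ltnS => /andP[_ kn]; rewrite hw.
Qed.

Lemma expectation_expR_walk l n :
  fine ('E_mu[fun w => expR (l * walk r X n w)%R])%E = expmoment P r l n i.
Proof.
have mX k e : measurable (X k @^-1` [set e]) by case: hX.
have mg : measurable_fun setT (fun w => expR (l * walk r X n w)).
  apply: measurableT_comp => //; apply: measurable_funM => //.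
  by apply: measurable_sum => k; exact: measurable_fun_finite.
rewrite unlock (integral_paths (n := n) (Psi := fun s => expR (l * \sum_(x <- s) r x)) hX hP)//.
- exact/measurable_EFinP.
  move=> x; rewrite muleC -integral_cst; last exact: (measurable_path_event hX).
  apply: eq_integral => w; rewrite inE => hw.
  by rewrite (walk_on_path hw).
Qed.

Variable nu : E -> R.
Hypotheses (hirr : irreducible P) (hnu : invariant_probability P nu).

Lemma kfun_ge l : expR (l * \sum_j nu j * r j) <= kfun mu r X l.
Proof.
have [k hk hl] := expmoment_rate_ge r hP hirr hnu l i.
apply: (le_trans hk); rewrite le_eqVlt; apply/orP; left; apply/eqP/esym.
rewrite /kfun; under eq_fun do rewrite expectation_expR_walk.
by apply: cvg_lim.
Qed.

Lemma kfun0 : kfun mu r X 0 = 1.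
Proof.
rewrite /kfun; under eq_fun do rewrite expectation_expR_walk.
have E1 n : expmoment P r 0 n i = 1.
  rewrite -[RHS](pathE_cst hP n 1 i); apply: eq_pathE => s.
  by rewrite mul0r expR0.
by under eq_fun do rewrite E1 powR1; exact: lim_cst.
Qed.

(** The graph of [kfun] lies above the line [1 + l * c] and meets it at 0, so the right and left
    difference quotients give the two inequalities on [c]. *)
Lemma drift_eq0 : is_derive (0 : R) 1 (kfun mu r X) 0 -> \sum_j nu j * r j = 0.
Proof.
move=> [dk dk0]; set c := \sum_j _.
have lk l : 1 + l * c <= kfun mu r X l.
  by apply: le_trans (kfun_ge l); exact: expR_ge1Dx.
have hc : h^-1 *: ((kfun mu r X \o shift 0) (h *: 1) - kfun mu r X 0) @[h --> (0 : R)^'] -->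
    'D_1 (kfun mu r X) 0 by exact: dk.
rewrite dk0 in hc.
apply/eqP; rewrite eq_le; apply/andP; split.
- apply: (@cvgr_to_ge _ _ _ _ _ _ _ (cvg_dnbhs_at_right hc)); near=> h.
  have h0 : 0 < h by near: h; exact: nbhs_right_gt.
  rewrite /= addr0 /GRing.scale /= mulr1 kfun0 ler_pdivlMl//.
  by have := lk h; rewrite lerBrDl.
- apply: (@cvgr_to_le _ _ _ _ _ _ _ (cvg_dnbhs_at_left hc)); near=> h.
  have h0 : h < 0 by near: h; exact: nbhs_left_lt.
  rewrite /= addr0 /GRing.scale /= mulr1 kfun0 ler_ndivrMl//.
  by have := lk h; rewrite lerBrDl.
Unshelve. all: by end_near. Qed.

End CriticalDrift.

(** * The law of the branching process *)

Section DiscreteMeasurability.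
Context {d : measure_display} {T : measurableType d}.

(** Measurability for the discrete sigma-algebra, stated through preimages since [E] carries no
    measurable structure. *)
Definition discretely_measurable {K : Type} (Y : T -> K) :=
  forall B : set K, measurable (Y @^-1` B).

Lemma discretely_measurable1 {K : countType} (Y : T -> K) :
  (forall k, measurable (Y @^-1` [set k])) -> discretely_measurable Y.
Proof.
move=> h B; have -> : Y @^-1` B = \bigcup_(k in B) (Y @^-1` [set k]).
  by apply/seteqP; split => w /=; [move=> Bw; exists (Y w)|move=> [k Bk] ->].
rewrite bigcup_mkcond; apply: countable_bigcupT_measurable => // k.
by case: ifP.
Qed.

Lemma discretely_measurable_bind {K : countType} {L : Type} (Y : T -> K) (F : K -> T -> L) :
  discretely_measurable Y -> (forall k, discretely_measurable (F k)) ->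
  discretely_measurable (fun w => F (Y w) w).
Proof.
move=> mY mF B.
have -> : (fun w => F (Y w) w) @^-1` B = \bigcup_k (Y @^-1` [set k] `&` F k @^-1` B).
  apply/seteqP; split => w /=; first by move=> Bw; exists (Y w).
  by move=> [k _ [/= ->]].
by apply: countable_bigcupT_measurable => // k; apply: measurableI; [exact: mY|exact: mF].
Qed.

Lemma discretely_measurable_cst {K : Type} (k : K) : discretely_measurable (fun=> k).
Proof. by move=> B; rewrite preimage_cst; case: ifP. Qed.

Lemma discretely_measurable_comp {K L : Type} (Y : T -> K) (g : K -> L) :
  discretely_measurable Y -> discretely_measurable (fun w => g (Y w)).
Proof. by move=> mY B; exact: (mY (g @^-1` B)). Qed.

Lemma discretely_measurable_sum (Y : nat -> T -> nat) b :
  (forall j, discretely_measurable (Y j)) ->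
  discretely_measurable (fun w => (\sum_(j < b) Y j w)%N).
Proof.
move=> mY; elim: b => [|b IH].
  by under eq_fun do rewrite big_ord0; exact: discretely_measurable_cst.
under eq_fun do rewrite big_ord_recr /=.
apply: (@discretely_measurable_bind nat nat (fun w => (\sum_(j < b) Y j w)%N)
  (fun k w => (k + Y b w)%N)) => // k.
exact: discretely_measurable_comp.
Qed.

Lemma measurable_fun_discrete {K : Type} {d'} {U : measurableType d'} (D : set T)
    (Y : T -> K) (phi : K -> U) :
  discretely_measurable Y -> measurable_fun D (fun w => phi (Y w)).
Proof. by move=> mY mD B _; apply: measurableI => //; exact: (mY (phi @^-1` B)). Qed.

Local Open Scope ereal_scope.

Lemma ge0_integral_nat_split {R : realType} (mu : {measure set T -> \bar R}) (D : set T)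
    (Y : T -> nat) (g : T -> \bar R) :
  measurable D -> discretely_measurable Y -> measurable_fun D g ->
  (forall w, D w -> 0 <= g w) ->
  \int[mu]_(w in D) g w = \sum_(k <oo) \int[mu]_(w in D `&` (Y @^-1` [set k])) g w.
Proof.
move=> mD mY mg g0.
have DE : D = \bigcup_k (D `&` (Y @^-1` [set k])).
  by apply/seteqP; split => w; [move=> Dw; exists (Y w)|move=> [k _ []]].
rewrite {1}DE ge0_integral_bigcup//; rewrite -?DE//.
- by move=> k; apply: measurableI.
- by move=> k l _ _ [w [[_ /= <-] [_ /= <-]]].
Qed.

End DiscreteMeasurability.

Section GenfunSeries.
Context {R : realType}.
Local Open Scope ereal_scope.

Lemma genfun_series (q : probability nat R) (t : R) : (0 <= t <= 1)%R ->
  (genfun q t)%:E = \sum_(k <oo) (t ^+ k)%:E * q [set k].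
Proof.
move=> /andP[t0 t1].
have E : \int[q]_k (t ^+ k)%:E = \sum_(k <oo) (t ^+ k)%:E * q [set k].
  rewrite (@ge0_integral_nat_split _ _ _ _ _ id)//.
  - apply: eq_eseriesr => k _; rewrite setTI -integral_cst//.
    by apply: eq_integral => l; rewrite inE /= => ->.
  - by move=> k _; rewrite lee_fin exprn_ge0.
rewrite -E /genfun unlock fineK// ge0_fin_numE; last first.
  by apply: integral_ge0 => k _; rewrite lee_fin exprn_ge0.
apply: (@le_lt_trans _ _ (\int[q]_k (cst 1 k))).
  apply: ge0_le_integral => //.
  - by move=> k _; rewrite lee_fin exprn_ge0.
  - by move=> k _; rewrite lee_fin exprn_ile1.
by rewrite integral_cst//= probability_setT mule1 ltry.
Qed.

End GenfunSeries.

Section Branching.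
Context {R : realType} {d : measure_display} {T : measurableType d} {E : finType}.
Context (mu : probability T R) (q : E -> probability nat R).
Context (xi : E -> nat -> nat -> T -> nat).
Hypothesis hxi : copies mu q xi.
Local Open Scope ereal_scope.

Let index := (E * nat * nat)%type.
Let ev (A : index -> set nat) (t : index) := xi t.1.1 t.1.2 t.2 @^-1` A t.

(** Joint independence of the event [H] and of the offspring variables indexed by [D]; [D] shrinks
    as variables get used in the definition of [H]. *)
Definition indep_of (H : set T) (D : set index) :=
  measurable H /\ forall (s : seq index) A, uniq s -> (forall t, t \in s -> D t) ->
    mu (H `&` \bigcap_(t in [set` s]) ev A t) = mu H * \prod_(t <- s) mu (ev A t).

Lemma discretely_measurable_xi e n j : discretely_measurable (xi e n j).
Proof. by move=> B; rewrite -[_ @^-1` _]setTI; apply: (proj1 (hxi e n j)). Qed.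

Let mev A t : measurable (ev A t). Proof. exact: discretely_measurable_xi. Qed.

Let mcap A (s : seq index) : measurable (\bigcap_(t in [set` s]) ev A t).
Proof. by apply: fin_bigcap_measurable => //; exact: finite_seq. Qed.

Lemma sub_indep_of H D D' : D' `<=` D -> indep_of H D -> indep_of H D'.
Proof. by move=> h [mH hH]; split => // s A us hs; apply: hH => // t /hs/h. Qed.

Lemma indep_of_mu H D t B : indep_of H D -> D t ->
  mu (H `&` (xi t.1.1 t.1.2 t.2 @^-1` B)) = mu H * mu (xi t.1.1 t.1.2 t.2 @^-1` B).
Proof.
move=> [mH hH] Dt; have := hH [:: t] (fun=> B) isT.
rewrite classical_sets.bigcap_seq !big_seq1; apply => u; rewrite inE => /eqP ->; exact: Dt.
Qed.

Lemma indep_of_cap H D t B : indep_of H D -> D t ->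
  indep_of (H `&` (xi t.1.1 t.1.2 t.2 @^-1` B)) (D `\ t).
Proof.
move=> hHD Dt; have [mH hH] := hHD; split.
  by apply: measurableI => //; exact: discretely_measurable_xi.
move=> s A us hs; pose A' u := if u == t then B else A u.
have ts : t \notin s by apply/negP => /hs [_]; apply.
have E1 u : u \in s -> ev A u = ev A' u.
  by move=> us'; rewrite /ev /A'; case: eqP => // ut; rewrite -ut us' in ts.
have E2 : xi t.1.1 t.1.2 t.2 @^-1` B = ev A' t by rewrite /ev /A' eqxx.
rewrite (indep_of_mu _ hHD Dt) E2 -muleA.
rewrite (eq_big_seq _ (fun u us => congr1 mu (E1 u us))) -(big_cons _ _ t s xpredT).
rewrite -setIA.
have -> : ev A' t `&` \bigcap_(u in [set` s]) ev A u = \bigcap_(u in [set` t :: s]) ev A' u.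
  rewrite !classical_sets.bigcap_seq big_cons; congr (_ `&` _).
  exact: eq_big_seq.
apply: hH; first by rewrite /= ts.
by move=> u; rewrite inE => /predU1P[->//|/hs []].
Qed.

Lemma indep_of_bigcup (H : nat -> set T) D : (forall k, indep_of (H k) D) ->
  trivIset setT H -> indep_of (\bigcup_k H k) D.
Proof.
move=> hH tH; have mH k : measurable (H k) by case: (hH k).
split; first exact: bigcupT_measurable.
move=> s A us hs; set C := \bigcap_(t in _) _; set p := \prod_(t <- s) _.
have mC : measurable C by exact: mcap.
rewrite setI_bigcupl !measure_bigcup//; last 2 first.
- by move=> k _; exact: measurableI.
- by apply: trivIset_setIr.
have p0 : 0 <= p by rewrite /p big_seq; apply: prode_ge0 => t _; exact: measure_ge0.
have pfin : p \is a fin_num.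
  by rewrite /p; elim/big_ind: _ => // [x y|t _]; [exact: fin_numM|rewrite fin_num_measure].
rewrite [RHS]muleC -[p]fineK// -nneseriesZl//.
by apply: eq_eseriesr => k _; rewrite fineK// muleC; case: (hH k) => _; apply.
Qed.

Let family e n b : set index := [set t | t.1 = (e, n) /\ (t.2 < b)%N].

(** Fixing the value [k] of the last variable leaves a shorter sum, whose target set is shifted by
    [k]. *)
Lemma sum_indep_of e n b (B : set nat) H D : indep_of H D ->
  family e n b `<=` D ->
  indep_of (H `&` [set w | B (\sum_(j < b) xi e n j w)%N]) (D `\` family e n b).
Proof.
elim: b B H D => [|b IH] B H D hH hD.
  have -> : H `&` [set w | B (\sum_(j < 0) xi e n j w)%N] = if `[< B 0%N >] then H else set0.
    case: asboolP => h0; apply/seteqP; split => w //=; rewrite big_ord0; tauto.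
  case: asboolP => _; first by apply: sub_indep_of hH => t [].
  by split => // s A _ _; rewrite set0I measure0 mul0e.
have Db : D (e, n, b) by apply: hD; split => /=.
have -> : H `&` [set w | B (\sum_(j < b.+1) xi e n j w)%N] =
  \bigcup_k ((H `&` (xi e n b @^-1` [set k])) `&`
     [set w | [set a | B (a + k)%N] (\sum_(j < b) xi e n j w)%N]).
  apply/seteqP; split => w /=.
    by move=> [Hw]; rewrite big_ord_recr /= => Bw; exists (xi e n b w).
  by move=> [k _ [[Hw /= <-] Bw]]; split => //; rewrite big_ord_recr.
apply: indep_of_bigcup => [k|]; last first.
  by move=> k l _ _ [w [[[_ /= <-] _] [[_ /= <-] _]]].
have h := IH [set a | B (a + k)%N] _ _ (@indep_of_cap _ _ (e, n, b) [set k] hH Db).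
apply: sub_indep_of (h _) => [t [Dt nt]|t [t1 tb]].
- split; last by move=> [t1 tb]; apply: nt; split => //; exact: leqW.
  by split => //; move=> /= te; apply: nt; rewrite te; split => /=.
- split; first by apply: hD; split => //; exact: leqW.
  by move=> /= te; rewrite te ltnn in tb.
Qed.

Lemma measurable_expr (Y : T -> nat) (t : R) (D : set T) : discretely_measurable Y ->
  measurable_fun D (fun w => (t ^+ Y w)%:E).
Proof. exact: (@measurable_fun_discrete _ _ nat _ _ D Y (fun k => (t ^+ k)%:E)). Qed.

(** Splitting according to the value of the last variable produces the series of [genfun (q e) t],
    one factor for each individual. *)
Lemma integral_sum_expr e n b (t : R) H D : (0 <= t <= 1)%R -> indep_of H D ->
  family e n b `<=` D ->
  \int[mu]_(w in H) (t ^+ (\sum_(j < b) xi e n j w)%N)%:E =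
  mu H * (genfun (q e) t ^+ b)%:E.
Proof.
move=> t01; have /andP[t0 t1] := t01; elim: b H D => [|b IH] H D hH hD; have [mH _] := hH.
  under eq_integral do rewrite big_ord0 expr0.
  by rewrite expr0 mule1 integral_cst// mul1e.
have Db : D (e, n, b) by apply: hD; split => /=.
rewrite (@ge0_integral_nat_split _ _ _ _ _ (xi e n b))//; last 3 first.
- exact: discretely_measurable_xi.
- apply: measurable_expr.
  by apply: discretely_measurable_sum => j; exact: discretely_measurable_xi.
- by move=> w _; rewrite lee_fin exprn_ge0.
set f := genfun (q e) t.
have f0 : (0 <= f)%R.
  by apply: fine_ge0; rewrite unlock; apply: integral_ge0 => k _; rewrite lee_fin exprn_ge0.
have fin : mu H \is a fin_num by rewrite fin_num_measure.
have E1 k : \int[mu]_(w in H `&` xi e n b @^-1` [set k])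
     (t ^+ (\sum_(j < b.+1) xi e n j w)%N)%:E =
    (fine (mu H) * f ^+ b)%:E * ((t ^+ k)%:E * q e [set k]).
  have mk : measurable (H `&` xi e n b @^-1` [set k]).
    by apply: measurableI => //; exact: discretely_measurable_xi.
  transitivity (\int[mu]_(w in H `&` xi e n b @^-1` [set k])
     ((t ^+ k)%:E * (t ^+ (\sum_(j < b) xi e n j w)%N)%:E)).
    apply: eq_integral => w; rewrite inE => -[_ /= <-].
    by rewrite big_ord_recr /= exprD mulrC EFinM.
  rewrite ge0_integralZl//; last 3 first.
  - apply: measurable_expr.
    by apply: discretely_measurable_sum => j; exact: discretely_measurable_xi.
  - by move=> w _; rewrite lee_fin exprn_ge0.
  - by rewrite lee_fin exprn_ge0.
  rewrite (IH _ _ (@indep_of_cap _ _ (e, n, b) [set k] hH Db)); last first.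
    move=> u [u1 ub]; split; first by apply: hD; split => //; exact: leqW.
    by move=> /= ue; rewrite ue ltnn in ub.
  rewrite (@indep_of_mu _ _ (e, n, b) _ hH Db) /= (proj2 (hxi e n b)) -/f.
  have qfin : q e [set k] \is a fin_num by rewrite fin_num_measure.
  by rewrite -(fineK fin) -(fineK qfin) -!EFinM /=; congr EFin; ring.
under eq_eseriesr do rewrite E1.
rewrite nneseriesZl -?genfun_series//; last first.
  by move=> k _; rewrite mule_ge0// lee_fin exprn_ge0.
by rewrite -/f exprSr -EFinM -[in RHS](fineK fin) -EFinM mulrA.
Qed.

End Branching.

Section BranchingOnPaths.
Context {R : realType} {d : measure_display} {T : measurableType d} {E : finType}.
Context (mu : probability T R) (q : E -> probability nat R) (P : E -> E -> R) (i : E).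
Context (X : nat -> T -> E) (xi : E -> nat -> nat -> T -> nat).
Hypotheses (hP : stochastic P) (hX : markov_chain mu P i X).
Hypotheses (hxi : copies mu q xi) (hindep : independent mu X xi).
Hypothesis hmom2 : forall e, ('E_(q e)[fun m : nat => (m%:R ^+ 2)%R] < +oo)%E.
Local Open Scope ereal_scope.

Let f e := genfun (q e).

Lemma discretely_measurable_branching (Y : nat -> T -> E) z n :
  (forall k, discretely_measurable (Y k)) -> discretely_measurable (branching Y xi z n).
Proof.
move=> mY; elim: n => [|n IH] /=; first exact: discretely_measurable_cst.
apply: (@discretely_measurable_bind _ _ nat nat (branching Y xi z n)
  (fun b w => \sum_(j < b) xi (Y n.+1 w) n j w)%N) => // b.
apply: (@discretely_measurable_bind _ _ E nat (Y n.+1)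
  (fun e w => \sum_(j < b) xi e n j w)%N) => // e.
by apply: discretely_measurable_sum => j; exact: (discretely_measurable_xi hxi).
Qed.

Lemma branching_on_path N x z n w : path_event X N x w -> (n <= N)%N ->
  branching X xi z n w = branching (fun k _ => x k) xi z n w.
Proof.
by move=> hw; elim: n => [//|n IH] nN /=; rewrite IH ?(ltnW nN)// hw.
Qed.

Let levels n : set (E * nat * nat) := [set t | (n <= t.1.2)%N].

Lemma branching_indep_of x z n b H : indep_of mu xi H setT ->
  indep_of mu xi (H `&` (branching (fun k _ => x k) xi z n @^-1` [set b])) (levels n).
Proof.
move=> hH; elim: n b => [|n IH] b.
  have [zb|zb] := eqVneq z b.
    have -> : H `&` (branching (fun k _ => x k) xi z 0 @^-1` [set b]) = H.
      by apply/seteqP; split => w //= -[].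
    exact: sub_indep_of hH.
  have -> : H `&` (branching (fun k _ => x k) xi z 0 @^-1` [set b]) = set0.
    by apply/seteqP; split => w //= -[_ /eqP]; rewrite (negbTE zb).
  by split => // s A _ _; rewrite set0I measure0 mul0e.
have -> : H `&` (branching (fun k _ => x k) xi z n.+1 @^-1` [set b]) =
  \bigcup_c ((H `&` (branching (fun k _ => x k) xi z n @^-1` [set c])) `&`
     [set w | [set b] (\sum_(j < c) xi (x n.+1) n j w)%N]).
  apply/seteqP; split => w /=; first by move=> [Hw bw]; exists (branching (fun k _ => x k) xi z n w).
  by move=> [c _ [[Hw /= <-]]].
apply: indep_of_bigcup => // [c|]; last by move=> k l _ _ [w [[[_ /= <-] _] [[_ /= <-] _]]].
have h := sum_indep_of hxi [set b] (IH c) (e := x n.+1) (n := n) (b := c).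
apply: sub_indep_of (h _) => [t /= tn|t [t1 _]].
- by split; [exact: ltnW|move=> [t1 _]; move: tn; rewrite /levels /= t1 ltnn].
- by rewrite /levels /= t1.
Qed.

(** Integrating out the last generation replaces [t] by [f (x n.+1) t], so the induction needs every
    [t] in the unit interval. *)
Lemma integral_branching_expr x z n (t : R) H : (0 <= t <= 1)%R -> indep_of mu xi H setT ->
  \int[mu]_(w in H) (t ^+ branching (fun k _ => x k) xi z n w)%:E =
  mu H * (foldr f t [seq x k | k <- iota 1 n] ^+ z)%:E.
Proof.
move=> t01 hH; have [mH _] := hH; elim: n t t01 => [|n IH] t t01.
  by rewrite /= muleC -integral_cst.
have f01 : (0 <= f (x n.+1) t <= 1)%R := genfun_itv (hmom2 _) t01.
have mB m : discretely_measurable (branching (fun k _ => x k) xi z m).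
  by apply: discretely_measurable_branching => k; exact: discretely_measurable_cst.
have -> : [seq x k | k <- iota 1 n.+1] = rcons [seq x k | k <- iota 1 n] (x n.+1).
  by rewrite iota1S map_rcons.
rewrite foldr_rcons -IH//.
have ge0 (s : R) m : (0 <= s <= 1)%R -> forall w, H w ->
    0 <= (s ^+ branching (fun k _ => x k) xi z m w)%:E.
  by move=> /andP[s0 _] w _; rewrite lee_fin exprn_ge0.
rewrite (@ge0_integral_nat_split _ _ _ _ _ (branching (fun k _ => x k) xi z n))//; last 2 first.
- exact: measurable_expr.
- exact: ge0.
rewrite [RHS](@ge0_integral_nat_split _ _ _ _ _ (branching (fun k _ => x k) xi z n))//; last 2 first.
- exact: measurable_expr.
- exact: ge0.
apply: eq_eseriesr => b _.
transitivity (\int[mu]_(w in H `&` branching (fun k _ => x k) xi z n @^-1` [set b])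
   (t ^+ (\sum_(j < b) xi (x n.+1) n j w)%N)%:E).
  by apply: eq_integral => w; rewrite inE => -[_ /= <-].
have hb := branching_indep_of x z n b hH.
rewrite (integral_sum_expr hxi t01 hb); last by move=> u [u1 _]; rewrite /levels /= u1.
rewrite muleC -integral_cst; last by case: hb.
by apply: eq_integral => w; rewrite inE => -[_ /= <-].
Qed.

Lemma path_event_indep_of N x : indep_of mu xi (path_event X N x) setT.
Proof.
by split; [exact: (measurable_path_event hX)|move=> s A us _; exact: hindep].
Qed.

(** The case [t = 0], where [0 ^+ b] is the indicator of [b = 0]. *)
Lemma extinction_on_path n x z :
  mu (path_event X n x `&` (branching X xi z n @^-1` [set 0%N])) =
  mu (path_event X n x) * (compgen f [seq x k | k <- iota 1 n] ^+ z)%:E.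
Proof.
have t01 : (0 <= (0 : R) <= 1)%R by rewrite lexx ler01.
rewrite -(integral_branching_expr x z n t01 (path_event_indep_of n x)).
have mp := measurable_path_event hX n x.
have mX k : discretely_measurable (X k).
  by apply: discretely_measurable1 => e; case: hX => + _ _; apply.
have mB : measurable (branching X xi z n @^-1` [set 0%N]).
  by apply: discretely_measurable_branching.
rewrite setIC -integral_indic//; apply: eq_integral => w; rewrite inE => hw.
rewrite -(branching_on_path z hw (leqnn n)) indicE expr0n.
by congr (_%:R)%:E; congr nat_of_bool; apply/idP/eqP; rewrite inE.
Qed.

Lemma survival_law n z j :
  fine (mu [set w | (0 < branching X xi z n.+1 w)%N /\ X n.+1 w = j]) =
  pathE P n.+1 (fun s => (1 - compgen f s ^+ z) * (last i s == j)%:R)%R i.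
Proof.
set S := [set w | _].
have mX k : discretely_measurable (X k).
  by apply: discretely_measurable1 => e; case: hX => + _ _; apply.
have mB : discretely_measurable (branching X xi z n.+1).
  exact: discretely_measurable_branching.
have mS : measurable S.
  by apply: measurableI; [exact: (mB [set b | (0 < b)%N])|exact: (mX n.+1 [set j])].
rewrite -[S]setIT -integral_indic//.
rewrite (@integral_paths _ _ _ _ _ _ _ _ hX n.+1 _
  (fun s => (1 - compgen f s ^+ z) * (last i s == j)%:R)%R hP)//.
  exact/measurable_EFinP.
move=> x; have mp := measurable_path_event hX n.+1 x.
rewrite integral_indic//.
have -> : last i [seq x k | k <- iota 1 n.+1] = x n.+1.
  by rewrite iota1S map_rcons last_rcons.
have [xj|xj] := eqVneq (x n.+1) j; last first.
  rewrite mulr0 mule0; have -> : S `&` path_event X n.+1 x = set0; last exact: measure0.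
  apply/seteqP; split => w //= -[[_ wj] wx]; move: xj.
  by rewrite -wj wx// eqxx.
have -> : S `&` path_event X n.+1 x =
    path_event X n.+1 x `\` (branching X xi z n.+1 @^-1` [set 0%N]).
  apply/seteqP; split => w /=.
    by move=> [[/[!lt0n]/eqP b0 _] hw]; split.
  by move=> [hw /eqP h]; split => //; split; [rewrite lt0n|rewrite hw].
rewrite mulr1.
have fin : mu (path_event X n.+1 x) \is a fin_num by rewrite fin_num_measure.
have h : mu (path_event X n.+1 x `\` (branching X xi z n.+1 @^-1` [set 0%N])) =
    mu (path_event X n.+1 x) -
    mu (path_event X n.+1 x `&` (branching X xi z n.+1 @^-1` [set 0%N])).
  by apply: measureD => //; rewrite -ge0_fin_numE.
apply: (etrans h).
rewrite extinction_on_path -(fineK fin) -!EFinM -EFinB /=; congr EFin; ring.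
Qed.

End BranchingOnPaths.

(** * Joint limit with the environment *)

Section JointLaw.
Context {R : realType} {E : finType} (P : E -> E -> R).
Hypothesis hP : stochastic P.

Lemma pathE_rcons n (Psi : seq E -> R) i :
  pathE P n.+1 Psi i = pathE P n (fun s => \sum_j P (last i s) j * Psi (rcons s j)) i.
Proof.
elim: n Psi i => [//|n IH] Psi i.
by apply: eq_bigr => j _; congr (_ * _); exact: (IH (fun s => Psi (j :: s))).
Qed.

Lemma pathE_sum n (I : finType) (w : I -> R) (Psi : I -> seq E -> R) i :
  pathE P n (fun s => \sum_k w k * Psi k s) i = \sum_k w k * pathE P n (Psi k) i.
Proof.
elim: n Psi i => [//|n IH] Psi i /=.
under eq_bigr do rewrite IH mulr_sumr.
rewrite exchange_big; apply: eq_bigr => k _; rewrite mulr_sumr.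
by apply: eq_bigr => j _; rewrite mulrCA.
Qed.

Context (g : seq E -> R).
Hypothesis g_ge0 : forall s, 0 <= g s.
Hypothesis g_rcons : forall s j, g (rcons s j) <= g s.

(** [g] stands for the survival probability given the environment, which can only decrease when a
    generation is appended; [joint] is then the probability of being alive at time [n] in state
    [j]. *)
Let joint n i j := pathE P n (fun s => g s * (last i s == j)%:R) i.

Lemma joint_ge0 n i j : 0 <= joint n i j.
Proof. by apply: (pathE_ge0 hP) => s; rewrite mulr_ge0. Qed.

Lemma joint_sum n i : \sum_j joint n i j = pathE P n g i.
Proof.
have := pathE_sum n (fun=> 1) (fun j s => g s * (last i s == j)%:R) i.
under [RHS]eq_bigr do rewrite mul1r.
move=> <-; apply: eq_pathE => s; under eq_bigr do rewrite mul1r.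
rewrite -mulr_sumr (bigD1 (last i s))//= eqxx big1 ?addr0 ?mulr1// => l ls.
by rewrite eq_sym (negbTE ls).
Qed.

Lemma jointS_le n i j : joint n.+1 i j <= \sum_l joint n i l * P l j.
Proof.
have -> : \sum_l joint n i l * P l j = pathE P n (fun s => g s * P (last i s) j) i.
  under eq_bigr do rewrite mulrC.
  rewrite -pathE_sum; apply: eq_pathE => s.
  rewrite (bigD1 (last i s))//= eqxx mulr1 big1 ?addr0 1?mulrC// => l ls.
  by rewrite eq_sym (negbTE ls) !mulr0.
rewrite /joint pathE_rcons; apply: (le_pathE hP) => s.
rewrite (bigD1 j)//= last_rcons eqxx mulr1 big1 ?addr0; last first.
  by move=> l lj; rewrite last_rcons (negbTE lj) !mulr0.
by rewrite mulrC ler_wpM2r// (proj1 hP).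
Qed.

Lemma jointD_le n m i j : joint (n + m) i j <= \sum_l joint n i l * nstep P m l j.
Proof.
elim: m n => [|m IH] n.
  rewrite addn0 (bigD1 j)//= eqxx mulr1 lerDl; apply: sumr_ge0 => l _.
  by rewrite mulr_ge0// joint_ge0.
rewrite -addSnnS; apply: le_trans (IH n.+1) _.
apply: le_trans (_ : \sum_l (\sum_k joint n i k * P k l) * nstep P m l j <= _).
  by apply: ler_sum => l _; rewrite ler_wpM2r ?(nstep_ge0 hP)// jointS_le.
under eq_bigr do rewrite mulr_suml.
rewrite exchange_big /= le_eqVlt; apply/orP; left; apply/eqP; apply: eq_bigr => k _.
by rewrite mulr_sumr; apply: eq_bigr => l _; rewrite mulrA.
Qed.

Context (nu : E -> R).
Hypothesis nu1 : \sum_j nu j = 1.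

(** Above, survival during the last [m] steps is ignored and the chain mixes. Below, the upper
    bounds for all other states are subtracted from the total mass at time [n + m]. *)
Lemma joint_sandwich (eps : R) n m i j :
  (forall k l, `|nstep P m k l - nu l| <= eps) ->
  pathE P (n + m) g i - (1 - nu j + #|E|%:R * eps) * pathE P n g i
    <= joint (n + m) i j <= (nu j + eps) * pathE P n g i.
Proof.
move=> hm.
have up l : joint (n + m) i l <= (nu l + eps) * pathE P n g i.
  apply: le_trans (jointD_le n m i l) _; rewrite -joint_sum mulr_sumr.
  apply: ler_sum => k _; rewrite mulrC ler_wpM2r ?joint_ge0//.
  by have := hm k l; rewrite ler_norml => /andP[_]; rewrite lerBlDl.
rewrite up andbT -(joint_sum (n + m)) (bigD1 j)//= -addrA gerDl subr_le0.
apply: le_trans (_ : \sum_(l | l != j) (nu l + eps) * pathE P n g i <= _).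
  by apply: ler_sum => l _.
have p0 : 0 <= pathE P n g i by apply: (pathE_ge0 hP).
have nuS : \sum_(l | l != j) nu l = 1 - nu j.
  by rewrite -nu1 [in RHS](bigD1 j)//= addrAC subrr add0r.
rewrite -mulr_suml ler_wpM2r// big_split /= nuS lerD2l sumr_const -[leLHS]mulr_natl ler_wpM2r//.
  by apply: le_trans (hm i j).
by rewrite ler_nat max_card.
Qed.

End JointLaw.

Section JointLimit.
Context {R : realType}.

(** For fixed [m], the limit of [sqrt n * p n] also governs [p (n + m)], so the two bounds differ by
    O(eps) after normalization. *)
Lemma cvg_sandwich (p G : nat -> R) (u v K : R) : 0 < u -> 0 <= v <= 1 -> 0 <= K ->
  (forall n, 0 <= p n) ->
  (forall eps : R, 0 < eps -> exists m, forall n,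
     p (n + m)%N - (1 - v + K * eps) * p n <= G (n + m)%N <= (v + eps) * p n) ->
  Num.sqrt n%:R * p n @[n --> \oo] --> u ->
  Num.sqrt n%:R * G n @[n --> \oo] --> u * v.
Proof.
move=> u0 /andP[v0 v1] K0 p0 hG hp; apply/cvgrPdist_le => e e0.
(* Chosen so that all terms of order [eps * u], including those with the factor [K], stay below
   [e]. *)
pose eps := Num.min 1 (e / (2 * ((2 * K + 4) * (u + 1)))).
have D0 : 0 < 2 * ((2 * K + 4) * (u + 1)) by rewrite !mulr_gt0//; lra.
have eps0 : 0 < eps by rewrite lt_min ltr01 divr_gt0.
have eps1 : eps <= 1 by rewrite ge_min lexx.
have epse : eps * ((2 * K + 4) * (u + 1)) <= e / 2.
  rewrite ler_pdivlMr// -mulrA [_ * 2]mulrC -ler_pdivlMr//.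
  by rewrite ge_min lexx orbT.
have [m hm] := hG _ eps0.
have hpm : Num.sqrt (n + m)%:R * p (n + m)%N @[n --> \oo] --> u 
  by rewrite (cvg_shiftn m (fun n => Num.sqrt n%:R * p n) (nbhs u)).
have hup : (v + eps) * ((1 + eps) * (Num.sqrt n%:R * p n)) @[n --> \oo] -->
    (v + eps) * ((1 + eps) * u).
  by apply: cvgM; [exact: cvg_cst|apply: cvgM; [exact: cvg_cst|exact: hp]].
have hlo : Num.sqrt (n + m)%:R * p (n + m)%N -
    (1 - v + K * eps) * ((1 + eps) * (Num.sqrt n%:R * p n)) @[n --> \oo] -->
    u - (1 - v + K * eps) * ((1 + eps) * u).
  apply: cvgB; first exact: hpm.
  by apply: cvgM; [exact: cvg_cst|apply: cvgM; [exact: cvg_cst|exact: hp]].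
have [b1 b2] : (v + eps) * ((1 + eps) * u) < u * v + e /\
   u * v - e < u - (1 - v + K * eps) * ((1 + eps) * u).
  have ee : eps ^+ 2 <= eps by rewrite expr2 ger_pMl.
  have eu : 0 <= eps * u by rewrite ltW// mulr_gt0.
  have : eps * u * (2 * K + 4) <= e / 2.
    apply: le_trans epse; rewrite -mulrA ler_pM2l// [leRHS]mulrC ler_wpM2r//; lra.
  have h1 : eps * u * v <= eps * u by rewrite ger_pMr//; nra.
  have h2 : eps ^+ 2 * u <= eps * u by rewrite ler_wpM2r// ltW.
  have h3 : K * (eps ^+ 2 * u) <= K * (eps * u) by rewrite ler_wpM2l.
  have h4 : 0 <= K * (eps * u) by rewrite mulr_ge0.
  have h5 : 0 <= eps * u * v by rewrite mulr_ge0.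
  rewrite expr2 in h2 h3.
  by split; nra.
have key : \forall n \near \oo, `|u * v - Num.sqrt (n + m)%:R * G (n + m)%N| <= e.
  have g1 := cvgr_lt _ hup _ b1; have g2 := cvgr_gt _ hlo _ b2.
  near=> n.
  have n0 : 0 < (n%:R : R) by rewrite ltr0n; near: n; exact: nbhs_infty_gt.
  (* Shifting time by the fixed [m] changes the normalization by a factor at most [1 + eps] once
     [n >= m / eps]. *)
  have sq : Num.sqrt (n + m)%:R <= (1 + eps) * Num.sqrt (n%:R : R).
    have e1 : 0 <= 1 + eps by lra.
    rewrite -[X in X * _](ger0_norm e1) -sqrtr_sqr -sqrtrM ?sqr_ge0//.
    apply: ler_wsqrtr.
    have : m%:R / eps <= n%:R by apply: ltW; near: n; exact: nbhs_infty_gtr.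
    rewrite ler_pdivrMr// natrD expr2; nra.
  have s0 : 0 <= Num.sqrt ((n + m)%:R : R) by exact: sqrtr_ge0.
  have /andP[h1 h2] := hm n.
  have k1 := ler_wpM2l s0 h1; have k2 := ler_wpM2l s0 h2.
  have k3 := ler_wpM2r (p0 n) sq.
  have l1 : (v + eps) * ((1 + eps) * (Num.sqrt n%:R * p n)) < u * v + e by near: n; exact: g1.
  have l2 : u * v - e < Num.sqrt (n + m)%:R * p (n + m)%N -
    (1 - v + K * eps) * ((1 + eps) * (Num.sqrt n%:R * p n)) by near: n; exact: g2.
  rewrite mulrBr mulrCA in k1; rewrite mulrCA in k2.
  have k4 : (v + eps) * (Num.sqrt (n + m)%:R * p n) <=
    (v + eps) * ((1 + eps) * (Num.sqrt n%:R * p n)) by rewrite ler_wpM2l ?mulrA//; lra.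
  have k5 : (1 - v + K * eps) * (Num.sqrt (n + m)%:R * p n) <=
      (1 - v + K * eps) * ((1 + eps) * (Num.sqrt n%:R * p n)).
    rewrite ler_wpM2l ?mulrA//; apply: addr_ge0; [lra|by rewrite mulr_ge0// ltW].
  by rewrite ler_norml; apply/andP; split; lra.
have [N _ hN] := key; exists (N + m)%N => // n /= Nn.
have mn : (m <= n)%N := leq_trans (leq_addl N m) Nn.
by have := hN (n - m)%N; rewrite /= subnK//; apply; rewrite -(leq_add2r m) subnK.
Unshelve. all: by end_near. Qed.

Lemma equiv_invsqrt (G : nat -> R) (l : R) : 0 < l ->
  Num.sqrt n%:R * G n @[n --> \oo] --> l -> G ~_\oo (fun n => l / Num.sqrt n%:R).
Proof.
move=> l0 h; apply/eqaddoP => e e0.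
have el : 0 < e * l by rewrite mulr_gt0.
have /cvgrPdist_le/(_ _ el) hn := h; near=> n.
have n0 : 0 < Num.sqrt (n%:R : R) by rewrite sqrtr_gt0 ltr0n; near: n; exact: nbhs_infty_gt.
rewrite /= -[leLHS]normrN [in leRHS]gtr0_norm ?divr_gt0// mulrA ler_pdivlMr//.
rewrite -[X in _ * X](gtr0_norm n0) -normrM.
have -> : - (G - (fun k : nat => l / Num.sqrt k%:R)) n * Num.sqrt n%:R =
    l - Num.sqrt n%:R * G n.
  rewrite !fctE mulNr mulrBl divfK ?gt_eqF// opprB [G n * _]mulrC//.
by near: n.
Unshelve. all: by end_near. Qed.

End JointLimit.

Theorem theorem1p1 (R : realType) (E : finType) (P : E -> E -> R)
  (nu : E -> R) (q : E -> probability nat R)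
  (d : measure_display) (T : measurableType d) (Pr : E -> probability T R)
  (X : nat -> T -> E) (xi : E -> nat -> nat -> T -> nat)
  (hP : stochastic P)
  (hX : forall i, markov_chain (Pr i) P i X)
  (hxi : forall i, copies (Pr i) q xi)
  (hindep : forall i, independent (Pr i) X xi)
  (hnu : invariant_probability P nu)
  (hirr : irreducible P) (haper : aperiodic P)
  (hmean : forall i, (0 < 'E_(q i)[fun m : nat => m%:R%R])%E)
  (hmom2 : forall i, ('E_(q i)[fun m : nat => (m%:R ^+ 2)%R] < +oo)%E)
  (hlattice : non_lattice P (rho q))
  (i0 : E) (hk : is_derive (0 : R) 1 (kfun (Pr i0) (rho q) X) 0) :
  exists u : E -> nat -> R,
    (forall i z, 0 < u i z) /\
    forall (i j : E) (z : nat), z <> 0%N ->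
      (fun n : nat =>
         fine (Pr i [set w | (0 < branching X xi z n w)%N /\ X n w = j]))
      ~_\oo
      (fun n : nat => u i z * nu j / Num.sqrt n%:R).
Proof.
have mean0 : \sum_i nu i * rho q i = 0 := drift_eq0 hP (hX i0) hirr hnu hk.
have lim_surv (iz : E * nat) : exists l : R, 0 < l /\ ((0 < iz.2)%N ->
    Num.sqrt n%:R * surv P q n iz.1 iz.2 @[n --> \oo] --> l).
  (* The value 1 at [z = 0] only makes [u] positive everywhere. *)
  case: iz => i [|z]; first by exists 1.
  have [c c0 hc] := survival_abel_cvg hP hmean hmom2 hnu hirr hlattice mean0 i (ltn0Sn z).
  have p01 k : 0 <= surv P q k i z.+1 <= 1.
    by rewrite (surv_ge0 hP)// (surv_le1 hP).
  have [l l0 hl] := monotone_tauberian p01 (surv_noninc hP hmean hmom2 i z.+1) c0 hc.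
  by exists l.
have [u hu] := choice lim_surv.
exists (fun i z => u (i, z)); split=> [i z|i j z z0]; first by case: (hu (i, z)).
have [u0 hl] := hu (i, z); have {}hl := hl ltac:(by rewrite lt0n; apply/eqP).
have nuj0 : 0 < nu j := nu_gt0 hP hirr hnu j.
have [nu_ge0 nu1 _] := hnu.
apply: equiv_invsqrt; first by rewrite mulr_gt0.
pose f e := genfun (q e).
pose g (s : seq E) := 1 - compgen f s ^+ z.
have f_itv e (t : R) : 0 <= t <= 1 -> 0 <= f e t <= 1 := @genfun_itv _ (q e) (hmom2 e) t.
have cg_itv s (t : R) : 0 <= t <= 1 -> 0 <= foldr f t s <= 1.
  by move=> t01; elim: s => //= e s; exact: f_itv.
have le_cg s (t : R) : 0 <= t <= 1 -> foldr f 0 s <= foldr f t s.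
  move=> /andP[t0 t1]; elim: s => //= e s IH; apply: (le_genfun (hmom2 e)) => //.
    by have /andP[] := cg_itv s 0 ltac:(by rewrite lexx ler01).
  by have /andP[] := cg_itv s t ltac:(by rewrite t0).
have z01 : 0 <= (0 : R) <= 1 by rewrite lexx ler01.
have g0 s : 0 <= g s.
  by rewrite subr_ge0; have /andP[] := onem_expr_ge0 z (cg_itv s 0 z01).
(* A further environment replaces the innermost 0 by [f e 0 >= 0], which increases the extinction
   probability. *)
have g_rcons s e : g (rcons s e) <= g s.
  rewrite lerD2l lerN2 /compgen foldr_rcons; apply: lerXn2r.
  - by rewrite nnegrE; have /andP[] := cg_itv s 0 z01.
  - by rewrite nnegrE; have /andP[] := cg_itv s _ (f_itv e 0 z01).
  - by apply: le_cg; exact: f_itv.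
pose G n := pathE P n (fun s => g s * (last i s == j)%:R) i.
have GE : \forall n \near \oo, Num.sqrt n%:R * G n = Num.sqrt n%:R *
    fine (Pr i [set w | (0 < branching X xi z n w)%N /\ X n w = j]).
  exists 1%N => // -[//|n] _.
  by rewrite (survival_law hP (hX i) (hxi i) (hindep i) hmom2).
apply: cvg_trans; first exact: (near_eq_cvg GE).
apply: (@cvg_sandwich _ (fun n => pathE P n g i) G _ _ #|E|%:R) => //.
- rewrite nu_ge0 -nu1 (bigD1 j)//= lerDl; exact: sumr_ge0.
- by move=> n; exact: (pathE_ge0 hP).
move=> eps eps0; have [m hm] := nstep_cvg_nu hP hirr haper hnu eps0.
by exists m => n; apply: (joint_sandwich hP).
Qed.
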